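(* Let $f\not\equiv 0$ be a meromorphic function in $\mathbb{C}$ of order $\sigma(f)=\sigma<1$, and let $\eta$ be a fixed non-zero complex number. Then for any $\varepsilon>0$ there exists a set $E\subset(1,\infty)$ that depends on $f$ and has finite logarithmic measure, such that for all $z$ satisfying $|z|=r\notin E\cup[0,1]$, $$\frac{f(z+\eta)-f(z)}{f(z)}=\eta\,\frac{f'(z)}{f(z)}+O\big(r^{2\sigma-2+\varepsilon}\big).$$
   Context: The order $\sigma(f)$ is the Nevanlinna order $\limsup_{r\to\infty}\log^+ T(r,f)/\log r$, with $T(r,f)$ the Nevanlinna characteristic. A set $E\subset(1,\infty)$ has finite logarithmic measure if $\int_E dr/r<\infty$. The notation $g(z)=O(\psi(r))$ for $|z|=r\notin E\cup[0,1]$ means: there are $r_0>0$ and $K>0$ such that $|g(z)|\le K\psi(r)$ for all $z$ with $|z|=r>r_0$ and $r\notin E\cup[0,1]$. *)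

(* Defs.v *)
(* Conventions: [R : realType] is the field of real numbers, [R[i]] the field of
   complex numbers. *)
From HB Require Import structures.
From mathcomp Require Import all_boot all_order all_algebra.
From mathcomp Require Import all_classical all_reals all_analysis.
From mathcomp Require Import complex.

Set Implicit Arguments.
Unset Strict Implicit.
Unset Printing Implicit Defensive.

Import Order.TTheory GRing.Theory Num.Theory numFieldNormedType.Exports.

Local Open Scope classical_set_scope.
Local Open Scope complex_scope.
Local Open Scope ring_scope.

(* The modulus, as an element of [R]; the norm [`|z|] of the library has values
   in [R[i]]. *)
Definition cabs (R : realType) (z : R[i]) : R := ComplexField.Normc.normc z.

(* The normed-module structure of [R[i]] over itself is carried by [R[i]^o], so
   that [derivable] and [derive1] below are complex differentiability and the
   complex derivative. *)
Definition cderiv (R : realType) (f : R[i] -> R[i]) (z : R[i]) : R[i] :=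
  derive1 (f : R[i]^o -> R[i]^o) z.

Definition holomorphic_at (R : realType) (f : R[i] -> R[i]) (a : R[i]) : Prop :=
  \forall z \near (a : R[i]^o), derivable (f : R[i]^o -> R[i]^o) z 1.

Definition has_pole (R : realType) (f : R[i] -> R[i]) (a : R[i]) (n : nat) : Prop :=
  (0 < n)%N /\
  exists g : R[i] -> R[i],
    [/\ holomorphic_at g a, g a != 0 &
        \forall z \near (a : R[i]^o)^', f z = g z / (z - a) ^+ n].

(* A meromorphic function in the plane is a total function whose values at its
   poles are arbitrary (and play no role); off the poles it is holomorphic. *)
Definition meromorphic (R : realType) (f : R[i] -> R[i]) : Prop :=
  forall a, holomorphic_at f a \/ exists n, has_pole f a n.

(* The order of the pole at [a], and [0] if [a] is not a pole. *)
Definition pole_mult (R : realType) (f : R[i] -> R[i]) (a : R[i]) : nat :=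
  xget 0%N [set n | has_pole f a n].

(* n(t, f) *)
Definition npoles (R : realType) (f : R[i] -> R[i]) (t : R) : \bar R :=
  (\esum_(a in [set a : R[i] | (cabs a <= t)%R]) ((pole_mult f a)%:R)%:E)%E.

(* N(r, f) = int_0^r (n(t, f) - n(0, f)) dt / t + n(0, f) log r *)
Definition pole_counting (R : realType) (f : R[i] -> R[i]) (r : R) : \bar R :=
  (\int[lebesgue_measure]_(t in `]0%R, r]) ((npoles f t - npoles f 0) * (t^-1)%:E)
   + npoles f 0 * (ln r)%:E)%E.

(* Also correct at [x = 0]: [ln 0 = 0] in the library, and log^+ 0 = 0. *)
Definition logplus (R : realType) (x : R) : R := Num.max 0 (ln x).

Definition elogplus (R : realType) (x : \bar R) : \bar R := maxe 0%E (lne x).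

(* r e^(i theta) *)
Definition circle_pt (R : realType) (r theta : R) : R[i] :=
  (r * cos theta) +i* (r * sin theta).

(* m(r, f) = (1 / 2 pi) int_0^(2 pi) log^+ |f(r e^(i theta))| d theta *)
Definition proximity (R : realType) (f : R[i] -> R[i]) (r : R) : \bar R :=
  ((2 * pi)^-1%:E *
   \int[lebesgue_measure]_(theta in `[0%R, (2 * pi)%R])
     (logplus (cabs (f (circle_pt r theta))))%:E)%E.

(* T(r, f) *)
Definition nevanlinna_char (R : realType) (f : R[i] -> R[i]) (r : R) : \bar R :=
  (proximity f r + pole_counting f r)%E.

Definition order_of_growth (R : realType) (f : R[i] -> R[i]) : \bar R :=
  limf_esup (fun r : R => (elogplus (nevanlinna_char f r) * ((ln r)^-1)%:E)%E)
            (pinfty_nbhs R).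

(* Measurability must be asked for: the integral of a nonnegative function over
   a non-measurable set is only a lower integral. *)
Definition finite_log_measure (R : realType) (E : set R) : Prop :=
  measurable (E : set (measurableTypeR R)) /\ (\int[lebesgue_measure]_(r in E) (r^-1)%:E < +oo)%E.

(* g(z) = O(psi(r)) for |z| = r not in A *)
Definition bigO_off (R : realType) (A : set R) (g : R[i] -> R[i]) (psi : R -> R) : Prop :=
  exists r0 K : R, [/\ 0 < r0, 0 < K &
    forall z : R[i], r0 < cabs z -> ~ A (cabs z) ->
      cabs (g z) <= K * psi (cabs z)].

(* Main.v *)
(* Let f have order sigma < 1. In a disc of radius comparable to X = 2^k, divide
   f by the Blaschke factors of its zeros and poles: the quotient is kappa exp(h),
   and the Poisson formula bounds the circle average of |Re h|, and the number of
   zeros, by the proximity function and the number of poles, i.e. by X^(sigma+o(1)).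
   Each factor F (exp h, a Blaschke factor or its inverse) satisfies
     F(z + eta) / F(z) = 1 + eta F'(z) / F(z) + O(y^2 + y |eta| / X),
   where y bounds |eta F'/F|, and this is stable under products if the bounds y
   are added. The total bound is
     Y = O(X^(sigma-1+o(1)) + sum_x 1 / ||z| - x|),
   x running over the moduli of the zeros and poles. The set of radii
   X < r <= 2 X where the sum exceeds X^(sigma-1+e) has measure X^(1-e/2+o(1)),
   hence logarithmic measure X^(-e/2+o(1)), which is summable over X = 2^k; off
   these sets the error is O(Y^2 + Y / X) = O(r^(2 sigma-2+2 e)). *)
Require Import Defs.
From HB Require Import structures.
From mathcomp Require Import all_boot all_order all_algebra.
From mathcomp Require Import all_classical all_reals all_analysis.
From mathcomp Require Import complex.
From mathcomp Require Import ring lra measurable_realfun.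

Set Implicit Arguments.
Unset Strict Implicit.
Unset Printing Implicit Defensive.

Import Order.TTheory GRing.Theory Num.Theory numFieldNormedType.Exports.

Local Open Scope classical_set_scope.
Local Open Scope complex_scope.
Local Open Scope ring_scope.

Local Notation Re := complex.Re.
Local Notation Im := complex.Im.

(** * Complex limits and derivatives *)

Section ComplexModulus.
Variable R : realType.
Implicit Types (z w : R[i]) (x y : R).

(** The hypothesis sigma < 1 enters through smallness: expansions of factors are multiplied only
    while their total bound Y is at most 1/8, and Y has size X^(sigma-1+e), which must tend to 0.
    The same smallness keeps the moduli of the poles more than |eta| away from |z|, so that z + eta
    is not a pole either. The characteristic T(r, f) controls the poles and the positive part of log
    |f| only. The zeros and the negative part are recovered from the Poisson formula at a point z1
    where f is regular and nonzero, fixed once for all scales. It replaces the origin of the usual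
    Jensen formula because f may vanish or have a pole at 0; as |z1| <= r / 8, the Poisson kernel at
    z1 stays between 1/3 and 3, and the change costs only constants and a term |ln |f(z1)||
    depending on f. Since only circle averages of |Re h| are bounded, derivatives of h are read off
    the Schwarz formula, with averages of a majorant in place of maxima. *)

Lemma complex_ext z w : Re z = Re w -> Im z = Im w -> z = w.
Proof. by case: z; case: w => ? ? ? ? /= -> ->. Qed.

Lemma cabsE z : cabs z = Num.sqrt (Re z ^+ 2 + Im z ^+ 2).
Proof. by case: z. Qed.

Lemma normrE_cabs z : `|z| = (cabs z)%:C.
Proof. by rewrite normc_def cabsE. Qed.

Lemma cabs_ge0 z : 0 <= cabs z.
Proof. by rewrite cabsE sqrtr_ge0. Qed.

Lemma cabs0 : cabs (0 : R[i]) = 0.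
Proof. exact: ComplexField.Normc.normc0. Qed.

Lemma cabs1 : cabs (1 : R[i]) = 1.
Proof. exact: ComplexField.Normc.normc1. Qed.

Lemma cabsM z w : cabs (z * w) = cabs z * cabs w.
Proof. exact: ComplexField.Normc.normcM. Qed.

Lemma cabsV z : cabs z^-1 = (cabs z)^-1.
Proof. exact: ComplexField.Normc.normcV. Qed.

Lemma cabs_div z w : cabs (z / w) = cabs z / cabs w.
Proof. by rewrite cabsM cabsV. Qed.

Lemma cabsX z n : cabs (z ^+ n) = cabs z ^+ n.
Proof. by elim: n => [|n IH]; rewrite ?expr0 ?cabs1// !exprS cabsM IH. Qed.

Lemma cabsN z : cabs (- z) = cabs z.
Proof. by rewrite !cabsE; case: z => a b /=; rewrite !sqrrN. Qed.

Lemma cabsBC z w : cabs (z - w) = cabs (w - z).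
Proof. by rewrite -cabsN opprB. Qed.

Lemma cabsD z w : cabs (z + w) <= cabs z + cabs w.
Proof.
rewrite -lecR (_ : _%:C = `|z + w|); last by rewrite normrE_cabs.
by rewrite rmorphD /= -!normrE_cabs ler_normD.
Qed.

Lemma cabsB z w : cabs (z - w) <= cabs z + cabs w.
Proof. by rewrite -(cabsN w); exact: cabsD. Qed.

Lemma cabs_triB z w : cabs z - cabs w <= cabs (z - w).
Proof. by have := cabsD (z - w) w; rewrite subrK; lra. Qed.

Lemma cabs_triD z w : cabs z - cabs w <= cabs (z + w).
Proof. by have := cabs_triB z (- w); rewrite cabsN opprK. Qed.

Lemma cabs_eq0 z : (cabs z == 0) = (z == 0).
Proof.
apply/eqP/eqP => [|->]; last exact: cabs0.
exact: ComplexField.Normc.eq0_normc.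
Qed.

Lemma cabs_gt0 z : (0 < cabs z) = (z != 0).
Proof. by rewrite lt_neqAle cabs_ge0 andbT eq_sym cabs_eq0. Qed.

Lemma cabsR x : cabs x%:C = `|x|.
Proof. by rewrite cabsE /= expr0n addr0 sqrtr_sqr. Qed.

Lemma cabs_i : cabs ('i%C : R[i]) = 1.
Proof. by rewrite cabsE /= expr0n add0r expr1n sqrtr1. Qed.

Lemma cabsJ z : cabs z^* = cabs z.
Proof. by rewrite !cabsE; case: z => a b /=; rewrite sqrrN. Qed.

Lemma Re_cabs z : `|Re z| <= cabs z.
Proof. by rewrite cabsE -sqrtr_sqr ler_wsqrtr// lerDl sqr_ge0. Qed.

Lemma Im_cabs z : `|Im z| <= cabs z.
Proof. by rewrite cabsE -sqrtr_sqr ler_wsqrtr// lerDr sqr_ge0. Qed.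

Lemma cabs_le_ReIm z : cabs z <= `|Re z| + `|Im z|.
Proof.
have -> : z = (Re z)%:C + 'i%C * (Im z)%:C by exact: complexE.
apply: le_trans (cabsD _ _) _; rewrite cabsM cabs_i mul1r !cabsR.
by case: z => a b /=; rewrite !mul0r !mul1r !subr0 !addr0 !add0r.
Qed.

Lemma sqr_cabs z : cabs z ^+ 2 = Re z ^+ 2 + Im z ^+ 2.
Proof. by rewrite cabsE sqr_sqrtr// addr_ge0 ?sqr_ge0. Qed.

Lemma mul_conjc z : z * z^* = (cabs z ^+ 2)%:C.
Proof.
by rewrite sqr_cabs; case: z => a b; apply: complex_ext; rewrite /=; ring.
Qed.

Lemma cconjM z w : (z * w)^* = z^* * w^*.
Proof. by case: z => a b; case: w => c d; apply: complex_ext; rewrite /=; ring. Qed.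

Lemma cconj_inj z w : z^* = w^* -> z = w.
Proof. by case: z => a b; case: w => c d /= [-> /oppr_inj ->]. Qed.

Lemma cconjK z : (z^*)^* = z.
Proof. exact: conjCK. Qed.

Lemma cconjR x : (x%:C)^* = x%:C.
Proof. by apply: complex_ext; rewrite /= ?oppr0. Qed.

Lemma cabs_prod_seq (T : Type) (s : seq T) (F : T -> R[i]) :
  cabs (\prod_(i <- s) F i) = \prod_(i <- s) cabs (F i).
Proof.
elim: s => [|a s IH]; first by rewrite !big_nil cabs1.
by rewrite !big_cons cabsM IH.
Qed.

Lemma cReD z w : Re (z + w) = Re z + Re w. Proof. by case: z; case: w. Qed.
Lemma cImD z w : Im (z + w) = Im z + Im w. Proof. by case: z; case: w. Qed.
Lemma cReB z w : Re (z - w) = Re z - Re w. Proof. by case: z; case: w. Qed.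
Lemma cImB z w : Im (z - w) = Im z - Im w. Proof. by case: z; case: w. Qed.
Lemma cReM z w : Re (z * w) = Re z * Re w - Im z * Im w.
Proof. by case: z; case: w. Qed.
Lemma cImM z w : Im (z * w) = Re z * Im w + Im z * Re w.
Proof. by case: z; case: w. Qed.

Lemma cabs_eq_small z : (forall e : R, 0 < e -> cabs z <= e) -> z = 0.
Proof.
move=> H; apply/eqP; rewrite -cabs_eq0 eq_le cabs_ge0 andbT.
by apply/ler_addgt0Pl => e e0; rewrite addr0; exact: H.
Qed.

Lemma nbhs_cabsP z (P : set R[i]) :
  (\forall w \near (z : R[i]^o), P w) <->
  exists2 d : R, 0 < d & forall w, cabs (w - z) < d -> P w.
Proof.
split.
  (* A positive radius in [R[i]] is real: the order of [R[i]] forces its imaginary part to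
     vanish. *)
  move=> /nbhs_ballP[e /= e0 H]; have e0' := e0; rewrite ltcE /= in e0'.
  case/andP: e0' => /eqP ie re; exists (Re e) => // w wz; apply: H.
  rewrite /ball /= distrC normrE_cabs.
  have -> : e = (Re e)%:C by case: (e) ie => ? ? /= ->.
  by rewrite ltcR.
move=> [d d0 H]; apply/nbhs_ballP; exists d%:C; first by rewrite /= ltcR.
by move=> w; rewrite /ball /= distrC normrE_cabs ltcR; exact: H.
Qed.

Lemma dnbhs_cabsP z (P : set R[i]) :
  (\forall w \near (z : R[i]^o)^', P w) <->
  exists2 d : R, 0 < d & forall w, cabs (w - z) < d -> w != z -> P w.
Proof.
by rewrite /dnbhs /within /=; exact: nbhs_cabsP.
Qed.

End ComplexModulus.

Section Limits.
Variable R : realType.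

(** Convergence with a real epsilon and the real modulus [cabs], because the norm of [R[i]^o] is
    itself complex valued. The filter is arbitrary, so that functions of a complex variable and
    paths share the same algebra of limits. *)
Definition clim (T : Type) (Fl : set_system T) (phi : T -> R[i]) (l : R[i]) :=
  forall e : R, 0 < e -> \forall x \near Fl, cabs (phi x - l) <= e.

Section Filter.
Variables (T : Type) (Fl : set_system T).
Hypothesis FF : Filter Fl.
Implicit Types (phi psi : T -> R[i]) (l m : R[i]).

Lemma clim_cst l : clim Fl (fun=> l) l.
Proof. by move=> e e0; apply: nearW => x; rewrite subrr cabs0 ltW. Qed.

Lemma climD phi psi l m : clim Fl phi l -> clim Fl psi m ->
  clim Fl (fun x => phi x + psi x) (l + m).
Proof.
move=> H K e e0; have e2 : 0 < e / 2 by lra.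
apply: filterS2 (H _ e2) (K _ e2) => x Hx Kx.
by rewrite (_ : _ - _ = (phi x - l) + (psi x - m)); [apply: le_trans (cabsD _ _) _; lra | ring].
Qed.

Lemma climN phi l : clim Fl phi l -> clim Fl (fun x => - phi x) (- l).
Proof.
by move=> H e e0; apply: filterS (H _ e0) => x; rewrite -opprD cabsN.
Qed.

Lemma climB phi psi l m : clim Fl phi l -> clim Fl psi m ->
  clim Fl (fun x => phi x - psi x) (l - m).
Proof. by move=> H /climN; exact: climD. Qed.

Lemma climM phi psi l m : clim Fl phi l -> clim Fl psi m ->
  clim Fl (fun x => phi x * psi x) (l * m).
Proof.
move=> H K e e0; pose A := cabs l + cabs m + 1.
have A0 : 1 <= A by rewrite /A; have := cabs_ge0 l; have := cabs_ge0 m; lra.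
pose d := Num.min 1 (e / (2 * A)).
have d0 : 0 < d by rewrite lt_min ltr01 divr_gt0// mulr_gt0//; lra.
have dA : 2 * A * d <= e.
  rewrite -ler_pdivlMl; last by rewrite mulr_gt0//; lra.
  by rewrite mulrC ge_min lexx orbT.
have d1 : d <= 1 by rewrite ge_min lexx.
apply: filterS2 (H _ d0) (K _ d0) => x Hx Kx.
rewrite (_ : _ - _ = (phi x - l) * (psi x - m) + ((phi x - l) * m + l * (psi x - m))); last by ring.
apply: le_trans (cabsD _ _) _; apply: le_trans (lerD (lexx _) (cabsD _ _)) _.
rewrite !cabsM; have := cabs_ge0 (phi x - l); have := cabs_ge0 (psi x - m).
have := cabs_ge0 l; have := cabs_ge0 m; rewrite /A in dA A0; move: dA A0 Hx Kx d1 d0.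
set a := cabs (_ - l); set b := cabs (_ - m); set c := cabs l; set f := cabs m.
move: d => d *; have : a * b <= d * 1 by rewrite ler_pM//; lra.
have : a * f <= d * f by rewrite ler_wpM2r.
have : c * b <= c * d by rewrite ler_wpM2l.
by nra.
Qed.

Lemma climV phi l : l != 0 -> clim Fl phi l -> clim Fl (fun x => (phi x)^-1) l^-1.
Proof.
move=> l0 H e e0; have L0 : 0 < cabs l by rewrite cabs_gt0.
pose d := Num.min (cabs l / 2) (e * cabs l ^+ 2 / 2).
have d0 : 0 < d by rewrite lt_min !divr_gt0// mulr_gt0// exprn_gt0.
apply: filterS (H _ d0) => x Hx.
have h1 : cabs (phi x - l) <= cabs l / 2 by apply: le_trans Hx _; rewrite ge_min lexx.
have h2 : cabs (phi x - l) <= e * cabs l ^+ 2 / 2.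
  by apply: le_trans Hx _; rewrite ge_min lexx orbT.
have h3 : cabs l / 2 <= cabs (phi x).
  by have := cabs_triB l (l - phi x); rewrite cabsBC in h1; rewrite subKr; lra.
have p0 : phi x != 0 by rewrite -cabs_gt0; lra.
rewrite (_ : _ - _ = (l - phi x) / (phi x * l)); last by field; rewrite l0 p0.
rewrite cabs_div cabsM cabsBC ler_pdivrMr; last by rewrite mulr_gt0//; lra.
apply: le_trans h2 _; rewrite -mulrA ler_pM2l// expr2.
by have := ler_wpM2r (cabs_ge0 l) h3; lra.
Qed.

End Filter.

Definition ccont (F : R[i] -> R[i]) z := clim (nbhs (z : R[i]^o)) F (F z).
Definition pcont (phi : R -> R[i]) t := clim (nbhs t) phi (phi t).

Lemma ccontP F z : ccont F z <->
  forall e : R, 0 < e -> exists2 d : R, 0 < d & forall w, cabs (w - z) < d -> cabs (F w - F z) <= e.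
Proof. by split=> H e /H /nbhs_cabsP. Qed.

Lemma ccont_cst c z : ccont (fun=> c) z. Proof. exact: clim_cst. Qed.
Lemma ccont_id z : ccont id z.
Proof. by apply/ccontP => e e0; exists e => // w /ltW. Qed.
Lemma ccontD F G z : ccont F z -> ccont G z -> ccont (fun w => F w + G w) z.
Proof. exact: climD. Qed.
Lemma ccontB F G z : ccont F z -> ccont G z -> ccont (fun w => F w - G w) z.
Proof. exact: climB. Qed.
Lemma ccontM F G z : ccont F z -> ccont G z -> ccont (fun w => F w * G w) z.
Proof. exact: climM. Qed.
Lemma ccontV F z : F z != 0 -> ccont F z -> ccont (fun w => (F w)^-1) z.
Proof. exact: climV. Qed.

Lemma clim_comp T (Fl : set_system T) (FF : Filter Fl) (phi : T -> R[i]) l F :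
  clim Fl phi l -> ccont F l -> clim Fl (fun x => F (phi x)) (F l).
Proof.
move=> H /ccontP K e /K[d d0 Kd]; have d2 : 0 < d / 2 by lra.
by apply: filterS (H _ d2) => x Hx; apply: Kd; lra.
Qed.

Lemma ccont_comp G F z : ccont G z -> ccont F (G z) -> ccont (F \o G) z.
Proof. exact: clim_comp. Qed.

Lemma clim_Re T (Fl : set_system T) (FF : Filter Fl) (phi : T -> R[i]) l :
  clim Fl phi l -> (Re (phi x)) @[x --> Fl] --> Re l.
Proof.
move=> H; apply/cvgrPdist_le => e /H; apply: filterS => x; apply: le_trans.
by rewrite -cReB cabsBC; exact: Re_cabs.
Qed.

Lemma clim_Im T (Fl : set_system T) (FF : Filter Fl) (phi : T -> R[i]) l :
  clim Fl phi l -> (Im (phi x)) @[x --> Fl] --> Im l.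
Proof.
move=> H; apply/cvgrPdist_le => e /H; apply: filterS => x; apply: le_trans.
by rewrite -cImB cabsBC; exact: Im_cabs.
Qed.

Lemma clim_ReIm T (Fl : set_system T) (FF : Filter Fl) (phi : T -> R[i]) l :
  (Re (phi x)) @[x --> Fl] --> Re l -> (Im (phi x)) @[x --> Fl] --> Im l -> clim Fl phi l.
Proof.
move=> /cvgrPdist_le H /cvgrPdist_le K e e0; have e2 : 0 < e / 2 by lra.
apply: filterS2 (H _ e2) (K _ e2) => x Hx Kx; rewrite cabsBC.
by apply: le_trans (cabs_le_ReIm _) _; rewrite cReB cImB; lra.
Qed.

End Limits.

Section Derivative.
Variable R : realType.
Implicit Types (F G : R[i] -> R[i]) (z w l m : R[i]).

(** Increment form of the complex derivative: with no division, h = 0 is allowed and remainders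
    combine by the triangle inequality. [cderP] identifies it with the derivative of the
    statement. *)
Definition cder F z l := forall e : R, 0 < e -> exists2 d : R, 0 < d &
  forall h, cabs h < d -> cabs (F (z + h) - F z - l * h) <= e * cabs h.

Definition cdiff F z := exists l, cder F z l.

Lemma cder_quad F z l (K d : R) : 0 < d ->
  (forall h, cabs h < d -> cabs (F (z + h) - F z - l * h) <= K * cabs h ^+ 2) ->
  cder F z l.
Proof.
move=> d0 H e e0; pose K' := Num.max K 1.
have K0 : 0 < K' by rewrite lt_max ltr01 orbT.
exists (Num.min d (e / K')); first by rewrite lt_min d0 divr_gt0.
move=> h; rewrite lt_min => /andP[hd he]; apply: le_trans (H _ hd) _.
rewrite expr2 mulrA ler_wpM2r ?cabs_ge0//.
apply: (@le_trans _ _ (K' * cabs h)).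
  by rewrite ler_wpM2r ?cabs_ge0// le_max lexx.
by rewrite mulrC -ler_pdivlMr// ltW.
Qed.

Lemma cder_lip F z l : cder F z l -> exists2 d : R, 0 < d &
  forall h, cabs h < d -> cabs (F (z + h) - F z) <= (cabs l + 1) * cabs h.
Proof.
move=> /(_ 1 ltr01)[d d0 H]; exists d => // h /H hd.
have := cabsD (F (z + h) - F z - l * h) (l * h); rewrite subrK cabsM.
by rewrite mulrDl; lra.
Qed.

Lemma cder_ccont F z l : cder F z l -> ccont F z.
Proof.
move=> /cder_lip[d d0 H]; apply/ccontP => e e0.
have L0 : 0 < cabs l + 1 by have := cabs_ge0 l; lra.
exists (Num.min d (e / (cabs l + 1))); first by rewrite lt_min d0 divr_gt0.
move=> w; rewrite lt_min => /andP[wd we].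
rewrite -[w](subrKC z); apply: le_trans (H _ wd) _.
by rewrite mulrC -ler_pdivlMr// ltW.
Qed.

Lemma cdiff_ccont F z : cdiff F z -> ccont F z.
Proof. by case=> l /cder_ccont. Qed.

Lemma cder_eq F G z l (d : R) : 0 < d -> (forall w, cabs (w - z) < d -> F w = G w) ->
  cder F z l -> cder G z l.
Proof.
move=> d0 E H e /H[d' d0' K]; exists (Num.min d d'); first by rewrite lt_min d0.
move=> h; rewrite lt_min => /andP[h1 h2]; rewrite -!E ?subrr ?cabs0//; first exact: K.
by rewrite addrC addKr.
Qed.

Lemma cder_cst c z : cder (fun=> c) z 0.
Proof.
by apply: (@cder_quad _ _ _ 1 1) => // h _; rewrite subrr mul0r subrr cabs0 mul1r sqr_ge0.
Qed.

Lemma cder_id z : cder id z 1.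
Proof.
apply: (@cder_quad _ _ _ 1 1) => // h _.
by rewrite /= (_ : _ - _ = 0) ?cabs0 ?mul1r ?sqr_ge0//; ring.
Qed.

Lemma cderD F G z l m : cder F z l -> cder G z m -> cder (fun w => F w + G w) z (l + m).
Proof.
move=> H K e e0; have e2 : 0 < e / 2 by lra.
have [d d0 Hd] := H _ e2; have [d' d0' Kd] := K _ e2.
exists (Num.min d d'); first by rewrite lt_min d0.
move=> h; rewrite lt_min => /andP[/Hd h1 /Kd h2].
rewrite (_ : _ - _ = (F (z + h) - F z - l * h) + (G (z + h) - G z - m * h)); last by ring.
by apply: le_trans (cabsD _ _) _; lra.
Qed.

Lemma cder_comp F G z l m : cder G z m -> cder F (G z) l -> cder (F \o G) z (l * m).
Proof.
move=> K H e e0; have [d1 d10 K1] := cder_lip K.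
have M0 : 0 < cabs m + 1 by have := cabs_ge0 m; lra.
have L0 : 0 < cabs l + 1 by have := cabs_ge0 l; lra.
have e1 : 0 < e / 2 / (cabs m + 1) by rewrite !divr_gt0.
have e2 : 0 < e / 2 / (cabs l + 1) by rewrite !divr_gt0.
have [d2 d20 H2] := H _ e1; have [d3 d30 K3] := K _ e2.
exists (Num.min d1 (Num.min d3 (d2 / (cabs m + 1)))).
  by rewrite !lt_min d10 d30 divr_gt0.
move=> h; rewrite !lt_min => /andP[h1 /andP[h3 h2]] /=.
have k1 := K1 _ h1; have k3 := K3 _ h3.
have k2 : cabs (G (z + h) - G z) < d2.
  by apply: le_lt_trans k1 _; rewrite mulrC -ltr_pdivlMr.
have := H2 _ k2; rewrite subrKC => q2.
rewrite (_ : _ - _ = (F (G (z + h)) - F (G z) - l * (G (z + h) - G z)) + l * (G (z + h) - G z - m * h)); last by ring.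
apply: le_trans (cabsD _ _) _; rewrite cabsM.
have a1 : e / 2 / (cabs m + 1) * cabs (G (z + h) - G z) <= e / 2 * cabs h.
  rewrite -mulrA; apply: ler_wpM2l; first by lra.
  by rewrite mulrC ler_pdivrMr// mulrC.
have a2 : cabs l * cabs (G (z + h) - G z - m * h) <= e / 2 * cabs h.
  apply: le_trans (ler_wpM2l (cabs_ge0 _) k3) _.
  rewrite mulrA ler_wpM2r ?cabs_ge0// [cabs l * _]mulrA ler_pdivrMr//.
  by have := cabs_ge0 l; nra.
by lra.
Qed.

Lemma cderM F G z l m : cder F z l -> cder G z m ->
  cder (fun w => F w * G w) z (l * G z + F z * m).
Proof.
move=> H K e e0; have [d1 d10 K1] := cder_lip K; have [d4 d40 K4] := cder_lip H.
have [d2 d20 H2] := H _ ltr01; have [d3 d30 K3] := K _ ltr01.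
pose A := cabs (F z) + cabs (G z) + 1.
have A0 : 1 <= A by rewrite /A; have := cabs_ge0 (F z); have := cabs_ge0 (G z); lra.
have e3 : 0 < e / (3 * A) by rewrite divr_gt0// mulr_gt0//; lra.
pose B := (cabs m + 1) * (cabs l + 1).
have B0 : 1 <= B by rewrite /B; have := cabs_ge0 m; have := cabs_ge0 l; nra.
have [d5 d50 H5] := H _ e3; have [d6 d60 K6] := K _ e3.
exists (Num.min (Num.min d1 d4) (Num.min (Num.min d5 d6) (e / (3 * B)))).
  by rewrite !lt_min d10 d40 d50 d60 divr_gt0//; lra.
move=> h; rewrite !lt_min => /andP[/andP[h1 h4] /andP[/andP[h5 h6] h7]].
have k1 := K1 _ h1; have k4 := K4 _ h4; have k5 := H5 _ h5; have k6 := K6 _ h6.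
rewrite (_ : _ - _ = (F (z + h) - F z - l * h) * G z + (F z * (G (z + h) - G z - m * h)
   + (F (z + h) - F z) * (G (z + h) - G z))); last by ring.
apply: le_trans (cabsD _ _) _; apply: le_trans (lerD (lexx _) (cabsD _ _)) _.
rewrite !cabsM.
have h0 := cabs_ge0 h.
have aux (x y : R) : 0 <= y -> y <= A -> 0 <= x -> x <= e / (3 * A) * cabs h -> x * y <= e / 3 * cabs h.
  move=> y0 yA x0 xe; apply: le_trans (ler_pM x0 y0 xe yA) _.
  by rewrite le_eqVlt; apply/orP; left; apply/eqP; field; lra.
have a1 : cabs (F (z + h) - F z - l * h) * cabs (G z) <= e / 3 * cabs h.
  by apply: aux => //; rewrite ?cabs_ge0// /A; have := cabs_ge0 (F z); lra.
have a2 : cabs (F z) * cabs (G (z + h) - G z - m * h) <= e / 3 * cabs h.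
  by rewrite mulrC; apply: aux => //; rewrite ?cabs_ge0// /A; have := cabs_ge0 (G z); lra.
have a3 : cabs (F (z + h) - F z) * cabs (G (z + h) - G z) <= e / 3 * cabs h.
  apply: le_trans (ler_pM (cabs_ge0 _) (cabs_ge0 _) k4 k1) _.
  have -> : (cabs l + 1) * cabs h * ((cabs m + 1) * cabs h) = (B * cabs h) * cabs h by rewrite /B; ring.
  rewrite ler_wpM2r// mulrC -ler_pdivlMr; last by lra.
  by rewrite (_ : e / 3 / B = e / (3 * B)) ?ltW//; field; lra.
by lra.
Qed.

Lemma cderZ c F z l : cder F z l -> cder (fun w => c * F w) z (c * l).
Proof. by move=> H; have := cderM (cder_cst c z) H; rewrite mul0r add0r. Qed.

Lemma cderN F z l : cder F z l -> cder (fun w => - F w) z (- l).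
Proof.
move=> /(cderZ (-1)); rewrite mulN1r; apply: (@cder_eq _ _ _ _ 1) => // w _.
by rewrite mulN1r.
Qed.

Lemma cderB F G z l m : cder F z l -> cder G z m -> cder (fun w => F w - G w) z (l - m).
Proof. by move=> H /cderN; exact: cderD. Qed.

Lemma cder_inv z : z != 0 -> cder (fun w => w^-1) z (- z ^- 2).
Proof.
move=> z0; have Z0 : 0 < cabs z by rewrite cabs_gt0.
apply: (@cder_quad _ _ _ (2 / cabs z ^+ 3) (cabs z / 2)); first by rewrite divr_gt0.
move=> h hz; have k : cabs z / 2 <= cabs (z + h) by have := cabs_triD z h; lra.
have zh : z + h != 0 by rewrite -cabs_gt0; lra.
rewrite (_ : _ - _ = h ^+ 2 / (z ^+ 2 * (z + h))); last by field; rewrite z0 zh.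
rewrite cabs_div cabsM !cabsX mulrC ler_wpM2r ?sqr_ge0//.
rewrite (_ : 2 / cabs z ^+ 3 = (cabs z ^+ 2 * (cabs z / 2))^-1); last by field; lra.
rewrite lef_pV2 ?posrE ?mulr_gt0 ?exprn_gt0//; try by lra.
by rewrite ler_wpM2l// exprn_ge0 ?cabs_ge0.
Qed.

Lemma cderV F z l : F z != 0 -> cder F z l -> cder (fun w => (F w)^-1) z (- l / F z ^+ 2).
Proof.
move=> Fz H; have := cder_comp H (cder_inv Fz); congr cder.
by rewrite mulNr mulrC mulNr.
Qed.

Lemma cdiff_cst c z : cdiff (fun=> c) z. Proof. by exists 0; exact: cder_cst. Qed.
Lemma cdiff_id z : cdiff id z. Proof. by exists 1; exact: cder_id. Qed.
Lemma cdiffD F G z : cdiff F z -> cdiff G z -> cdiff (fun w => F w + G w) z.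
Proof. by move=> [l H] [m K]; exists (l + m); exact: cderD. Qed.
Lemma cdiffB F G z : cdiff F z -> cdiff G z -> cdiff (fun w => F w - G w) z.
Proof. by move=> [l H] [m K]; exists (l - m); exact: cderB. Qed.
Lemma cdiffM F G z : cdiff F z -> cdiff G z -> cdiff (fun w => F w * G w) z.
Proof. by move=> [l H] [m K]; eexists; exact: cderM H K. Qed.
Lemma cdiffV F z : F z != 0 -> cdiff F z -> cdiff (fun w => (F w)^-1) z.
Proof. by move=> Fz [l H]; eexists; exact: cderV Fz H. Qed.
Lemma cdiff_eq F G z (d : R) : 0 < d -> (forall w, cabs (w - z) < d -> F w = G w) ->
  cdiff F z -> cdiff G z.
Proof. by move=> d0 E [l H]; exists l; exact: cder_eq d0 E H. Qed.
Lemma cdiffX F n z : cdiff F z -> cdiff (fun w => F w ^+ n) z.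
Proof.
move=> H; elim: n => [|n IH]; first exact: (@cdiff_eq (fun=> 1) _ _ 1 ltr01 _ (cdiff_cst 1 z)).
by apply: (@cdiff_eq (fun w => F w * F w ^+ n) _ _ 1 ltr01 _ (cdiffM H IH)) => w _; rewrite exprS.
Qed.
Lemma cdiff_prod (T : Type) (s : seq T) (F : T -> R[i] -> R[i]) z :
  (forall a, cdiff (F a) z) -> cdiff (fun w => \prod_(a <- s) F a w) z.
Proof.
move=> H; elim: s => [|a s IH].
  by apply: (@cdiff_eq (fun=> 1) _ _ 1 ltr01 _ (cdiff_cst 1 z)) => w _; rewrite big_nil.
apply: (@cdiff_eq (fun w => F a w * \prod_(b <- s) F b w) _ _ 1 ltr01 _ (cdiffM (H a) IH)) => w _.
by rewrite big_cons.
Qed.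

Lemma cderP F z l : cder F z l <-> is_derive (z : R[i]^o) 1 (F : R[i]^o -> R[i]^o) l.
Proof.
split=> [H|[/cvg_ex[l' Hl] <-]].
  apply: DeriveDef.
    apply/cvg_ex; exists l; apply/cvgrPdist_le => e e0.
    have e0' := e0; rewrite ltcE /= in e0'; case/andP: e0' => /eqP ie re.
    have [d d0 K] := H _ re; apply/dnbhs_cabsP; exists d => // h; rewrite subr0 => hd h0.
    rewrite distrC normrE_cabs (_ : e = (Re e)%:C); last by case: (e) ie => ? ? /= ->.
    have h1 : 0 < cabs h by rewrite cabs_gt0.
    rewrite lecR -(ler_pM2r h1) -cabsM /= (_ : (_ - _) * h = F (z + h) - F z - l * h) ?K//.
    by rewrite /GRing.scale /= mulr1 [h + z]addrC; field.
  rewrite /derive; apply/cvg_lim => //.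
  apply/cvgrPdist_le => e e0.
  have e0' := e0; rewrite ltcE /= in e0'; case/andP: e0' => /eqP ie re.
  have [d d0 K] := H _ re; apply/dnbhs_cabsP; exists d => // h; rewrite subr0 => hd h0.
  rewrite distrC normrE_cabs (_ : e = (Re e)%:C); last by case: (e) ie => ? ? /= ->.
  have h1 : 0 < cabs h by rewrite cabs_gt0.
  rewrite lecR -(ler_pM2r h1) -cabsM /= (_ : (_ - _) * h = F (z + h) - F z - l * h) ?K//.
  by rewrite /GRing.scale /= mulr1 [h + z]addrC; field.
rewrite /derive (cvg_lim _ Hl)//.
move=> e e0; move/cvgrPdist_le : Hl => /(_ e%:C); rewrite ltcR => /(_ e0).
move=> /dnbhs_cabsP[d d0 K]; exists d => // h hd.
have [->|h0] := eqVneq h 0; first by rewrite addr0 subrr mulr0 subrr cabs0 mulr0.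
have := K h; rewrite subr0 => /(_ hd h0); rewrite distrC normrE_cabs lecR.
have h1 : 0 < cabs h by rewrite cabs_gt0.
rewrite -(ler_pM2r h1) -cabsM /= (_ : (_ - _) * h = F (z + h) - F z - l' * h)//.
by rewrite /GRing.scale /= mulr1 [h + z]addrC; field.
Qed.

Lemma derivable_cdiff F z : derivable (F : R[i]^o -> R[i]^o) z 1 <-> cdiff F z.
Proof.
split; first by move=> /derivableP /cderP H; eexists; exact: H.
by case=> l /cderP[].
Qed.

Lemma cder_cderiv F z l : cder F z l -> cderiv F z = l.
Proof. by move=> /cderP [_ H]; rewrite /cderiv derive1E. Qed.

Lemma holomorphic_atP F z : holomorphic_at F z <->
  exists2 d : R, 0 < d & forall w, cabs (w - z) < d -> cdiff F w.
Proof.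
split; first by move=> /nbhs_cabsP[d d0 H]; exists d => // w /H /derivable_cdiff.
by move=> [d d0 H]; apply/nbhs_cabsP; exists d => // w /H /derivable_cdiff.
Qed.

End Derivative.

(** * Goursat's lemma and the mean value property *)

Section PathIntegral.
Variable R : realType.
Implicit Types (a b c t : R) (phi psi : R -> R[i]) (g h : R -> R).
Local Notation mu := (@lebesgue_measure R).

Definition rint a b g : R := \int[mu]_(t in `[a, b]) g t.

(** Continuity is two-sided even at the ends a and b, so that no one-sided limits have to be carried
    along. *)
Definition rcon a b g := forall t, a <= t <= b -> g x @[x --> t] --> g t.

Lemma rcon_integrable a b g : rcon a b g -> mu.-integrable `[a, b] (EFin \o g).
Proof.
move=> H; apply: continuous_compact_integrable; first exact: segment_compact.
apply/continuous_in_subspaceT => t; rewrite inE /= in_itv /= => tab.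
exact: H.
Qed.

Lemma rint_eq a b g h : (forall t, a <= t <= b -> g t = h t) -> rint a b g = rint a b h.
Proof.
by move=> E; apply: eq_Rintegral => t; rewrite inE /= in_itv /=; exact: E.
Qed.

Lemma rintD a b g h : rcon a b g -> rcon a b h ->
  rint a b (fun t => g t + h t) = rint a b g + rint a b h.
Proof. by move=> /rcon_integrable ? /rcon_integrable ?; exact: RintegralD. Qed.

Lemma rintB a b g h : rcon a b g -> rcon a b h ->
  rint a b (fun t => g t - h t) = rint a b g - rint a b h.
Proof. by move=> /rcon_integrable ? /rcon_integrable ?; exact: RintegralB. Qed.

Lemma rintZ a b k g : rcon a b g -> rint a b (fun t => k * g t) = k * rint a b g.
Proof. by move=> /rcon_integrable ?; exact: RintegralZl. Qed.

Lemma rint_cst a b k : a <= b -> rint a b (fun=> k) = k * (b - a).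
Proof.
move=> ab; rewrite /rint Rintegral_cst//= lebesgue_measure_itv /= lte_fin.
by case: ltgtP ab => // -> _; rewrite subrr.
Qed.

Lemma rint_le a b g h : rcon a b g -> rcon a b h ->
  (forall t, a <= t <= b -> g t <= h t) -> rint a b g <= rint a b h.
Proof.
by move=> /rcon_integrable ? /rcon_integrable ? E; exact: le_Rintegral.
Qed.

Lemma rint_ge0 a b g : (forall t, a <= t <= b -> 0 <= g t) -> 0 <= rint a b g.
Proof. by move=> E; apply: Rintegral_ge0 => t; rewrite /= in_itv /=; exact: E. Qed.

Lemma rcon_cst a b k : rcon a b (fun=> k).
Proof. by move=> t _; exact: cvg_cst. Qed.

Lemma rconD a b g h : rcon a b g -> rcon a b h -> rcon a b (fun t => g t + h t).
Proof. by move=> H K t tab; apply: cvgD; [exact: H|exact: K]. Qed.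

Lemma rconZ a b k g : rcon a b g -> rcon a b (fun t => k * g t).
Proof. by move=> H t tab; apply: cvgM; [exact: cvg_cst|exact: H]. Qed.

Lemma rconM a b g h : rcon a b g -> rcon a b h -> rcon a b (fun t => g t * h t).
Proof. by move=> H K t tab; apply: cvgM; [exact: H|exact: K]. Qed.

Lemma rcon_norm a b g : rcon a b g -> rcon a b (fun t => `|g t|).
Proof. by move=> H t tab; apply: cvg_norm; exact: H. Qed.

Lemma rint_normr a b g : rcon a b g -> `|rint a b g| <= rint a b (fun t => `|g t|).
Proof. by move=> /rcon_integrable ?; exact: le_normr_Rintegral. Qed.

Lemma rint_split a b c g : a <= c -> c <= b -> rcon a b g ->
  rint a b g = rint a c g + rint c b g.
Proof.
move=> ac cb H; have I := rcon_integrable H.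
have I' : mu.-integrable `]c, b] (EFin \o g).
  apply: integrableS I => // t; rewrite /= !in_itv /= => /andP[ct ->].
  by rewrite (le_trans ac (ltW ct)).
rewrite /rint -(@Rintegral_itv_obnd_cbnd _ c)//.
by rewrite -(@Rintegral_itvB _ g (BLeft a) (BRight b) c) ?bnd_simp// subrKC.
Qed.

Lemma rint_point a g : rint a a g = 0.
Proof. by rewrite /rint set_itv1 Rintegral_set1. Qed.

Lemma rint_FTC a b g G : a <= b -> rcon a b g ->
  (forall t, a <= t <= b -> is_derive t 1 G (g t)) -> rint a b g = G b - G a.
Proof.
rewrite le_eqVlt => /orP[/eqP-> _ _|ab cg dG]; first by rewrite rint_point subrr.
have cG t : a <= t <= b -> G x @[x --> t] --> G t.
  move=> /dG [dt _]; apply/differentiable_continuous; exact/derivable1_diffP.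
rewrite /rint /Rintegral (@continuous_FTC2 _ g G)//.
- apply/continuous_in_subspaceT => t; rewrite inE /= in_itv /= => tab.
  exact: cg.
- split.
  + by move=> t; rewrite in_itv /= => /andP[? ?]; case: (dG t) => //; rewrite !ltW.
  + by apply: cvg_at_right_filter; apply: cG; rewrite lexx ltW.
  + by apply: cvg_at_left_filter; apply: cG; rewrite lexx ltW.
- move=> t; rewrite in_itv /= => /andP[? ?]; rewrite derive1E.
  by case: (dG t) => //; rewrite !ltW.
Qed.

Definition cint a b phi : R[i] :=
  rint a b (fun t => Re (phi t)) +i* rint a b (fun t => Im (phi t)).

Definition pcon a b phi := forall t, a <= t <= b -> pcont phi t.

Lemma pcon_Re a b phi : pcon a b phi -> rcon a b (fun t => Re (phi t)).
Proof. by move=> H t /H; exact: clim_Re. Qed.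

Lemma pcon_Im a b phi : pcon a b phi -> rcon a b (fun t => Im (phi t)).
Proof. by move=> H t /H; exact: clim_Im. Qed.

Lemma pcon_cst a b k : pcon a b (fun=> k).
Proof. by move=> t _; exact: clim_cst. Qed.
Lemma pconD a b phi psi : pcon a b phi -> pcon a b psi -> pcon a b (fun t => phi t + psi t).
Proof. by move=> H K t tab; apply: climD; [exact: H|exact: K]. Qed.
Lemma pconB a b phi psi : pcon a b phi -> pcon a b psi -> pcon a b (fun t => phi t - psi t).
Proof. by move=> H K t tab; apply: climB; [exact: H|exact: K]. Qed.
Lemma pconM a b phi psi : pcon a b phi -> pcon a b psi -> pcon a b (fun t => phi t * psi t).
Proof. by move=> H K t tab; apply: climM; [exact: H|exact: K]. Qed.

Lemma pcon_comp a b phi F : pcon a b phi -> (forall t, a <= t <= b -> ccont F (phi t)) ->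
  pcon a b (fun t => F (phi t)).
Proof. by move=> H K t tab; apply: clim_comp; [exact: H|exact: K]. Qed.

Lemma pcon_real a b g : rcon a b g -> pcon a b (fun t => (g t)%:C).
Proof. by move=> H t tab; apply: clim_ReIm => /=; [exact: H|exact: cvg_cst]. Qed.

Lemma rcon_cabs a b phi : pcon a b phi -> rcon a b (fun t => cabs (phi t)).
Proof.
move=> H t /H K; apply/cvgrPdist_le => e /K; apply: filterS => s; apply: le_trans.
rewrite ler_norml; have := cabs_triB (phi t) (phi s).
by have := cabs_triB (phi s) (phi t); rewrite [cabs (phi t - _)]cabsBC; lra.
Qed.

Lemma cint_eq a b phi psi : (forall t, a <= t <= b -> phi t = psi t) ->
  cint a b phi = cint a b psi.
Proof. by move=> E; congr (_ +i* _); apply: rint_eq => t /E ->. Qed.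

Lemma cintD a b phi psi : pcon a b phi -> pcon a b psi ->
  cint a b (fun t => phi t + psi t) = cint a b phi + cint a b psi.
Proof.
move=> H K; apply: complex_ext; rewrite ?cReD ?cImD /= -rintD;
  try (by apply: pcon_Re); try (by apply: pcon_Im);
  by apply: rint_eq => t _; rewrite ?cReD ?cImD.
Qed.

Lemma cintB a b phi psi : pcon a b phi -> pcon a b psi ->
  cint a b (fun t => phi t - psi t) = cint a b phi - cint a b psi.
Proof.
move=> H K; apply: complex_ext; rewrite ?cReB ?cImB /= -rintB;
  try (by apply: pcon_Re); try (by apply: pcon_Im);
  by apply: rint_eq => t _; rewrite ?cReB ?cImB.
Qed.

Lemma cintZ a b (k : R[i]) phi : pcon a b phi -> cint a b (fun t => k * phi t) = k * cint a b phi.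
Proof.
move=> H; have HR := pcon_Re H; have HI := pcon_Im H.
apply: complex_ext.
  have -> : Re (k * cint a b phi) = Re k * rint a b (fun t => Re (phi t))
    - Im k * rint a b (fun t => Im (phi t)) by rewrite cReM.
  rewrite -(rintZ _ HR) -(rintZ _ HI) -rintB; [|exact: rconZ..].
  by apply: rint_eq => t _; rewrite cReM.
have -> : Im (k * cint a b phi) = Re k * rint a b (fun t => Im (phi t))
    + Im k * rint a b (fun t => Re (phi t)) by rewrite cImM.
rewrite -(rintZ _ HR) -(rintZ _ HI) -rintD; [|exact: rconZ..].
by apply: rint_eq => t _; rewrite cImM.
Qed.

Lemma cintZr a b (k : R[i]) phi : pcon a b phi -> cint a b (fun t => phi t * k) = cint a b phi * k.
Proof.
by move=> H; rewrite mulrC -cintZ//; apply: cint_eq => t _; rewrite mulrC.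
Qed.

Lemma cint_conj a b phi : pcon a b phi -> cint a b (fun t => (phi t)^*) = (cint a b phi)^*.
Proof.
move=> H; apply: complex_ext => /=; first by apply: rint_eq => t _; case: (phi t).
rewrite -[RHS]mulN1r -rintZ; last exact: pcon_Im.
by apply: rint_eq => t _; case: (phi t) => ? ? /=; rewrite mulN1r.
Qed.

Lemma cint_cst a b (k : R[i]) : a <= b -> cint a b (fun=> k) = k * (b - a)%:C.
Proof.
by move=> ab; case: k => x y; apply: complex_ext; rewrite /= rint_cst//; ring.
Qed.

Lemma cint_split a b c phi : a <= c -> c <= b -> pcon a b phi ->
  cint a b phi = cint a c phi + cint c b phi.
Proof.
move=> ac cb H; apply: complex_ext; rewrite ?cReD ?cImD /=; apply: rint_split => //.
  exact: pcon_Re.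
exact: pcon_Im.
Qed.

(** Real and imaginary parts are bounded separately, which is where the factor 2 comes from; it is
    harmless in all later estimates. *)
Lemma cint_bound a b phi g : pcon a b phi -> rcon a b g ->
  (forall t, a <= t <= b -> cabs (phi t) <= g t) -> cabs (cint a b phi) <= 2 * rint a b g.
Proof.
move=> H K E; apply: le_trans (cabs_le_ReIm _) _ => /=; rewrite mulr_natl mulr2n.
have HR := pcon_Re H; have HI := pcon_Im H.
apply: lerD; [apply: le_trans (rint_normr HR) _|apply: le_trans (rint_normr HI) _];
  apply: rint_le => //; try exact: rcon_norm;
  move=> t /E; apply: le_trans; [exact: Re_cabs|exact: Im_cabs].
Qed.

Lemma cint_bound_cst a b phi (M : R) : a <= b -> pcon a b phi ->
  (forall t, a <= t <= b -> cabs (phi t) <= M) -> cabs (cint a b phi) <= 2 * M * (b - a).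
Proof.
move=> ab H E; have := cint_bound H (@rcon_cst a b M) E.
by rewrite rint_cst// mulrA.
Qed.

Lemma pcont_line (p q : R[i]) t : pcont (fun t => p + t%:C * q) t.
Proof.
apply: climD; first exact: clim_cst.
apply: climM; last exact: clim_cst.
by apply: clim_ReIm => /=; [exact: cvg_id|exact: cvg_cst].
Qed.

Lemma is_derive_eps (G : R -> R) t (l : R) :
  (forall e, 0 < e -> \forall h \near 0, `|G (t + h) - G t - l * h| <= e * `|h|) ->
  is_derive t 1 G l.
Proof.
move=> H.
have C : h^-1 *: (G (h *: 1 + t) - G t) @[h --> 0^'] --> l.
  apply/cvgrPdist_le => e e0; rewrite /dnbhs near_withinE.
  apply: filterS (H e e0) => h K /= h0; have h1 : 0 < `|h| by rewrite normr_gt0.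
  rewrite -(ler_pM2r h1) distrC -normrM /= (_ : (_ - _) * h = G (t + h) - G t - l * h)//.
  by rewrite /GRing.scale /= mulr1 [h + t]addrC; field.
apply: DeriveDef; first by apply/cvg_ex; exists l.
by rewrite /derive; apply/cvg_lim.
Qed.

Lemma is_derive_line F (p q l : R[i]) t : cder F (p + t%:C * q) l ->
  is_derive t 1 (fun s : R => Re (F (p + s%:C * q))) (Re (l * q)) /\
  is_derive t 1 (fun s : R => Im (F (p + s%:C * q))) (Im (l * q)).
Proof.
move=> H.
have K e : 0 < e -> \forall h \near (0 : R),
   cabs (F (p + (t + h)%:C * q) - F (p + t%:C * q) - l * q * h%:C) <= e * `|h|.
  move=> e0; have Q0 : 0 < cabs q + 1 by have := cabs_ge0 q; lra.
  have e1 : 0 < e / (cabs q + 1) by rewrite divr_gt0.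
  have [d d0 {}H] := H _ e1.
  have d1 : 0 < d / (cabs q + 1) by rewrite divr_gt0.
  near=> h.
  have hd : `|h| < d / (cabs q + 1).
    by near: h; apply/nbhs_ballP; exists (d / (cabs q + 1)) => // h; rewrite /ball /= sub0r normrN.
  have hq : cabs (h%:C * q) <= `|h| * (cabs q + 1).
    by rewrite cabsM cabsR ler_wpM2l//; lra.
  rewrite (_ : p + (t + h)%:C * q = p + t%:C * q + h%:C * q); last first.
    by rewrite rmorphD mulrDl addrA.
  rewrite -[l * q * _]mulrA [q * _]mulrC; apply: le_trans (H (h%:C * q) _) _.
  - by apply: le_lt_trans hq _; rewrite -ltr_pdivlMr.
  - by apply: le_trans (ler_wpM2l (ltW e1) hq) _; rewrite le_eqVlt; apply/orP; left; apply/eqP; field; lra.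
split; apply: is_derive_eps => e /K; apply: filterS => h; apply: le_trans.
- apply: le_trans (Re_cabs _); rewrite !cReB (_ : Re (l * q * h%:C) = Re (l * q) * h)//.
  by rewrite cReM /= mulr0 subr0.
- apply: le_trans (Im_cabs _); rewrite !cImB (_ : Im (l * q * h%:C) = Im (l * q) * h)//.
  by rewrite cImM /= mulr0 add0r.
Unshelve. all: by end_near. Qed.

Lemma cint_line a b F F' (p q : R[i]) : a <= b ->
  (forall t, a <= t <= b -> cder F (p + t%:C * q) (F' (p + t%:C * q))) ->
  (forall t, a <= t <= b -> ccont F' (p + t%:C * q)) ->
  cint a b (fun t => F' (p + t%:C * q) * q) = F (p + b%:C * q) - F (p + a%:C * q).
Proof.
move=> ab dF cF'.
have C : pcon a b (fun t => F' (p + t%:C * q) * q).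
  apply: pconM; last exact: pcon_cst.
  by apply: pcon_comp => // t _; exact: pcont_line.
apply: complex_ext; rewrite ?cReB ?cImB /=.
  apply: (@rint_FTC _ _ _ (fun s : R => Re (F (p + s%:C * q)))) => //; first exact: pcon_Re.
  by move=> t /dF /is_derive_line[].
apply: (@rint_FTC _ _ _ (fun s : R => Im (F (p + s%:C * q)))) => //; first exact: pcon_Im.
by move=> t /dF /is_derive_line[].
Qed.

(** Compactness of [a, b]: closeness that is uniform near each single t becomes uniform in t. *)
Lemma unif_near a b (Phi : R -> R -> R[i]) x0 :
  (forall t, a <= t <= b -> forall e : R, 0 < e -> exists2 d : R, 0 < d &
     forall x s, `|x - x0| < d -> `|s - t| < d -> cabs (Phi x s - Phi x0 s) <= e) ->
  forall e : R, 0 < e -> exists2 d : R, 0 < d &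
    forall x, `|x - x0| < d -> forall t, a <= t <= b -> cabs (Phi x t - Phi x0 t) <= e.
Proof.
move=> H e e0; have /compact_near_coveringP := @segment_compact R a b.
move=> /(_ R (nbhs x0) (fun x t => cabs (Phi x t - Phi x0 t) <= e)) [].
  move=> t; rewrite /= in_itv /= => /H/(_ e e0)[d d0 K].
  exists (ball t d, ball x0 d); first by split; exact: nbhsx_ballx.
  by move=> [s x] /= [h1 h2]; apply: K; rewrite distrC.
move=> d /= d0 K; exists d => // x xd t tab; apply: K; last by rewrite /= in_itv.
by rewrite /ball /= distrC.
Qed.

End PathIntegral.

Section Goursat.
Variable R : realType.
Implicit Types (a b c d x y : R) (F G : R[i] -> R[i]).

Lemma exp2_gt (x : R) : exists n : nat, x < 2 ^+ n.
Proof. by exists (Num.bound x); exact: upper_nthrootP. Qed.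

Section RectangleFunctional.
Variables (J : R -> R -> R -> R -> R[i]) (a b c d : R).
Hypothesis ab : a <= b.
Hypothesis cd : c <= d.
Hypothesis addx : forall x1 m x2 y1 y2, a <= x1 -> x1 <= m -> m <= x2 -> x2 <= b ->
  c <= y1 -> y1 <= y2 -> y2 <= d -> J x1 x2 y1 y2 = J x1 m y1 y2 + J m x2 y1 y2.
Hypothesis addy : forall x1 x2 y1 m y2, a <= x1 -> x1 <= x2 -> x2 <= b ->
  c <= y1 -> y1 <= m -> m <= y2 -> y2 <= d -> J x1 x2 y1 y2 = J x1 x2 y1 m + J x1 x2 m y2.
Hypothesis small : forall p q, a <= p <= b -> c <= q <= d -> forall e : R, 0 < e ->
  exists2 dl : R, 0 < dl & forall x1 x2 y1 y2, a <= x1 -> x1 <= p -> p <= x2 -> x2 <= b ->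
    c <= y1 -> y1 <= q -> q <= y2 -> y2 <= d -> (x2 - x1) + (y2 - y1) < dl ->
    cabs (J x1 x2 y1 y2) <= e * ((x2 - x1) + (y2 - y1)) ^+ 2.

Let rect := ((R * R) * (R * R))%type.
Let good (n : nat) (Q : rect) :=
  [/\ a <= Q.1.1 /\ Q.1.2 <= b, c <= Q.2.1 /\ Q.2.2 <= d,
     cabs (J a b c d) / 4 ^+ n <= cabs (J Q.1.1 Q.1.2 Q.2.1 Q.2.2),
     Q.1.2 - Q.1.1 = (b - a) / 2 ^+ n & Q.2.2 - Q.2.1 = (d - c) / 2 ^+ n].
Let sub (Q Q' : rect) := [/\ Q.1.1 <= Q'.1.1, Q'.1.2 <= Q.1.2, Q.2.1 <= Q'.2.1 & Q'.2.2 <= Q.2.2].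

Let bisect n Q : good n Q -> exists Q', good n.+1 Q' /\ sub Q Q'.
Proof.
case: Q => [[x1 x2] [y1 y2]] [/= [ax xb] [cy yd] HJ hx hy].
have P2 : 0 < 2 ^+ n :> R by rewrite exprn_gt0.
have x12 : x1 <= x2 by rewrite -subr_ge0 hx divr_ge0 ?subr_ge0// ltW.
have y12 : y1 <= y2 by rewrite -subr_ge0 hy divr_ge0 ?subr_ge0// ltW.
pose mx := (x1 + x2) / 2; pose my := (y1 + y2) / 2.
have [m1 m2] : x1 <= mx /\ mx <= x2 by rewrite /mx; lra.
have [m3 m4] : y1 <= my /\ my <= y2 by rewrite /my; lra.
have E : J x1 x2 y1 y2 = (J x1 mx y1 my + J x1 mx my y2) + (J mx x2 y1 my + J mx x2 my y2).
  rewrite (@addx _ mx)//; congr (_ + _); apply: addy => //.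
    by apply: le_trans m2 xb.
  exact: le_trans ax m1.
have T : cabs (J x1 x2 y1 y2) <= cabs (J x1 mx y1 my) + cabs (J x1 mx my y2)
     + (cabs (J mx x2 y1 my) + cabs (J mx x2 my y2)).
  by rewrite E; apply: le_trans (cabsD _ _) _; apply: lerD; exact: cabsD.
set K := cabs (J a b c d) in HJ *.
have hx1 : mx - x1 = (b - a) / 2 ^+ n.+1.
  by rewrite exprSr invfM mulrA -hx /mx; field.
have hx2 : x2 - mx = (b - a) / 2 ^+ n.+1.
  by rewrite exprSr invfM mulrA -hx /mx; field.
have hy1 : my - y1 = (d - c) / 2 ^+ n.+1.
  by rewrite exprSr invfM mulrA -hy /my; field.
have hy2 : y2 - my = (d - c) / 2 ^+ n.+1.
  by rewrite exprSr invfM mulrA -hy /my; field.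
have HK : K / 4 ^+ n.+1 = (K / 4 ^+ n) / 4 by rewrite exprSr invfM mulrA.
have am := le_trans ax m1; have mb := le_trans m2 xb.
have cm := le_trans cy m3; have md := le_trans m4 yd.
have [H1|H1] := leP (K / 4 ^+ n.+1) (cabs (J x1 mx y1 my)).
  by exists ((x1, mx), (y1, my)).
have [H2|H2] := leP (K / 4 ^+ n.+1) (cabs (J x1 mx my y2)).
  by exists ((x1, mx), (my, y2)).
have [H3|H3] := leP (K / 4 ^+ n.+1) (cabs (J mx x2 y1 my)).
  by exists ((mx, x2), (y1, my)).
have [H4|H4] := leP (K / 4 ^+ n.+1) (cabs (J mx x2 my y2)).
  by exists ((mx, x2), (my, y2)).
by exfalso; rewrite HK in H1 H2 H3 H4; lra.
Qed.

(** Goursat's subdivision. One of the four quarters carries at least a quarter of |J|, so the n-th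
    rectangle carries |J| / 4^n, while the square of its half-perimeter is D^2 / 4^n. At the common
    point of the nested rectangles [small] with e = |J| / (D^2 + 1) contradicts this; the summand 1
    covers D = 0 and makes the inequality strict. *)
Lemma rect_functional_eq0 : J a b c d = 0.
Proof.
apply/eqP; rewrite -cabs_eq0; apply/negP => /negP J0.
have K0 : 0 < cabs (J a b c d) by rewrite lt_neqAle eq_sym J0 cabs_ge0.
have [f Hf] : {f : nat * rect -> rect & forall nQ, good nQ.1 nQ.2 -> good nQ.1.+1 (f nQ) /\ sub nQ.2 (f nQ)}.
  apply: (choice (P := fun nQ Q' => good nQ.1 nQ.2 -> good nQ.1.+1 Q' /\ sub nQ.2 Q')) => -[n Q] /=.
  have [/bisect[Q' H]|H] := pselect (good n Q); first by exists Q'.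
  by exists Q.
pose fix S n : rect := if n is m.+1 then f (m, S m) else ((a, b), (c, d)).
have SG n : good n (S n).
  elim: n => [|n IH]; first by rewrite /good /= !expr0 !divr1; split.
  by have [] := Hf (n, S n) IH.
have SS n : sub (S n) (S n.+1) by have [] := Hf (n, S n) (SG n).
have SSm n m : sub (S n) (S (m + n)%N).
  elim: m => [|m [h1 h2 h3 h4]]; first by split.
  rewrite addSn; have [k1 k2 k3 k4] := SS (m + n)%N.
  by split; [exact: le_trans h1 k1|exact: le_trans k2 h2|exact: le_trans h3 k3|exact: le_trans k4 h4].
have ord n : (S n).1.1 <= (S n).1.2 /\ (S n).2.1 <= (S n).2.2.
  have [_ _ _ hx hy] := SG n; 
  by split; rewrite -subr_ge0 ?hx ?hy divr_ge0 ?subr_ge0// ?exprn_ge0.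
have cross n m : (S n).1.1 <= (S m).1.2 /\ (S n).2.1 <= (S m).2.2.
  have [h1 _ h3 _] := SSm n m; have [_ k2 _ k4] := SSm m n; rewrite addnC in k2 k4.
  by have [k5 k6] := ord (m + n)%N; split;
    [exact: le_trans h1 (le_trans k5 k2)|exact: le_trans h3 (le_trans k6 k4)].
(* The suprema of the left and of the lower edges are the coordinates of a point common to all the
   rectangles. *)
pose A := [set x | exists n, x = (S n).1.1]; pose B := [set x | exists n, x = (S n).2.1].
have A0 : A !=set0 by exists a, 0%N.
have B0 : B !=set0 by exists c, 0%N.
have pl n : (S n).1.1 <= sup A.
  by apply: ub_le_sup; [exists b => _ [m ->]; have [] := cross m 0%N|exists n].
have pu n : sup A <= (S n).1.2.
  by apply: ge_sup => // _ [m ->]; have [] := cross m n.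
have ql n : (S n).2.1 <= sup B.
  by apply: ub_le_sup; [exists d => _ [m ->]; have [] := cross m 0%N|exists n].
have qu n : sup B <= (S n).2.2.
  by apply: ge_sup => // _ [m ->]; have [] := cross m n.
pose D := (b - a) + (d - c).
have D0 : 0 <= D by rewrite /D addr_ge0// subr_ge0.
have e0 : 0 < cabs (J a b c d) / (D ^+ 2 + 1).
  by rewrite divr_gt0//; have := sqr_ge0 D; lra.
have pab : a <= sup A <= b by rewrite (pl 0%N) (pu 0%N).
have qcd : c <= sup B <= d by rewrite (ql 0%N) (qu 0%N).
have [dl dl0 H] := small pab qcd e0.
have [n hn] := exp2_gt (D / dl).
have [[h1 h2] [h3 h4] h5 h6 h7] := SG n.
have P2 : 0 < 2 ^+ n :> R by rewrite exprn_gt0.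
have S1 : (S n).1.2 - (S n).1.1 + ((S n).2.2 - (S n).2.1) = D / 2 ^+ n.
  by rewrite h6 h7 /D; ring.
have := H _ _ _ _ h1 (pl n) (pu n) h2 h3 (ql n) (qu n) h4; rewrite S1.
rewrite ltr_pdivrMr// mulrC -ltr_pdivrMr// => /(_ hn) /(le_trans h5).
have -> : 4 ^+ n = (2 ^+ n) ^+ 2 :> R by rewrite exprAC; congr (_ ^+ n); ring.
rewrite expr_div_n mulrA ler_pM2r ?invr_gt0 ?exprn_gt0//.
rewrite mulrAC ler_pdivlMr; last by have := sqr_ge0 D; lra.
by rewrite ler_pM2l//; lra.
Qed.

End RectangleFunctional.

(** Edges keep the shape F (p + t q) q of [cint_line], with q = i on vertical and q = 1 on
    horizontal ones, whence the factor 1 in [hint]. With these, [rectint] is the counterclockwise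
    integral along the boundary. *)
Definition vint G x y1 y2 := cint y1 y2 (fun t => G (x%:C + t%:C * 'i%C) * 'i%C).
Definition hint G y x1 x2 := cint x1 x2 (fun t => G (y%:C * 'i%C + t%:C * 1) * 1).
Definition rectint G x1 x2 y1 y2 :=
  (vint G x2 y1 y2 - vint G x1 y1 y2) - (hint G y2 x1 x2 - hint G y1 x1 x2).

Lemma hvpt x y : y%:C * 'i%C + x%:C * 1 = x%:C + y%:C * 'i%C :> R[i].
Proof. by rewrite mulr1 addrC. Qed.

Lemma pcon_v G x y1 y2 : (forall y, y1 <= y <= y2 -> ccont G (x%:C + y%:C * 'i%C)) ->
  pcon y1 y2 (fun t => G (x%:C + t%:C * 'i%C) * 'i%C).
Proof.
move=> H; apply: pconM; last exact: pcon_cst.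
by apply: pcon_comp => // t _; exact: pcont_line.
Qed.

Lemma pcon_h G y x1 x2 : (forall x, x1 <= x <= x2 -> ccont G (x%:C + y%:C * 'i%C)) ->
  pcon x1 x2 (fun t => G (y%:C * 'i%C + t%:C * 1) * 1).
Proof.
move=> H; apply: pconM; last exact: pcon_cst.
apply: pcon_comp => // t h; first exact: pcont_line.
by rewrite hvpt; exact: H.
Qed.

Lemma rectint_primitive F G x1 x2 y1 y2 : x1 <= x2 -> y1 <= y2 ->
  (forall z, cder F z (G z)) -> (forall z, ccont G z) -> rectint G x1 x2 y1 y2 = 0.
Proof.
move=> x12 y12 dF cG; rewrite /rectint /vint /hint !(@cint_line _ _ _ F)//.
by rewrite !hvpt; ring.
Qed.

Lemma rectintB F G x1 x2 y1 y2 : x1 <= x2 -> y1 <= y2 ->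
  (forall x y, x1 <= x <= x2 -> y1 <= y <= y2 -> ccont F (x%:C + y%:C * 'i%C)) ->
  (forall x y, x1 <= x <= x2 -> y1 <= y <= y2 -> ccont G (x%:C + y%:C * 'i%C)) ->
  rectint (fun z => F z - G z) x1 x2 y1 y2 = rectint F x1 x2 y1 y2 - rectint G x1 x2 y1 y2.
Proof.
move=> x12 y12 cF cG.
have xx1 : x1 <= x1 <= x2 by rewrite lexx. have xx2 : x1 <= x2 <= x2 by rewrite x12 lexx.
have yy1 : y1 <= y1 <= y2 by rewrite lexx. have yy2 : y1 <= y2 <= y2 by rewrite y12 lexx.
have V x : x1 <= x <= x2 -> vint (fun z => F z - G z) x y1 y2 = vint F x y1 y2 - vint G x y1 y2.
  move=> hx; rewrite /vint -cintB; try (by apply: pcon_v => y hy; auto).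
  by apply: cint_eq => t _; rewrite mulrBl.
have H y : y1 <= y <= y2 -> hint (fun z => F z - G z) y x1 x2 = hint F y x1 x2 - hint G y x1 x2.
  move=> hy; rewrite /hint -cintB; try (by apply: pcon_h => x hx; auto).
  by apply: cint_eq => t _; rewrite mulrBl.
by rewrite /rectint !V// !H//; ring.
Qed.

Lemma rectint_bound G x1 x2 y1 y2 (M : R) : x1 <= x2 -> y1 <= y2 ->
  (forall x y, x1 <= x <= x2 -> y1 <= y <= y2 -> ccont G (x%:C + y%:C * 'i%C)) ->
  (forall x y, x1 <= x <= x2 -> y1 <= y <= y2 -> cabs (G (x%:C + y%:C * 'i%C)) <= M) ->
  cabs (rectint G x1 x2 y1 y2) <= 4 * M * ((x2 - x1) + (y2 - y1)).
Proof.
move=> x12 y12 cG bG.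
have xx1 : x1 <= x1 <= x2 by rewrite lexx. have xx2 : x1 <= x2 <= x2 by rewrite x12 lexx.
have yy1 : y1 <= y1 <= y2 by rewrite lexx. have yy2 : y1 <= y2 <= y2 by rewrite y12 lexx.
have V x : x1 <= x <= x2 -> cabs (vint G x y1 y2) <= 2 * M * (y2 - y1).
  move=> hx; apply: cint_bound_cst => // [|t ht]; first by apply: pcon_v => y hy; auto.
  by rewrite cabsM cabs_i mulr1 bG.
have H y : y1 <= y <= y2 -> cabs (hint G y x1 x2) <= 2 * M * (x2 - x1).
  move=> hy; apply: cint_bound_cst => // [|t ht]; first by apply: pcon_h => x hx; auto.
  by rewrite cabsM cabs1 mulr1 hvpt bG.
rewrite /rectint; apply: le_trans (cabsB _ _) _.
have := cabsB (vint G x2 y1 y2) (vint G x1 y1 y2).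
have := cabsB (hint G y2 x1 x2) (hint G y1 x1 x2).
by have := V _ xx1; have := V _ xx2; have := H _ yy1; have := H _ yy2; lra.
Qed.

Lemma goursat G x1 x2 y1 y2 : x1 <= x2 -> y1 <= y2 ->
  (forall x y, x1 <= x <= x2 -> y1 <= y <= y2 -> cdiff G (x%:C + y%:C * 'i%C)) ->
  rectint G x1 x2 y1 y2 = 0.
Proof.
move=> x12 y12 dG.
have cG x y : x1 <= x <= x2 -> y1 <= y <= y2 -> ccont G (x%:C + y%:C * 'i%C).
  by move=> hx hy; apply: cdiff_ccont; exact: dG.
apply: rect_functional_eq0 => //.
- move=> a m b c d h1 h2 h3 h4 h5 h6 h7.
  have Hs y : y1 <= y <= y2 -> hint G y a b = hint G y a m + hint G y m b.
    by move=> hy; apply: cint_split => //; apply: pcon_h => x hx; apply: cG => //; lra.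
  by rewrite /rectint !Hs; [ring|lra|lra].
- move=> a b c m d h1 h2 h3 h4 h5 h6 h7.
  have Hs x : x1 <= x <= x2 -> vint G x c d = vint G x c m + vint G x m d.
    by move=> hx; apply: cint_split => //; apply: pcon_v => y hy; apply: cG => //; lra.
  by rewrite /rectint !Hs; [ring|lra|lra].
- move=> p q hp hq e e0; pose z0 := p%:C + q%:C * 'i%C.
  have [l Hl] := dG p q hp hq; rewrite -/z0 in Hl.
  have e4 : 0 < e / 4 by lra.
  have [dl dl0 H] := Hl _ e4; exists dl => // a b c d h1 h2 h3 h4 h5 h6 h7 h8 hD.
  have ab := le_trans h2 h3; have cd := le_trans h6 h7.
  (* The affine part of G at z0 has a primitive, so its boundary integral vanishes and may be
     subtracted; what remains is bounded by e/4 times the half-perimeter, and [rectint_bound]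
     multiplies by 4 and once more by the half-perimeter. *)
  pose A z := G z0 + l * (z - z0).
  have cA z : ccont A z.
    apply: ccontD; first exact: ccont_cst.
    by apply: ccontM; [exact: ccont_cst|apply: ccontB; [exact: ccont_id|exact: ccont_cst]].
  have JA : rectint A a b c d = 0.
    apply: (@rectint_primitive (fun z => (G z0 - l * z0) * z + (l / 2) * (z * z))) => // z.
    rewrite (_ : A z = (G z0 - l * z0) * 1 + (l / 2) * (1 * z + z * 1)); last by rewrite /A; field.
    by apply: cderD; apply: cderZ; [exact: cder_id|apply: cderM; exact: cder_id].
  have cG' x y : a <= x <= b -> c <= y <= d -> ccont G (x%:C + y%:C * 'i%C).
    by move=> hx hy; apply: cG; [lra|lra].
  rewrite -[rectint _ _ _ _ _]subr0 -JA -rectintB//.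
  have -> : e * (b - a + (d - c)) ^+ 2 = 4 * (e / 4 * (b - a + (d - c))) * (b - a + (d - c)).
    by field.
  apply: rectint_bound => // x y hx hy; first by apply: ccontB; [exact: cG'|exact: cA].
  have hz : cabs (x%:C + y%:C * 'i%C - z0) <= (b - a) + (d - c).
    rewrite (_ : _ - _ = (x - p)%:C + (y - q)%:C * 'i%C); last first.
      by rewrite !rmorphB /z0 /=; ring.
    apply: le_trans (cabsD _ _) _; rewrite cabsM cabs_i mulr1 !cabsR.
    by apply: lerD; rewrite ler_norml; lra.
  have := H (x%:C + y%:C * 'i%C - z0) (le_lt_trans hz hD).
  rewrite subrKC (_ : G _ - _ - _ = G (x%:C + y%:C * 'i%C) - A (x%:C + y%:C * 'i%C)); last first.
    by rewrite /A; ring.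
  by move=> /le_trans; apply; rewrite ler_wpM2l// ltW.
Qed.

End Goursat.

(** * The complex exponential and its quadratic remainder *)

Section ComplexExponential.
Variable R : realType.
Implicit Types (x y t r : R) (z w s : R[i]).

Lemma MVT_norm (f df : R -> R) (x y M : R) : (forall t, is_derive t 1 f (df t)) ->
  (forall t, `|t| <= Num.max `|x| `|y| -> `|df t| <= M) -> `|f y - f x| <= M * `|y - x|.
Proof.
move=> H; wlog xy : x y / x <= y.
  move=> K B; have [xy|/ltW yx] := leP x y; first exact: K.
  by rewrite distrC [`|y - x|]distrC; apply: K => // t; rewrite maxC; exact: B.
move=> B; have C : {within `[x, y], continuous f}.
  apply/continuous_in_subspaceT => t _; apply/differentiable_continuous/derivable1_diffP.
  by case: (H t).
have [c cxy ->] := MVT_segment xy (fun t _ => H t) C.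
rewrite normrM ler_wpM2r// B//; move: cxy; rewrite in_itv /= => /andP[xc cy].
rewrite ler_norml le_max; have := ler_norm y; have := ler_norm (- x); rewrite normrN => h1 h2.
apply/andP; split; last by apply/orP; right; lra.
rewrite lerNl le_max; apply/orP; left; lra.
Qed.

Lemma sin_lip x y : `|sin y - sin x| <= `|y - x|.
Proof.
rewrite -[leRHS]mul1r; apply: (@MVT_norm _ cos) => t _; exact: cos_max.
Qed.

Lemma cos_lip x y : `|cos y - cos x| <= `|y - x|.
Proof.
rewrite -[leRHS]mul1r; apply: (@MVT_norm _ (fun t => - sin t)) => t _.
by rewrite normrN; exact: sin_max.
Qed.

Lemma sin_le_norm y : `|sin y| <= `|y|.
Proof. by have := sin_lip 0 y; rewrite sin0 !subr0. Qed.

Lemma cos1B_le y : `|cos y - 1| <= y ^+ 2.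
Proof.
have D t : is_derive t 1 (@cos R) (- sin t) by exact: is_derive_cos.
have := @MVT_norm _ (fun t => - sin t) 0 y `|y| D _.
rewrite cos0 subr0 -expr2 -normrX [X in _ <= X]ger0_norm ?sqr_ge0//; apply => t.
by rewrite normr0 => h; rewrite normrN; apply: le_trans (sin_le_norm t) _;
  apply: le_trans h _; rewrite ge_max normr_ge0 lexx.
Qed.

Lemma sinB_le y : `|y| <= 1 -> `|sin y - y| <= y ^+ 2.
Proof.
move=> y1; have D t : is_derive t 1 (fun u : R => sin u - u) (cos t - 1).
  exact: is_deriveB.
have := @MVT_norm _ (fun t => cos t - 1) 0 y `|y| D _.
rewrite sin0 subrr !subr0 -expr2 -normrX [X in _ <= X]ger0_norm ?sqr_ge0//; apply => t.
rewrite normr0 => h; apply: le_trans (cos1B_le t) _.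
have {}h : `|t| <= `|y| by apply: le_trans h _; rewrite ge_max normr_ge0 lexx.
have -> : t ^+ 2 = `|t| * `|t| by rewrite -expr2 -normrX ger0_norm ?sqr_ge0.
by have := normr_ge0 t; nra.
Qed.

(** Both sides come from 1 + u <= exp u: at u = x it gives the sign of the remainder, and at u = -x,
    multiplied by exp x, it gives exp x (1 - x) <= 1. *)
Lemma expR_quad x : `|x| <= 1 / 2 -> `|expR x - 1 - x| <= 2 * x ^+ 2.
Proof.
rewrite ler_norml => /andP[x1 x2]; have := expR_ge1Dx x; have := expR_ge1Dx (- x).
have := expRxMexpNx_1 x; have := expR_gt0 x; move: (expR x) (expR (- x)) => u v u0 uv vx ux.
rewrite ger0_norm; last by lra.
have h : u * (1 - x) <= 1 by have := ler_wpM2l (ltW u0) vx; rewrite uv.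
have k : (1 + x + 2 * x ^+ 2) * (1 - x) >= 1.
  rewrite (_ : _ * _ = 1 + x ^+ 2 * (1 - 2 * x)); last by ring.
  by rewrite lerDl mulr_ge0 ?sqr_ge0//; lra.
have : u * (1 - x) <= (1 + x + 2 * x ^+ 2) * (1 - x) by lra.
by rewrite ler_pM2r; lra.
Qed.

Definition cexp z : R[i] := circle_pt (expR (Re z)) (Im z).

Lemma cexpD z w : cexp (z + w) = cexp z * cexp w.
Proof.
case: z w => [a b] [c d]; apply: complex_ext; rewrite /cexp /circle_pt /= expRD ?cosD ?sinD; ring.
Qed.

Lemma cexp0 : cexp 0 = 1.
Proof. by rewrite /cexp /circle_pt /= expR0 cos0 sin0 mulr1 mulr0. Qed.

Lemma cabs_circle_pt r t : cabs (circle_pt r t) = `|r|.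
Proof.
rewrite cabsE /= !exprMn -mulrDr cos2Dsin2 mulr1; exact: sqrtr_sqr.
Qed.

Lemma circle_ptE r t : circle_pt r t = r%:C * circle_pt 1 t.
Proof. by apply: complex_ext; rewrite /=; ring. Qed.

Lemma cabs_cexp z : cabs (cexp z) = expR (Re z).
Proof. by rewrite cabs_circle_pt ger0_norm// expR_ge0. Qed.

Lemma cexp_neq0 z : cexp z != 0.
Proof. by rewrite -cabs_gt0 cabs_cexp expR_gt0. Qed.

Lemma cexpN z : cexp (- z) = (cexp z)^-1.
Proof.
by apply: (mulfI (cexp_neq0 z)); rewrite -cexpD subrr cexp0 divff// cexp_neq0.
Qed.

Lemma cexp_quad s : cabs s <= 1 / 2 -> cabs (cexp s - 1 - s) <= 8 * cabs s ^+ 2.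
Proof.
case: s => x y s1; have Es : cabs (x +i* y) ^+ 2 = x ^+ 2 + y ^+ 2 by rewrite sqr_cabs.
have x1 := le_trans (Re_cabs (x +i* y)) s1; have y1 := le_trans (Im_cabs (x +i* y)) s1.
rewrite /= in x1 y1. apply: (le_trans (cabs_le_ReIm _)) => /=.
have E1 := expR_quad x1; have C1 := cos1B_le y.
have S1 : `|sin y - y| <= y ^+ 2 by apply: sinB_le; lra.
have e1 : `|expR x - 1| <= 2 * `|x|.
  have := ler_normD (expR x - 1 - x) x; rewrite subrK; move=> h.
  have : x ^+ 2 <= `|x| / 2.
    by rewrite -(ger0_norm (sqr_ge0 x)) normrX expr2 ler_wpM2l//; lra.
  by move=> k; apply: le_trans h _; lra.
have a1 : `|expR x * cos y - 1 - x| <= 2 * x ^+ 2 + 2 * y ^+ 2.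
  rewrite (_ : _ - x = (expR x - 1 - x) * cos y + (1 + x) * (cos y - 1)); last by ring.
  apply: le_trans (ler_normD _ _) _; apply: lerD.
    by rewrite normrM -[leRHS]mulr1 ler_pM// cos_max.
  rewrite normrM ler_pM//; apply: le_trans (ler_normD _ _) _; rewrite normr1; lra.
have a2 : `|expR x * sin y - 0 - y| <= x ^+ 2 + 2 * y ^+ 2.
  rewrite (_ : _ - y = (expR x - 1) * sin y + (sin y - y)); last by ring.
  apply: le_trans (ler_normD _ _) _.
  have : `|(expR x - 1) * sin y| <= 2 * `|x| * `|y|.
    by rewrite normrM ler_pM// sin_le_norm.
  have : 2 * `|x| * `|y| <= x ^+ 2 + y ^+ 2.
    rewrite -(ger0_norm (sqr_ge0 x)) -(ger0_norm (sqr_ge0 y)) !normrX.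
    by have := sqr_ge0 (`|x| - `|y|); lra.
  by move=> ? ?; lra.
rewrite Es; have := sqr_ge0 x; have := sqr_ge0 y.
by move: a1 a2; rewrite !oppr0 ?addr0; lra.
Qed.

Lemma cder_cexp z : cder cexp z (cexp z).
Proof.
apply: (@cder_quad _ _ _ _ (cabs (cexp z) * 8) (1 / 2)); first by lra.
move=> h /ltW h2; rewrite cexpD (_ : _ - _ = cexp z * (cexp h - 1 - h)); last by ring.
by rewrite cabsM -mulrA ler_wpM2l ?cabs_ge0// cexp_quad.
Qed.

Lemma cexp_period z : cexp (z + (2 * pi)%:C * 'i%C) = cexp z.
Proof.
rewrite cexpD; have -> : cexp ((2 * pi)%:C * 'i%C) = 1.
  rewrite /cexp /= !(mul0r, mulr0, mulr1, subrr, addr0, subr0) expR0 /circle_pt.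
  by rewrite mulr_natl cos2pi sin2pi mulr1 mulr0.
by rewrite mulr1.
Qed.

Lemma circle_pt_near r r0 t t0 :
  cabs (circle_pt r t - circle_pt r0 t0) <= `|r - r0| + `|r0| * (2 * `|t - t0|).
Proof.
rewrite !(circle_ptE r) !(circle_ptE r0).
rewrite (_ : _ - _ = (r - r0)%:C * circle_pt 1 t + r0%:C * (circle_pt 1 t - circle_pt 1 t0)); last first.
  by rewrite rmorphB /=; ring.
apply: le_trans (cabsD _ _) _; rewrite !cabsM !cabsR cabs_circle_pt normr1 mulr1.
rewrite lerD2l ler_wpM2l//; apply: le_trans (cabs_le_ReIm _) _ => /=; rewrite !mul1r.
by have := sin_lip t0 t; have := cos_lip t0 t; lra.
Qed.

Lemma pcont_circle r t : pcont (circle_pt r) t.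
Proof.
move=> e e0; have d0 : 0 < e / (2 * `|r| + 1).
  by rewrite divr_gt0// ltr_wpDl// mulr_ge0.
apply/nbhs_ballP; exists (e / (2 * `|r| + 1)) => // s; rewrite /ball /= distrC => st.
apply: le_trans (circle_pt_near _ _ _ _) _; rewrite subrr normr0 add0r.
have r1 : 0 < 2 * `|r| + 1 by rewrite ltr_wpDl// mulr_ge0.
rewrite ltr_pdivlMr// in st; have := normr_ge0 (s - t); lra.
Qed.

End ComplexExponential.

(** * Mean values over concentric circles *)

Section MeanValue.
Variable R : realType.
Implicit Types (F G : R[i] -> R[i]) (z w : R[i]) (r rho t : R).

Let circ F r := cint 0 (2 * pi) (fun t => F (circle_pt r t)).

Let pi2 : 0 <= 2 * pi :> R. Proof. by rewrite mulr_ge0// pi_ge0. Qed.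

Lemma pcon_circ F r : 0 <= r -> (forall z, cabs z = r -> ccont F z) ->
  pcon 0 (2 * pi) (fun t => F (circle_pt r t)).
Proof.
move=> r0 H; apply: pcon_comp => t _; first exact: pcont_circle.
by apply: H; rewrite cabs_circle_pt ger0_norm.
Qed.

Let vint_circ F r : 0 < r ->
  vint (F \o @cexp R) (ln r) 0 (2 * pi) = cint 0 (2 * pi) (fun t => F (circle_pt r t) * 'i%C).
Proof.
move=> r0; apply: cint_eq => t _; congr (F _ * _).
rewrite /cexp /= !(mul0r, mulr0, mulr1, subrr, addr0, subr0, add0r).
by rewrite (lnK _)// posrE.
Qed.

(* The substitution z = exp w turns the difference into the integral of F \o exp
   along the boundary of a rectangle of height 2 pi. *)
Let circ_annulus F r1 r2 : 0 < r1 -> r1 <= r2 ->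
  (forall z, r1 <= cabs z <= r2 -> cdiff F z) -> circ F r1 = circ F r2.
Proof.
move=> r10 r12 dF; have r20 := lt_le_trans r10 r12.
have l12 : ln r1 <= ln r2 by rewrite ler_ln.
have dG x y : ln r1 <= x <= ln r2 -> 0 <= y <= 2 * pi ->
    cdiff (F \o @cexp R) (x%:C + y%:C * 'i%C).
  move=> /andP[x1 x2] _; have [|l Hl] := dF (cexp (x%:C + y%:C * 'i%C)).
    rewrite cabs_cexp /= !(mul0r, mulr0, mulr1, subrr, addr0, subr0).
    by move: x1 x2; rewrite -(ler_expR (ln r1)) -(ler_expR x) !lnK ?posrE// => -> ->.
  by eexists; apply: cder_comp Hl; exact: cder_cexp.
have := goursat l12 pi2 dG; rewrite /rectint !vint_circ//.
have -> : hint (F \o @cexp R) (2 * pi) (ln r1) (ln r2) = hint (F \o @cexp R) 0 (ln r1) (ln r2).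
  apply: cint_eq => t _; congr (_ * _); rewrite /= mul0r add0r addrC.
  by rewrite cexp_period.
have P r : r1 <= r -> r <= r2 -> pcon 0 (2 * pi) (fun t => F (circle_pt r t)).
  move=> h1 h2; apply: pcon_circ => [|z zr]; first by apply: le_trans h1; exact: ltW.
  by apply: cdiff_ccont; apply: dF; rewrite zr h1.
rewrite subrr subr0 !cintZr; [|exact: P..].
rewrite -mulrBl => /eqP; rewrite mulf_eq0 subr_eq0.
have /negbTE-> : ('i%C : R[i]) != 0 by rewrite -cabs_gt0 cabs_i.
by rewrite orbF => /eqP.
Qed.

(** Continuity of the circle integral in the radius. It is phrased through nearby radii with the
    common value V in order to pass to the centre and across the circle through an exceptional
    point. *)
Let circ_lim F beta r (V : R[i]) : 0 <= r < beta -> (forall z, cabs z < beta -> ccont F z) ->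
  (forall d, 0 < d -> exists s, [/\ `|s - r| < d, 0 <= s, s < beta & circ F s = V]) ->
  circ F r = V.
Proof.
move=> /andP[r0 rb] cF H; apply/eqP; rewrite -subr_eq0; apply/eqP/cabs_eq_small => e e0.
pose e' := e / (4 * (2 * pi + 1)).
have e'0 : 0 < e' by rewrite divr_gt0// mulr_gt0// ltr_wpDl.
have := @unif_near R 0 (2 * pi) (fun s t => F (circle_pt s t)) r _ _ e'0.
case=> [t _ e1 e10|d d0 K].
  have rt : cabs (circle_pt r t) < beta by rewrite cabs_circle_pt ger0_norm.
  have e12 : 0 < e1 / 2 by lra.
  have /ccontP /(_ _ e12)[d d0 Hd] := cF _ rt.
  have D0 : 0 < d / (2 * r + 2) by rewrite divr_gt0//; lra.
  exists (d / (2 * r + 2)) => // x s hx hs.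
  have rs : `|r| * (2 * `|s - t|) <= 2 * r * (d / (2 * r + 2)).
    rewrite ger0_norm// mulrCA mulrA ler_wpM2l// ?mulr_ge0//; exact: ltW.
  have Ed : (2 * r + 1) * (d / (2 * r + 2)) < d.
    by rewrite mulrA ltr_pdivrMr; [nra|lra].
  have h1 : cabs (circle_pt x s - circle_pt r t) < d.
    by apply: le_lt_trans (circle_pt_near _ _ _ _) _; lra.
  have h2 : cabs (circle_pt r s - circle_pt r t) < d.
    by apply: le_lt_trans (circle_pt_near _ _ _ _) _; rewrite subrr normr0; lra.
  rewrite (_ : _ - _ = (F (circle_pt x s) - F (circle_pt r t)) - (F (circle_pt r s) - F (circle_pt r t))); last by ring.
  by apply: le_trans (cabsB _ _) _; have := Hd _ h1; have := Hd _ h2; lra.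
have [s [sr s0 sb <-]] := H d d0.
have P x : 0 <= x -> x < beta -> pcon 0 (2 * pi) (fun t => F (circle_pt x t)).
  by move=> x0 xb; apply: pcon_circ => // z zr; apply: cF; rewrite zr.
rewrite cabsBC /circ -cintB; [|exact: P..].
apply: le_trans (@cint_bound_cst _ _ _ _ e' _ _ _) _ => //.
- by apply: pconB; exact: P.
- by move=> t ht; exact: K.
rewrite subr0 /e'; have p1 : 0 < 2 * pi + 1 :> R by rewrite ltr_wpDl.
rewrite (_ : _ * _ * _ = e * (2 * pi / (2 * (2 * pi + 1)))); last by field; rewrite -/(2 * pi); lra.
have q1 : 2 * pi / (2 * (2 * pi + 1)) <= 1 :> R.
  by rewrite ler_pdivrMr ?mulr_gt0//; lra.
by have := ler_wpM2l (ltW e0) q1; rewrite mulr1.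
Qed.

(** At w0 only continuity is assumed, so that the result applies to a difference quotient extended
    by continuity, and thus yields Cauchy's formula. The annulus argument works on either side of
    the circle |z| = |w0|; [circ_lim] joins the two sides and the centre. *)
Let mean_value_circ F beta w0 r : 0 <= r < beta -> (forall z, cabs z < beta -> ccont F z) ->
  (forall z, cabs z < beta -> z != w0 -> cdiff F z) -> circ F r = F 0 * (2 * pi)%:C.
Proof.
move=> /andP[r0 rb] cF dF.
have circ0 : circ F 0 = F 0 * (2 * pi)%:C.
  rewrite -[2 * pi]subr0 -cint_cst//; apply: cint_eq => t _.
  by rewrite circle_ptE mul0r.
have Ann r1 r2 : 0 < r1 -> r1 <= r2 -> r2 < beta -> (r2 < cabs w0 \/ cabs w0 < r1) -> circ F r1 = circ F r2.
  move=> h1 h2 h3 h4; apply: circ_annulus => // z /andP[z1 z2]; apply: dF.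
    exact: le_lt_trans z2 h3.
  by apply/negP => /eqP zw; rewrite zw in z1 z2; case: h4; rewrite ltNge ?z1 ?z2.
have lt_case s : 0 <= s < beta -> s < cabs w0 -> circ F s = circ F 0.
  move=> /andP[s0 sb] sw; move: s0; rewrite le_eqVlt => /orP[/eqP<-//|s0].
  apply/esym/(@circ_lim _ beta) => //; first by rewrite lexx (lt_trans s0 sb).
  move=> d d0; exists (Num.min s (d / 2)); have m0 : 0 < Num.min s (d / 2).
    by rewrite lt_min s0 divr_gt0.
  have m1 : Num.min s (d / 2) <= s by rewrite ge_min lexx.
  split; [|exact: ltW|exact: le_lt_trans m1 sb|].
    by rewrite subr0 gtr0_norm// gt_min; apply/orP; right; lra.
  by apply: Ann => //; left.
have eq_case : cabs w0 < beta -> circ F (cabs w0) = circ F 0.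
  move=> wb; have [E|w00] := eqVneq (cabs w0) 0; first by rewrite E.
  have w0p : 0 < cabs w0 by rewrite lt_neqAle eq_sym w00 cabs_ge0.
  apply: (@circ_lim _ beta) => //; first by rewrite wb cabs_ge0.
  move=> d d0; pose m := Num.min (cabs w0) (d / 2).
  have m0 : 0 < m by rewrite lt_min w0p divr_gt0.
  have m1 : m <= cabs w0 by rewrite ge_min lexx.
  have m2 : m <= d / 2 by rewrite ge_min lexx orbT.
  exists (cabs w0 - m); split; [|lra|lra|].
    by rewrite (_ : _ - _ = - m) ?normrN ?gtr0_norm//; [lra|ring].
  by apply: lt_case; [apply/andP; split; lra|lra].
rewrite -circ0; have [rw|wr|rw] := ltgtP r (cabs w0).
- by apply: lt_case => //; rewrite r0.
- have wb := lt_trans wr rb; rewrite -eq_case//.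
  apply/esym/(@circ_lim _ beta) => //; first by rewrite wb cabs_ge0.
  move=> d d0; pose m := Num.min (r - cabs w0) (d / 2).
  have m0 : 0 < m by rewrite lt_min subr_gt0 wr divr_gt0.
  have m1 : m <= r - cabs w0 by rewrite ge_min lexx.
  have m2 : m <= d / 2 by rewrite ge_min lexx orbT.
  have := cabs_ge0 w0 => c0.
  exists (cabs w0 + m); split; [|lra|lra|].
    by rewrite (_ : _ - _ = m) ?gtr0_norm//; [lra|ring].
  by apply: Ann; [lra|lra|lra|right; lra].
- by rewrite rw; apply: eq_case; rewrite -rw.
Qed.

Definition cavg r F : R[i] := ((2 * pi)^-1)%:C * circ F r.

Lemma mean_value F beta w0 r : 0 <= r < beta -> (forall z, cabs z < beta -> ccont F z) ->
  (forall z, cabs z < beta -> z != w0 -> cdiff F z) -> cavg r F = F 0.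
Proof.
move=> rb cF dF; rewrite /cavg (@mean_value_circ F beta w0)// mulrCA -rmorphM /=.
by rewrite mulVf ?mulr1// mulf_neq0// gt_eqF// pi_gt0.
Qed.

End MeanValue.

(** * Cauchy and Schwarz formulas in a disc *)

Section CircleAverage.
Variable R : realType.
Implicit Types (F G : R[i] -> R[i]) (z w h : R[i]) (r s : R) (u v g : R[i] -> R).

Let p2 : 0 < 2 * pi :> R. Proof. by rewrite mulr_gt0// pi_gt0. Qed.

Definition conc r F := forall z, cabs z = r -> ccont F z.

Definition rconc r u := rcon 0 (2 * pi) (fun t => u (circle_pt r t)).

Definition ravg r u : R := (2 * pi)^-1 * rint 0 (2 * pi) (fun t => u (circle_pt r t)).

Lemma circle_on r t : 0 <= r -> cabs (circle_pt r t) = r.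
Proof. by move=> r0; rewrite cabs_circle_pt ger0_norm. Qed.

Lemma conc_pcon r F : 0 <= r -> conc r F -> pcon 0 (2 * pi) (fun t => F (circle_pt r t)).
Proof. by move=> r0 H; exact: pcon_circ. Qed.

Lemma cavg_eq r F G : 0 <= r -> (forall z, cabs z = r -> F z = G z) -> cavg r F = cavg r G.
Proof.
by move=> r0 E; congr (_ * _); apply: cint_eq => t _; rewrite E// circle_on.
Qed.

Lemma cavgD r F G : 0 <= r -> conc r F -> conc r G ->
  cavg r (fun z => F z + G z) = cavg r F + cavg r G.
Proof. by move=> r0 /(conc_pcon r0) H /(conc_pcon r0) K; rewrite /cavg cintD// mulrDr. Qed.

Lemma cavgB r F G : 0 <= r -> conc r F -> conc r G ->
  cavg r (fun z => F z - G z) = cavg r F - cavg r G.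
Proof. by move=> r0 /(conc_pcon r0) H /(conc_pcon r0) K; rewrite /cavg cintB// mulrBr. Qed.

Lemma cavgZ r (k : R[i]) F : 0 <= r -> conc r F -> cavg r (fun z => k * F z) = k * cavg r F.
Proof. by move=> r0 /(conc_pcon r0) H; rewrite /cavg cintZ// mulrCA. Qed.

Lemma cavgZr r (k : R[i]) F : 0 <= r -> conc r F -> cavg r (fun z => F z * k) = cavg r F * k.
Proof. by move=> r0 /(conc_pcon r0) H; rewrite /cavg cintZr// mulrA. Qed.

Lemma cavg_conj r F : 0 <= r -> conc r F -> cavg r (fun z => (F z)^*) = (cavg r F)^*.
Proof.
by move=> r0 /(conc_pcon r0) H; rewrite /cavg cint_conj// cconjM cconjR.
Qed.

Lemma Re_cavg r F : Re (cavg r F) = ravg r (fun z => Re (F z)).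
Proof. by rewrite /cavg cReM /= mul0r subr0. Qed.

Lemma ravg_eq r u v : 0 <= r -> (forall z, cabs z = r -> u z = v z) -> ravg r u = ravg r v.
Proof.
by move=> r0 E; congr (_ * _); apply: rint_eq => t _; rewrite E// circle_on.
Qed.

Lemma ravg_le r u v : 0 <= r -> rconc r u -> rconc r v ->
  (forall z, cabs z = r -> u z <= v z) -> ravg r u <= ravg r v.
Proof.
move=> r0 H K E; rewrite ler_pM2l ?invr_gt0//; apply: rint_le => // t _.
by rewrite E// circle_on.
Qed.

Lemma ravgB r u v : rconc r u -> rconc r v -> ravg r (fun z => u z - v z) = ravg r u - ravg r v.
Proof. by move=> H K; rewrite /ravg rintB// mulrBr. Qed.

Lemma ravgZ r (k : R) u : rconc r u -> ravg r (fun z => k * u z) = k * ravg r u.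
Proof. by move=> H; rewrite /ravg rintZ// mulrCA. Qed.

Lemma ravg_ge0 r u : 0 <= r -> (forall z, cabs z = r -> 0 <= u z) -> 0 <= ravg r u.
Proof.
move=> r0 E; apply: mulr_ge0; first by rewrite invr_ge0 ltW.
apply: rint_ge0 => t _.
by rewrite E// circle_on.
Qed.

Lemma conc_Re r F : 0 <= r -> conc r F -> rconc r (fun z => Re (F z)).
Proof. by move=> r0 /(conc_pcon r0) /pcon_Re. Qed.

Lemma cavg_bound r F g : 0 <= r -> conc r F -> rconc r g ->
  (forall z, cabs z = r -> cabs (F z) <= g z) -> cabs (cavg r F) <= 2 * ravg r g.
Proof.
move=> r0 /(conc_pcon r0) H K E; rewrite /cavg cabsM cabsR ger0_norm ?invr_ge0 ?(ltW p2)//.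
rewrite /ravg (mulrCA 2) ler_pM2l ?invr_gt0//; apply: cint_bound => // t _.
by rewrite E// circle_on.
Qed.

Lemma conc_rcabs r F : 0 <= r -> conc r F -> rconc r (fun z => cabs (F z)).
Proof. by move=> r0 /(conc_pcon r0) H; apply: rcon_cabs. Qed.

Lemma rconcZ r (k : R) u : rconc r u -> rconc r (fun z => k * u z).
Proof. exact: rconZ. Qed.

End CircleAverage.

(** * Cauchy transforms, primitives, logarithms and the Schwarz formula *)

Section CauchyFormula.
Variable R : realType.
Implicit Types (F G psi : R[i] -> R[i]) (z w h : R[i]) (r s beta : R) (g : R[i] -> R).

Definition hol beta F := forall z, cabs z < beta -> cdiff F z.

Lemma hol_conc beta r F : r < beta -> hol beta F -> conc r F.
Proof. by move=> rb H z zr; apply: cdiff_ccont; apply: H; rewrite zr. Qed.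

Lemma circle_sub_neq0 r z w : cabs z = r -> cabs w < r -> z - w != 0.
Proof. by move=> zr wr; apply/negP; rewrite subr_eq0 => /eqP zw; rewrite -zw zr ltxx in wr. Qed.

Lemma ccont_sub z w : ccont (fun x => x - w) z.
Proof. by apply: ccontB; [exact: ccont_id|exact: ccont_cst]. Qed.

Lemma cdiff_sub z w : cdiff (fun x => x - w) z.
Proof. by apply: cdiffB; [exact: cdiff_id|exact: cdiff_cst]. Qed.

(* On |z| = r the conjugate of z / (z - w) is r^2 / (r^2 - conj(w) z), which is
   holomorphic inside the circle. *)
Lemma conj_kernel r z w : 0 < r -> cabs z = r -> cabs w < r ->
  (z / (z - w))^* = (r ^+ 2)%:C / ((r ^+ 2)%:C - w^* * z).
Proof.
move=> r0 zr wr; have zw := circle_sub_neq0 zr wr.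
have z0 : z != 0 by rewrite -cabs_gt0 zr.
have E : z * z^* = (r ^+ 2)%:C by rewrite mul_conjc zr.
rewrite -E [w^* * z]mulrC -mulrBr -rmorphB invfM mulrACA divff// mul1r.
by rewrite rmorphM fmorphV.
Qed.

Lemma mean_value_hol beta r F : 0 <= r < beta -> hol beta F -> cavg r F = F 0.
Proof.
move=> rb H; apply: (@mean_value _ _ beta 0) => // z zb; last by move=> _; exact: H.
by apply: cdiff_ccont; exact: H.
Qed.

Lemma cavg_conj_kernel beta r F w : 0 < r -> r < beta -> cabs w < r -> hol beta F ->
  cavg r (fun z => F z * (z / (z - w))^* ) = F 0.
Proof.
move=> r0 rb wr H; have w0 := cabs_ge0 w.
have rw : 0 < r + cabs w by lra.
(* The conjugated kernel has its pole at modulus r^2 / |w|. The number 2 r^2 / (r + |w|) lies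
   strictly between r and that modulus, and also makes sense for w = 0. *)
pose b := Num.min beta (2 * r ^+ 2 / (r + cabs w)).
have b1 : b <= beta by rewrite ge_min lexx.
have b2 : b <= 2 * r ^+ 2 / (r + cabs w) by rewrite ge_min lexx orbT.
have rb' : r < b by rewrite lt_min rb ltr_pdivlMr//; nra.
have N z : cabs z < b -> (r ^+ 2)%:C - w^* * z != 0.
  move=> zb; rewrite -cabs_gt0.
  have := cabs_triB (r ^+ 2)%:C (w^* * z); rewrite cabsM cabsJ cabsR ger0_norm ?sqr_ge0//.
  have : cabs w * cabs z < r ^+ 2; last by lra.
  have z1 : cabs z < 2 * r ^+ 2 / (r + cabs w) by lra.
  apply: (@le_lt_trans _ _ (cabs w * (2 * r ^+ 2 / (r + cabs w)))).
    by rewrite ler_wpM2l// ltW.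
  rewrite mulrA ltr_pdivrMr//.
  have : 0 < r ^+ 2 by rewrite exprn_gt0.
  by nra.
rewrite (@cavg_eq _ _ _ (fun z => F z * ((r ^+ 2)%:C / ((r ^+ 2)%:C - w^* * z)))) ?(ltW r0)//; last first.
  by move=> z zr; rewrite (@conj_kernel r).
rewrite (@mean_value_hol b); [|by rewrite (ltW r0)|].
  by rewrite mulr0 subr0 divff ?mulr1// -cabs_gt0 cabsR normr_gt0 expf_neq0// gt_eqF.
move=> z zb; apply: cdiffM; first by apply: H; exact: lt_le_trans b1.
apply: cdiffM; first exact: cdiff_cst.
apply: cdiffV; first exact: N.
by apply: cdiffB; [exact: cdiff_cst|apply: cdiffM; [exact: cdiff_cst|exact: cdiff_id]].
Qed.

Lemma conc_kernel r w k : cabs w < r -> conc r (fun z => z / (z - w) ^+ k).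
Proof.
move=> wr z zr; apply: ccontM; first exact: ccont_id.
apply: ccontV; first by rewrite expf_neq0// (circle_sub_neq0 zr).
by apply: cdiff_ccont; apply: cdiffX; exact: cdiff_sub.
Qed.

Lemma concM r F G : conc r F -> conc r G -> conc r (fun z => F z * G z).
Proof. by move=> H K z zr; apply: ccontM; [exact: H|exact: K]. Qed.

Lemma cavg_kernel r w : 0 < r -> cabs w < r -> cavg r (fun z => z / (z - w)) = 1.
Proof.
move=> r0 wr; have C : conc r (fun z => z / (z - w)).
  by move=> z zr; have := conc_kernel 1 wr zr.
apply: cconj_inj; rewrite -cavg_conj ?(ltW r0)//.
have rb : r < r + 1 by lra.
have H1 := @cavg_conj_kernel (r + 1) r (fun=> 1) w r0 rb wr (fun z _ => cdiff_cst 1 z).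
have -> : (1 : R[i])^* = 1 by exact: rmorph1.
rewrite -[RHS]H1; apply: cavg_eq; first exact: ltW.
by move=> z _; rewrite mul1r.
Qed.

Lemma cauchy_formula beta r F w : 0 < r -> r < beta -> cabs w < r -> hol beta F ->
  F w = cavg r (fun z => F z * (z / (z - w))).
Proof.
move=> r0 rb wr H; have wb := lt_trans wr rb.
have [l Hl] := H _ wb.
(* z times the difference quotient, extended continuously to w. The factor z gives Q 0 = 0, also
   when w = 0, so the circle average of Q vanishes; on the circle Q is the difference of the two
   Cauchy integrands. *)
pose Q z := if z == w then w * l else z * ((F z - F w) / (z - w)).
have Qd z : cabs z < beta -> z != w -> cdiff Q z.
  move=> zb zw; have d0 : 0 < cabs (z - w) by rewrite cabs_gt0 subr_eq0.
  apply: (@cdiff_eq _ (fun z => z * ((F z - F w) / (z - w))) _ _ (cabs (z - w))) => //.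
    move=> x xz; rewrite /Q; case: eqP => // xw.
    by rewrite xw cabsBC ltxx in xz.
  apply: cdiffM; first exact: cdiff_id.
  apply: cdiffM; first by apply: cdiffB; [exact: H|exact: cdiff_cst].
  by apply: cdiffV; [rewrite subr_eq0|exact: cdiff_sub].
have Qw : ccont Q w.
  apply/ccontP => e e0; pose A := cabs w + cabs l + 1.
  have A0 : 0 < A by have := cabs_ge0 w; have := cabs_ge0 l; rewrite /A; lra.
  pose e1 := Num.min 1 (e / (2 * A)).
  have e10 : 0 < e1 by rewrite lt_min ltr01 divr_gt0// mulr_gt0.
  have e11 : e1 <= 1 by rewrite ge_min lexx.
  have e12 : e1 * A <= e / 2.
    rewrite -ler_pdivlMr//; apply: (@le_trans _ _ (e / (2 * A))).
      by rewrite ge_min lexx orbT.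
    by rewrite invfM mulrA.
  have [d d0 K] := Hl _ e10.
  exists (Num.min d e1); first by rewrite lt_min d0.
  move=> z; rewrite lt_min => /andP[zd ze]; rewrite /Q eqxx.
  have [_|zw] := eqVneq z w; first by rewrite subrr cabs0 ltW.
  have zw0 : z - w != 0 by rewrite subr_eq0.
  have zw1 : 0 < cabs (z - w) by rewrite cabs_gt0.
  have := K _ zd; rewrite subrKC => k1.
  rewrite (_ : _ - _ = z * ((F z - F w - l * (z - w)) / (z - w)) + (z - w) * l); last by field.
  apply: le_trans (cabsD _ _) _; rewrite !cabsM cabsV.
  have k2 : cabs (F z - F w - l * (z - w)) / cabs (z - w) <= e1 by rewrite ler_pdivrMr.
  have k3 : cabs z <= cabs w + 1.
    by have := cabsD (z - w) w; rewrite subrK; lra.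
  have k4 := ler_pM (cabs_ge0 z) (divr_ge0 (cabs_ge0 _) (ltW zw1)) k3 k2.
  have k5 : cabs (z - w) * cabs l <= e1 * cabs l by rewrite ler_wpM2r ?cabs_ge0// ltW.
  by move: e12; rewrite /A; lra.
have := @mean_value _ Q beta w r _ _ Qd.
rewrite (ltW r0) rb /= => /(_ isT)/=.
have -> : Q 0 = 0 by rewrite /Q; case: eqP => [<-|]; rewrite mul0r.
have QC z : cabs z < beta -> ccont Q z.
  move=> zb; have [->//|zw] := eqVneq z w; by apply: cdiff_ccont; exact: Qd.
move=> /(_ QC).
have C0 := conc_kernel 1 wr.
have cF := hol_conc rb H.
rewrite (@cavg_eq _ _ _ (fun z => F z * (z / (z - w)) - F w * (z / (z - w)))) ?(ltW r0)//; last first.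
  move=> z zr; rewrite /Q; have zw := circle_sub_neq0 zr wr.
  by rewrite -subr_eq0 (negbTE zw); field.
rewrite cavgB ?(ltW r0)//; [|exact: concM|by apply: concM C0 => z _; exact: ccont_cst].
rewrite cavgZ ?(ltW r0)// cavg_kernel// mulr1 => /eqP.
by rewrite subr_eq0 => /eqP.
Qed.

(** Since dz = i z dt on the circle, this is the Cauchy integral of psi(z) / (z - w)^(k+1) divided
    by 2 pi i, that is, the k-th derivative of [ctrans 0 psi r] divided by k!. *)
Definition ctrans k psi r w := cavg r (fun z => psi z * (z / (z - w) ^+ k.+1)).

Lemma conc_ctrans k psi r w : cabs w < r -> conc r psi ->
  conc r (fun z => psi z * (z / (z - w) ^+ k.+1)).
Proof. by move=> wr H; apply: concM => //; exact: conc_kernel. Qed.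

Lemma circle_sub_ge r s z w : s < r -> cabs z = r -> cabs w <= s -> r - s <= cabs (z - w).
Proof. by move=> sr zr ws; have := cabs_triB z w; rewrite zr; lra. Qed.

Section CauchyTransform.
Variables (psi : R[i] -> R[i]) (g : R[i] -> R) (r s : R).
Hypotheses (r0 : 0 < r) (sr : s < r) (Hpsi : conc r psi) (Hg : rconc r g).
Hypothesis bound : forall z, cabs z = r -> cabs (psi z) <= g z.

Let rs0 : 0 < r - s. Proof. by rewrite subr_gt0. Qed.

(** The bound involves the average of a majorant g, not a maximum of psi: for psi = 2 Re h only the
    mean of |Re h| will be known. *)
Lemma ctrans_bound k w : cabs w <= s -> cabs (ctrans k psi r w) <= 2 * ravg r g * (r / (r - s) ^+ k.+1).
Proof.
move=> ws; have wr := le_lt_trans ws sr.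
rewrite -mulrA [ravg r g * _]mulrC -ravgZ//; apply: cavg_bound; [exact: ltW|exact: conc_ctrans|exact: rconcZ|].
move=> z zr; rewrite mulrC cabsM cabs_div cabsX zr ler_pM ?cabs_ge0//.
- by rewrite divr_ge0 ?exprn_ge0 ?cabs_ge0// ltW.
- have h := circle_sub_ge sr zr ws.
  rewrite ler_pM2l// lef_pV2 ?posrE ?exprn_gt0//; last exact: lt_le_trans h.
  by rewrite lerXn2r ?nnegrE ?cabs_ge0 ?(ltW rs0).
- exact: bound.
Qed.

Lemma ctrans_quad0 w h : cabs w <= s -> cabs (w + h) <= s ->
  cabs (ctrans 0 psi r (w + h) - ctrans 0 psi r w - ctrans 1 psi r w * h)
    <= 2 * ravg r g * (r / (r - s) ^+ 3) * cabs h ^+ 2.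
Proof.
move=> ws whs; have wr := le_lt_trans ws sr; have whr := le_lt_trans whs sr.
rewrite /ctrans -cavgB ?(ltW r0)//; try exact: conc_ctrans.
rewrite -cavgZr ?(ltW r0)//; last exact: conc_ctrans.
have D1 : conc r (fun z => psi z * (z / (z - (w + h)) ^+ 1) - psi z * (z / (z - w) ^+ 1)).
  by move=> z zr; apply: ccontB; exact: conc_ctrans zr.
have D2 : conc r (fun z => psi z * (z / (z - w) ^+ 2) * h).
  by apply: concM; [exact: conc_ctrans|move=> z _; exact: ccont_cst].
rewrite -cavgB ?(ltW r0)//.
rewrite -mulrA -mulrA [ravg r g * _]mulrC -ravgZ//. apply: cavg_bound; [exact: ltW| |exact: rconcZ|].
  by move=> z zr; apply: ccontB; [exact: D1|exact: D2].
move=> z zr; have h1 := circle_sub_ge sr zr ws; have h2 := circle_sub_ge sr zr whs.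
have n1 := circle_sub_neq0 zr wr; have n2 := circle_sub_neq0 zr whr.
rewrite (_ : _ - _ = (z * h ^+ 2 / ((z - w) ^+ 2 * (z - (w + h)))) * psi z); last first.
  by field; rewrite n1 n2.
rewrite cabsM ler_pM ?cabs_ge0//; last exact: bound.
rewrite cabs_div (cabsM z) (cabsM ((z - w) ^+ 2)) !cabsX zr mulrAC ler_wpM2r ?exprn_ge0 ?cabs_ge0// ler_pM2l//.
have a0 := lt_le_trans rs0 h1; have b0 := lt_le_trans rs0 h2.
rewrite lef_pV2 ?posrE ?mulr_gt0 ?exprn_gt0// exprSr ler_pM ?exprn_ge0 ?(ltW rs0)//.
by rewrite lerXn2r ?nnegrE ?cabs_ge0 ?(ltW rs0).
Qed.

Lemma ctrans_quad1 w h : cabs w <= s -> cabs (w + h) <= s ->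
  cabs (ctrans 1 psi r (w + h) - ctrans 1 psi r w - 2 * ctrans 2 psi r w * h)
    <= 2 * ravg r g * (3 * r / (r - s) ^+ 4) * cabs h ^+ 2.
Proof.
move=> ws whs; have wr := le_lt_trans ws sr; have whr := le_lt_trans whs sr.
rewrite /ctrans -cavgB ?(ltW r0)//; try exact: conc_ctrans.
rewrite -cavgZ ?(ltW r0)//; last exact: conc_ctrans.
rewrite -cavgZr ?(ltW r0)//; last first.
  by apply: concM; [move=> z _; exact: ccont_cst|exact: conc_ctrans].
have D1 : conc r (fun z => psi z * (z / (z - (w + h)) ^+ 2) - psi z * (z / (z - w) ^+ 2)).
  by move=> z zr; apply: ccontB; exact: conc_ctrans zr.
have D2 : conc r (fun z => 2 * (psi z * (z / (z - w) ^+ 3)) * h).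
  apply: concM; last by move=> z _; exact: ccont_cst.
  by apply: concM; [move=> z _; exact: ccont_cst|exact: conc_ctrans].
rewrite -cavgB ?(ltW r0)//.
rewrite -mulrA -mulrA [ravg r g * _]mulrC -ravgZ//. apply: cavg_bound; [exact: ltW| |exact: rconcZ|].
  by move=> z zr; apply: ccontB; [exact: D1|exact: D2].
move=> z zr; have h1 := circle_sub_ge sr zr ws; have h2 := circle_sub_ge sr zr whs.
have n1 := circle_sub_neq0 zr wr; have n2 := circle_sub_neq0 zr whr.
rewrite (_ : _ - _ = (z * h ^+ 2 * (2 / ((z - w) ^+ 3 * (z - (w + h))) + ((z - w) ^+ 2 * (z - (w + h)) ^+ 2)^-1)) * psi z); last first.
  by field; rewrite n1 n2.
rewrite cabsM ler_pM ?cabs_ge0//; last exact: bound.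
rewrite (cabsM (z * h ^+ 2)) (cabsM z) cabsX zr.
rewrite (_ : 3 * r / _ * _ = r * cabs h ^+ 2 * (3 / (r - s) ^+ 4)); last by ring.
rewrite ler_wpM2l ?mulr_ge0 ?exprn_ge0 ?cabs_ge0 ?(ltW r0)//.
have a0 := lt_le_trans rs0 h1; have b0 := lt_le_trans rs0 h2.
have aux j k : cabs ((z - w) ^+ j * (z - (w + h)) ^+ k)^-1 <= (r - s) ^- (j + k).
  rewrite cabsV cabsM !cabsX lef_pV2 ?posrE ?mulr_gt0 ?exprn_gt0// exprD.
  by rewrite ler_pM ?exprn_ge0 ?(ltW rs0)// lerXn2r ?nnegrE ?cabs_ge0 ?(ltW rs0).
apply: le_trans (cabsD _ _) _; rewrite cabsM.
have -> : cabs (2 : R[i]) = 2.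
  by rewrite (_ : 2 = 2%:C) ?cabsR ?ger0_norm// rmorph_nat.
have := aux 3 1%N; have := aux 2 2; rewrite expr1 /= => ? ?; lra.
Qed.

End CauchyTransform.

Lemma ctrans_cder psi r w : 0 < r -> conc r psi -> cabs w < r ->
  cder (ctrans 0 psi r) w (ctrans 1 psi r w).
Proof.
move=> r0 H wr; pose s := (cabs w + r) / 2; have sr : s < r by rewrite /s; lra.
have ws : cabs w < s by rewrite /s; lra.
have Hg := conc_rcabs (ltW r0) H.
apply: (@cder_quad _ _ _ _ (2 * ravg r (fun z => cabs (psi z)) * (r / (r - s) ^+ 3)) (s - cabs w)).
  by rewrite subr_gt0.
move=> h hs; apply: ctrans_quad0 => //; first exact: ltW.
by have := cabsD w h; lra.
Qed.

Lemma ctrans_cder1 psi r w : 0 < r -> conc r psi -> cabs w < r ->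
  cder (ctrans 1 psi r) w (2 * ctrans 2 psi r w).
Proof.
move=> r0 H wr; pose s := (cabs w + r) / 2; have sr : s < r by rewrite /s; lra.
have ws : cabs w < s by rewrite /s; lra.
have Hg := conc_rcabs (ltW r0) H.
apply: (@cder_quad _ _ _ _ (2 * ravg r (fun z => cabs (psi z)) * (3 * r / (r - s) ^+ 4)) (s - cabs w)).
  by rewrite subr_gt0.
move=> h hs; apply: ctrans_quad1 => //; first exact: ltW.
by have := cabsD w h; lra.
Qed.

Lemma cauchy_ctrans beta r F w : 0 < r -> r < beta -> cabs w < r -> hol beta F ->
  F w = ctrans 0 F r w.
Proof. exact: cauchy_formula. Qed.

Lemma cderiv_ctrans beta r F w : 0 < r -> r < beta -> cabs w < r -> hol beta F ->
  cder F w (ctrans 1 F r w).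
Proof.
move=> r0 rb wr H; apply: (@cder_eq _ (ctrans 0 F r) _ _ _ (r - cabs w)); first by rewrite subr_gt0.
  move=> z zw; rewrite -(@cauchy_ctrans beta)//.
  by have := cabsD (z - w) w; rewrite subrK; lra.
by apply: ctrans_cder => //; exact: hol_conc rb H.
Qed.

Lemma cdiff_cder F w : cdiff F w -> cder F w (cderiv F w).
Proof. by case=> l Hl; rewrite (cder_cderiv Hl). Qed.

Lemma hol_cderiv beta F : hol beta F -> hol beta (cderiv F).
Proof.
move=> H w wb; pose r := (cabs w + beta) / 2.
have rb : r < beta by rewrite /r; lra.
have wr : cabs w < r by rewrite /r; lra.
have r0 : 0 < r by have := cabs_ge0 w; lra.
exists (2 * ctrans 2 F r w); apply: (@cder_eq _ (ctrans 1 F r) _ _ _ (r - cabs w)); first by rewrite subr_gt0.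
  move=> z zw; apply/esym/cder_cderiv/(@cderiv_ctrans beta) => //.
  by have := cabsD (z - w) w; rewrite subrK; lra.
by apply: ctrans_cder1 => //; exact: hol_conc rb H.
Qed.

Lemma hol_quad beta s F : s < beta -> hol beta F -> exists2 K : R, 0 <= K &
  (forall w, cabs w <= s -> cabs (cderiv F w) <= K) /\
  (forall w h, cabs w <= s -> cabs (w + h) <= s ->
    cabs (F (w + h) - F w - cderiv F w * h) <= K * cabs h ^+ 2).
Proof.
move=> sb H; have [s0|s0] := ltP s 0.
  by exists 0 => //; split=> [w|w h]; have := cabs_ge0 w; lra.
pose r := (s + beta) / 2; have rb : r < beta by rewrite /r; lra.
have sr : s < r by rewrite /r; lra.
have r0 : 0 < r by lra.
have cF := hol_conc rb H; have Hg := conc_rcabs (ltW r0) cF.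
pose A := 2 * ravg r (fun z => cabs (F z)).
have A0 : 0 <= A by rewrite mulr_ge0// ravg_ge0 ?(ltW r0)// => z _; exact: cabs_ge0.
have q0 k : 0 <= r / (r - s) ^+ k by rewrite divr_ge0 ?exprn_ge0 ?subr_ge0// ltW.
pose K1 := A * (r / (r - s) ^+ 2); pose K2 := A * (r / (r - s) ^+ 3).
have K10 : 0 <= K1 by rewrite mulr_ge0.
have K20 : 0 <= K2 by rewrite mulr_ge0.
have E w : cabs w <= s -> cderiv F w = ctrans 1 F r w.
  by move=> ws; apply/cder_cderiv/(@cderiv_ctrans beta) => //; exact: le_lt_trans sr.
exists (K1 + K2); first exact: addr_ge0.
split=> [w ws|w h ws whs].
  rewrite E//; apply: le_trans (_ : _ <= K1) _; last by rewrite lerDl.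
  exact: (@ctrans_bound F (fun z => cabs (F z))).
rewrite E// !(@cauchy_ctrans beta r F)//; try exact: le_lt_trans sr.
apply: le_trans (_ : _ <= K2 * cabs h ^+ 2) _; last by rewrite ler_wpM2r ?exprn_ge0 ?cabs_ge0// lerDr.
exact: (@ctrans_quad0 F (fun z => cabs (F z))).
Qed.

(* The quotient is the Cauchy transform of F / (z - a), also at a itself. *)
Lemma hol_divide beta F a : hol beta F -> cabs a < beta -> F a = 0 ->
  exists2 G, hol beta G & forall z, F z = (z - a) * G z.
Proof.
move=> H ab Fa; pose G z := if z == a then cderiv F a else F z / (z - a).
exists G; last first.
  move=> z; rewrite /G; have [->|za] := eqVneq z a; first by rewrite Fa subrr mul0r.
  by rewrite mulrC divfK// subr_eq0.
move=> w wb; have [->|wa] := eqVneq w a; last first.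
  have d0 : 0 < cabs (w - a) by rewrite cabs_gt0 subr_eq0.
  apply: (@cdiff_eq _ (fun z => F z / (z - a)) _ _ (cabs (w - a))) => //.
    by move=> x xw; rewrite /G; case: eqP => // xa; rewrite xa cabsBC ltxx in xw.
  by apply: cdiffM; [exact: H|apply: cdiffV; [rewrite subr_eq0|exact: cdiff_sub]].
pose r := (cabs a + beta) / 2; have rb : r < beta by rewrite /r; lra.
have ar : cabs a < r by rewrite /r; lra.
have r0 : 0 < r by have := cabs_ge0 a; lra.
pose psi z := F z / (z - a).
have cF := hol_conc rb H.
have Cpsi : conc r psi.
  move=> z zr; apply: ccontM; first exact: cF.
  by apply: ccontV; [exact: circle_sub_neq0 zr ar|exact: ccont_sub].
have [l Hl] : cdiff (ctrans 0 psi r) a by eexists; exact: ctrans_cder.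
exists l; apply: (@cder_eq _ _ _ _ _ (r - cabs a) _ _ Hl); first by rewrite subr_gt0.
move=> z za; have zr : cabs z < r by have := cabsD (z - a) a; rewrite subrK; lra.
rewrite /G; have [->|zna] := eqVneq z a.
  rewrite (cder_cderiv (cderiv_ctrans r0 rb ar H)); apply: cavg_eq; first exact: ltW.
  move=> x xr; have := circle_sub_neq0 xr ar => n; rewrite /psi; field; exact: n.
have E0 : F z = F z - F a by rewrite Fa subr0.
rewrite {1}E0 (cauchy_ctrans r0 rb zr H) (cauchy_ctrans r0 rb ar H).
rewrite -cavgB ?(ltW r0)//; try exact: conc_ctrans.
have za0 : z - a != 0 by rewrite subr_eq0.
rewrite -cavgZr ?(ltW r0)//; last first.
  by move=> x xr; apply: ccontB; [exact: (conc_ctrans 0 zr cF)|exact: (conc_ctrans 0 ar cF)].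
apply: cavg_eq; first exact: ltW.
move=> x xr; have n1 := circle_sub_neq0 xr ar; have n2 := circle_sub_neq0 xr zr.
by rewrite /psi; field; rewrite n1 n2 za0.
Qed.

(** The primitive is the integral of F along the ray from 0 to w. Its increment is compared with h
    F(w) under the integral sign, where the two integrands differ by a quadratic remainder supplied
    by [hol_quad]. *)
Lemma hol_primitive beta F : hol beta F ->
  exists H, H 0 = 0 /\ forall w, cabs w < beta -> cder H w (F w).
Proof.
move=> HF; have HF' := hol_cderiv HF.
pose H w := cint 0 1 (fun t => w * F (0 + t%:C * w)).
have ray w t : cabs w < beta -> 0 <= t <= 1 -> cabs (0 + t%:C * w) < beta.
  move=> wb /andP[t0 t1]; rewrite add0r cabsM cabsR ger0_norm//.
  by apply: le_lt_trans wb; rewrite ler_piMl ?cabs_ge0.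
have P G w : hol beta G -> cabs w < beta -> pcon 0 1 (fun t => G (0 + t%:C * w)).
  move=> HG wb; apply: pcon_comp => t ht; first exact: pcont_line.
  by apply: cdiff_ccont; apply: HG; exact: ray.
have PH w : cabs w < beta -> pcon 0 1 (fun t => w * F (0 + t%:C * w)).
  by move=> wb; apply: pconM; [exact: pcon_cst|exact: P].
have Ptw w : pcon 0 1 (fun t : R => t%:C * w).
  by apply: pconM; [apply: pcon_real => t _; exact: cvg_id|exact: pcon_cst].
exists H; split.
  rewrite /H (@cint_eq _ _ _ _ (fun=> 0)); last by move=> t _; rewrite mul0r.
  by rewrite cint_cst// mul0r.
move=> w wb; pose s := (cabs w + beta) / 2.
have sb : s < beta by rewrite /s; lra.
have ws : cabs w < s by rewrite /s; lra.
have [K K0 [B Q]] := hol_quad sb HF.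
(* The integrand is the derivative of t F(t w), whose values at 0 and 1 are 0 and F(w). *)
have FE : F w = cint 0 1 (fun t => F (0 + t%:C * w) + t%:C * w * cderiv F (0 + t%:C * w)).
  have := @cint_line R 0 1 (fun x => x * F (0 + x * w)) (fun x => F (0 + x * w) + x * w * cderiv F (0 + x * w)) 0 1 ler01.
  have z0 : 0%:C = 0 :> R[i] by []. have o1 : 1%:C = 1 :> R[i] by [].
  rewrite z0 o1 !mulr1 addr0 !add0r mul0r !mul1r subr0 => <-.
  - by apply: cint_eq => t _; rewrite !mulr1 !add0r.
  - move=> t ht; rewrite !mulr1 !add0r.
    have dl : cder (fun x => 0 + x * w) t%:C w.
      have := cderD (cder_cst 0 t%:C) (cderM (cder_id t%:C) (cder_cst w t%:C)).
      by rewrite mulr0 addr0 mul1r add0r.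
    have tb := ray _ _ wb ht; rewrite add0r in tb.
    have dF : cder F (0 + t%:C * w) (cderiv F (t%:C * w)).
      by rewrite add0r; apply: cdiff_cder; exact: HF.
    have := cderM (cder_id t%:C) (cder_comp dl dF); rewrite /= mul1r add0r.
    by rewrite -mulrA [w * _]mulrC.
  - move=> t ht; have tb := ray _ _ wb ht; rewrite add0r in tb.
    rewrite (_ : 0 + t%:C * 1 = t%:C :> R[i]); last by rewrite mulr1 add0r.
    have cl : ccont (fun x => 0 + x * w) t%:C.
      apply: ccontD; first exact: ccont_cst.
      by apply: ccontM; [exact: ccont_id|exact: ccont_cst].
    have cc G : ccont G (t%:C * w) -> ccont (fun x => G (0 + x * w)) t%:C.
      by move=> HG; apply: (@ccont_comp _ (fun x => 0 + x * w) G) => //; rewrite add0r.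
    apply: ccontD; first by apply: cc; exact: cdiff_ccont (HF _ tb).
    apply: ccontM; first by apply: ccontM; [exact: ccont_id|exact: ccont_cst].
    by apply: cc; exact: cdiff_ccont (HF' _ tb).
apply: (@cder_quad _ _ _ _ (2 * (cabs w * K + (K * (s - cabs w) + K))) (s - cabs w)).
  by rewrite subr_gt0.
move=> h hs; have whs : cabs (w + h) < s by have := cabsD w h; lra.
have whb := lt_trans whs sb.
have P1 := P _ _ HF wb; have P2 := P _ _ HF' wb; have P3 := P _ _ HF whb.
have PI : pcon 0 1 (fun t => F (0 + t%:C * w) + t%:C * w * cderiv F (0 + t%:C * w)).
  by apply: pconD => //; apply: pconM.
have PI' : pcon 0 1 (fun t => (F (0 + t%:C * w) + t%:C * w * cderiv F (0 + t%:C * w)) * h).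
  by apply: pconM => //; exact: pcon_cst.
rewrite FE -cintZr// /H -cintB; try exact: PH.
rewrite -cintB//; last by apply: pconB; exact: PH.
set X := (2 * _ * _); have -> : X = 2 * ((cabs w * K + (K * (s - cabs w) + K)) * cabs h ^+ 2) * (1 - 0).
  by rewrite /X subr0 mulr1 mulrA.
apply: cint_bound_cst => //; first by apply: pconB => //; apply: pconB; exact: PH.
move=> t /andP[t0 t1]; rewrite !add0r.
have tz z : cabs z <= s -> cabs (t%:C * z) <= s.
  by move=> zs; rewrite cabsM cabsR ger0_norm//; apply: le_trans zs; rewrite ler_piMl ?cabs_ge0.
have tws := tz _ (ltW ws); have twhs := tz _ (ltW whs).
have th : cabs (t%:C * h) <= cabs h by rewrite cabsM cabsR ger0_norm// ler_piMl ?cabs_ge0.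
have E : t%:C * (w + h) = t%:C * w + t%:C * h by rewrite mulrDr.
rewrite E in twhs *.
have q := Q _ _ tws twhs; have b := B _ tws.
set D := F (t%:C * w + t%:C * h) - F (t%:C * w) - cderiv F (t%:C * w) * (t%:C * h) in q.
rewrite (_ : _ - _ = w * D + h * (D + cderiv F (t%:C * w) * (t%:C * h))); last by rewrite /D; ring.
have h0 := cabs_ge0 h; have th0 := cabs_ge0 (t%:C * h).
have q' : cabs D <= K * cabs h ^+ 2.
  by apply: le_trans q _; rewrite ler_wpM2l// lerXn2r ?nnegrE.
have q2 : cabs D <= K * (s - cabs w) * cabs h.
  by apply: le_trans q' _; rewrite expr2 mulrA ler_wpM2r// ler_wpM2l// ltW.
have q3 : cabs (cderiv F (t%:C * w) * (t%:C * h)) <= K * cabs h.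
  by rewrite cabsM ler_pM// cabs_ge0.
have q4 := cabsD D (cderiv F (t%:C * w) * (t%:C * h)).
apply: le_trans (cabsD _ _) _; rewrite !cabsM [X in _ <= X]mulrDl; apply: lerD.
  by rewrite -mulrA ler_wpM2l ?cabs_ge0.
by rewrite expr2 [X in _ <= X]mulrA [X in _ <= X]mulrC ler_wpM2l//; lra.
Qed.

Lemma hol_cst0 beta F w : hol beta F -> (forall z, cabs z < beta -> cder F z 0) ->
  cabs w < beta -> F w = F 0.
Proof.
move=> H D wb; have := @cint_line R 0 1 F (fun=> 0) 0 w ler01.
have z0 : 0%:C = 0 :> R[i] by []. have o1 : 1%:C = 1 :> R[i] by [].
rewrite z0 o1 mul0r !add0r mul1r => E; apply/eqP; rewrite -subr_eq0 -E.
- by rewrite cint_cst// mul0r.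
- move=> t /andP[t0 t1]; apply: D; rewrite add0r cabsM cabsR ger0_norm//.
  by apply: le_lt_trans wb; rewrite ler_piMl ?cabs_ge0.
- by move=> t _; exact: ccont_cst.
Qed.

Lemma hol_log beta F : hol beta F -> (forall z, cabs z < beta -> F z != 0) ->
  exists2 H, hol beta H & forall z, cabs z < beta -> F z = F 0 * cexp (H z).
Proof.
move=> HF F0; have HL : hol beta (fun z => cderiv F z / F z).
  move=> z zb; apply: cdiffM; first exact: (hol_cderiv HF).
  by apply: cdiffV; [exact: F0|exact: HF].
have [H [H0 dH]] := hol_primitive HL.
exists H; first by move=> z zb; eexists; exact: dH.
have D z : cabs z < beta -> cder (fun z => F z * cexp (- H z)) z 0.
  move=> zb; have := cderM (cdiff_cder (HF _ zb)) (cder_comp (cderN (dH _ zb)) (cder_cexp _)).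
  rewrite /= (_ : _ + _ = 0)//; field; exact: F0.
move=> z zb; have := @hol_cst0 beta _ z (fun z zb => ex_intro _ _ (D z zb)) D zb.
by rewrite /= H0 oppr0 cexp0 mulr1 => <-; rewrite cexpN divfK// cexp_neq0.
Qed.

Lemma conc_conj r F : conc r F -> conc r (fun z => (F z)^*).
Proof.
move=> H z /H /ccontP K; apply/ccontP => e /K[d d0 Hd]; exists d => // w /Hd.
by rewrite -rmorphB cabsJ.
Qed.

(** Against the Cauchy kernel, F averages to F(w) and its conjugate to the conjugate of F(0); adding
    the two leaves 2 Re F under the average. Hence h and its derivatives are controlled by Re h
    alone, up to an additive constant. *)
Lemma schwarz_formula beta r F w : 0 < r -> r < beta -> cabs w < r -> hol beta F ->
  F w = ctrans 0 (fun z => (2 * Re (F z))%:C) r w - (F 0)^*.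
Proof.
move=> r0 rb wr H; have cF := hol_conc rb H; have cK := conc_kernel 1 wr.
have E : (F 0)^* = cavg r (fun z => (F z)^* * (z / (z - w))).
  rewrite -(cavg_conj_kernel r0 rb wr H) -cavg_conj ?(ltW r0)//; last by apply: concM cF _; exact: conc_conj.
  apply: cavg_eq; first exact: ltW.
  by move=> z _; rewrite cconjM cconjK.
rewrite {1}(cauchy_formula r0 rb wr H) E /ctrans.
apply/eqP; rewrite eq_sym subr_eq -cavgD ?(ltW r0)//; [|exact: concM|by apply: concM => //; exact: conc_conj].
apply/eqP/cavg_eq => [|z _]; first exact: ltW.
rewrite expr1 -mulrDl; congr (_ * _).
by case: (F z) => a b; apply: complex_ext; rewrite /=; ring.
Qed.

End CauchyFormula.

(** * Blaschke factors and the Poisson-Jensen formula *)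

Section Blaschke.
Variable R : realType.
Implicit Types (F G : R[i] -> R[i]) (z w c a : R[i]) (r s beta : R).

(* The denominator of the Blaschke factor (w - c) / blden r c w of the disc of
   radius r; when c lies outside the disc the factor is 1. *)
Definition blden r c w : R[i] :=
  if cabs c < r then ((r ^+ 2)%:C - c^* * w) / r%:C else w - c.

Lemma blaschke_identity r c w :
  cabs ((r ^+ 2)%:C - c^* * w) ^+ 2 - r ^+ 2 * cabs (w - c) ^+ 2
    = (r ^+ 2 - cabs c ^+ 2) * (r ^+ 2 - cabs w ^+ 2).
Proof.
by rewrite !sqr_cabs; case: c => a b; case: w => x y; rewrite /=; ring.
Qed.

Lemma cabs_real_ge0 (x : R) : 0 <= x -> cabs x%:C = x.
Proof. by move=> x0; rewrite cabsR ger0_norm. Qed.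

Lemma blden_circle r c z : 0 < r -> cabs z = r -> cabs (blden r c z) = cabs (z - c).
Proof.
move=> r0 zr; rewrite /blden; case: ifP => // _.
have := blaschke_identity r c z; rewrite zr subrr mulr0 => /eqP; rewrite subr_eq0 => /eqP E.
rewrite cabs_div cabs_real_ge0 ?ltW//; apply/(mulIf (lt0r_neq0 r0)).
rewrite divfK ?gt_eqF//; apply/eqP; rewrite -(@eqrXn2 _ 2)// ?mulr_ge0 ?cabs_ge0 ?ltW//.
by rewrite E exprMn mulrC.
Qed.

Lemma blden_lower r c w : cabs c * cabs w <= r ^+ 2 ->
  r ^+ 2 - cabs c * cabs w <= cabs ((r ^+ 2)%:C - c^* * w).
Proof.
move=> h; have := cabs_triB (r ^+ 2)%:C (c^* * w).
by rewrite cabsM cabsJ cabs_real_ge0 ?sqr_ge0.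
Qed.

(** The first condition puts the reflected point r^2 / conj(c), the zero of the denominator, outside
    |w| < beta; the second does the same for c itself when the factor is 1. *)
Lemma blden_neq0 r beta c w : 0 < r -> r < beta -> (cabs c < r -> cabs c * beta <= r ^+ 2) ->
  (r <= cabs c -> beta <= cabs c) -> cabs w < beta -> blden r c w != 0.
Proof.
move=> r0 rb H1 H2 wb; rewrite /blden; have [cr|rc] := ltP.
  rewrite mulf_neq0// ?invr_neq0//; last by rewrite -cabs_gt0 cabs_real_ge0 ?ltW.
  have h : cabs c * cabs w < r ^+ 2.
    have [->|c0] := eqVneq (cabs c) 0; first by rewrite mul0r exprn_gt0.
    have cp : 0 < cabs c by rewrite lt_neqAle eq_sym c0 cabs_ge0.
    by apply: lt_le_trans (H1 cr); rewrite ltr_pM2l.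
  by rewrite -cabs_gt0; apply: lt_le_trans (blden_lower (ltW h)); rewrite subr_gt0.
by rewrite subr_eq0; apply/eqP => E; have := H2 rc; rewrite -E leNgt wb.
Qed.

Lemma cdiff_blden r c w : cdiff (blden r c) w.
Proof.
rewrite /blden; case: (cabs c < r); last exact: cdiff_sub.
apply: cdiffM; last exact: cdiff_cst.
by apply: cdiffB; [exact: cdiff_cst|apply: cdiffM; [exact: cdiff_cst|exact: cdiff_id]].
Qed.

Lemma geometric_small (q e : R) : 0 <= q < 1 -> 0 < e -> exists n : nat, q ^+ n < e.
Proof.
move=> /andP[q0 q1] e0; have : q ^+ n @[n --> \oo] --> (0 : R).
  by apply: cvg_expr; rewrite ger0_norm.
move=> /cvgrPdist_lt /(_ e e0)[n _ /(_ n (leqnn n))]; rewrite /= sub0r normrN.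
by rewrite ger0_norm ?exprn_ge0//; exists n.
Qed.

(** Otherwise n zeros in |z| <= s could be divided out for every n. Replacing each z - a by its
    Blaschke denominator does not change the modulus on |z| = r, so the Cauchy bound M at z1 is the
    same for all n. At z1 itself each replacement gains a factor q < 1 in the square of the modulus,
    so that |F(z1)|^2 <= q^n M^2, which is impossible for large n. *)
Lemma hol_zero_factorization beta s F z1 : s < beta -> hol beta F -> cabs z1 <= s -> F z1 != 0 ->
  exists A G, [/\ hol beta G, (forall z, F z = \prod_(a <- A) (z - a) * G z),
    {in A, forall a, cabs a <= s} & forall z, cabs z <= s -> G z != 0].
Proof.
move=> sb HF z1s Fz1; apply: contrapT => NE.
have s0 : 0 <= s := le_trans (cabs_ge0 _) z1s.
pose r := (s + beta) / 2; have sr : s < r by rewrite /r; lra.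
have rb : r < beta by rewrite /r; lra.
have r0 : 0 < r by lra.
have r2 : s ^+ 2 < r ^+ 2 by rewrite !expr2; nra.
have step n : exists A G, [/\ hol beta G, (forall z, F z = \prod_(a <- A) (z - a) * G z),
    {in A, forall a, cabs a <= s} & size A = n].
  elim: n => [|n [A [G [HG FG As sA]]]].
    by exists [::], F; split=> // z; rewrite big_nil mul1r.
  have [a [as0 Ga]] : exists a, cabs a <= s /\ G a = 0.
    apply: contrapT => N; apply: NE; exists A, G; split=> // z zs.
    by apply/negP => /eqP Gz; apply: N; exists z.
  have [G' HG' E] := hol_divide HG (le_lt_trans as0 sb) Ga.
  exists (a :: A), G'; split=> //=; last by rewrite sA.
    by move=> z; rewrite big_cons FG E; ring.
  by move=> b; rewrite inE => /predU1P[->//|]; exact: As.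
pose M := 2 * ravg r (fun z => cabs (F z)) * (r / (r - s) ^+ 1).
have cF := hol_conc rb HF.
have M0 : 0 <= M.
  apply: mulr_ge0; last by rewrite divr_ge0 ?expr1 ?subr_ge0 ?(ltW r0) ?(ltW sr).
  apply: mulr_ge0 => //; apply: ravg_ge0 => [|z _]; [exact: ltW|exact: cabs_ge0].
(* By [blaschke_identity], |z1 - a|^2 is smaller than the squared modulus of the denominator by a
   proportion of at least (r^2 - s^2)^2 / (2 r^2)^2, uniformly for |a|, |z1| <= s. *)
pose q := 1 - (r ^+ 2 - s ^+ 2) ^+ 2 / (2 * r ^+ 2) ^+ 2.
have rr0 : 0 < 2 * r ^+ 2 by rewrite mulr_gt0 ?exprn_gt0.
have q01 : 0 <= q < 1.
  rewrite /q subr_ge0 ler_pdivrMr ?exprn_gt0// mul1r gtrBl divr_gt0 ?exprn_gt0 ?subr_gt0// andbT.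
  rewrite lerXn2r ?nnegrE ?(ltW rr0) ?subr_ge0 ?(ltW r2)//.
  by have := sqr_ge0 s; lra.
have Fz10 : 0 < cabs (F z1) by rewrite cabs_gt0.
have e0 : 0 < cabs (F z1) ^+ 2 / (M ^+ 2 + 1).
  by rewrite divr_gt0 ?exprn_gt0//; have := sqr_ge0 M; lra.
have [n qn] := geometric_small q01 e0.
have [A [G [HG FG As sA]]] := step n.
have Ar a : a \in A -> cabs a < r by move=> /As h; exact: le_lt_trans sr.
have Bz a : a \in A -> cabs (z1 - a) ^+ 2 <= q * cabs (blden r a z1) ^+ 2.
  move=> aA; have ar := Ar _ aA; rewrite /blden ar cabs_div cabs_real_ge0 ?(ltW r0)//.
  have I := blaschke_identity r a z1; set D := cabs (_ - _ * _) in I *.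
  have a2 : cabs a ^+ 2 <= s ^+ 2 by rewrite lerXn2r ?nnegrE ?cabs_ge0//; exact: As.
  have z2 : cabs z1 ^+ 2 <= s ^+ 2 by rewrite lerXn2r ?nnegrE ?cabs_ge0.
  have D0 : 0 <= D by exact: cabs_ge0.
  have D2 : D <= 2 * r ^+ 2.
    apply: le_trans (cabsB _ _) _; rewrite cabs_real_ge0 ?sqr_ge0// cabsM cabsJ.
    have : cabs a * cabs z1 <= s * s by rewrite ler_pM ?cabs_ge0//; exact: As.
    by rewrite -expr2; lra.
  have D2' : D ^+ 2 <= (2 * r ^+ 2) ^+ 2 by rewrite lerXn2r ?nnegrE ?(ltW rr0).
  have p1 : (r ^+ 2 - s ^+ 2) ^+ 2 <= (r ^+ 2 - cabs a ^+ 2) * (r ^+ 2 - cabs z1 ^+ 2).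
    by rewrite expr2 ler_pM//; lra.
  have p2 : (r ^+ 2 - s ^+ 2) ^+ 2 / (2 * r ^+ 2) ^+ 2 * D ^+ 2 <= (r ^+ 2 - s ^+ 2) ^+ 2.
    by rewrite mulrAC ler_pdivrMr ?exprn_gt0// ler_wpM2l// sqr_ge0.
  rewrite expr_div_n mulrA ler_pdivlMr ?exprn_gt0// /q mulrBl mul1r mulrC; lra.
pose H z := \prod_(a <- A) blden r a z * G z.
have HH : hol beta H.
  move=> z zb; apply: cdiffM; last exact: HG.
  by apply: cdiff_prod => a; exact: cdiff_blden.
have HM : cabs (H z1) <= M.
  rewrite (cauchy_ctrans r0 rb (le_lt_trans z1s sr) HH).
  apply: ctrans_bound => //; first exact: hol_conc rb HH.
    exact: conc_rcabs (ltW r0) cF.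
  move=> z zr; rewrite FG /H !cabsM !cabs_prod_seq le_eqVlt; apply/orP; left; apply/eqP.
  by congr (_ * _); apply: eq_bigr => a _; exact: blden_circle.
have : cabs (F z1) ^+ 2 <= q ^+ n * M ^+ 2.
  rewrite FG cabsM exprMn.
  have : cabs (\prod_(a <- A) (z1 - a)) ^+ 2 <= q ^+ n * cabs (\prod_(a <- A) blden r a z1) ^+ 2.
    rewrite -sA {HH HM H FG step sA}; elim: A As Ar Bz => [|a A IH] As Ar Bz.
      by rewrite !big_nil mul1r.
    rewrite !big_cons !cabsM !exprMn [size _]/= [q ^+ _]exprS [leRHS]mulrACA ler_pM ?exprn_ge0 ?cabs_ge0//.
      by apply: Bz; rewrite mem_head.
    by apply: IH => b bA; [apply: As|apply: Ar|apply: Bz]; rewrite inE bA orbT.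
  move=> h; apply: (@le_trans _ _ (q ^+ n * cabs (H z1) ^+ 2)).
    by rewrite /H cabsM exprMn [leRHS]mulrA ler_wpM2r ?exprn_ge0 ?cabs_ge0.
  rewrite ler_wpM2l ?exprn_ge0//; first by case/andP: q01.
  by rewrite lerXn2r ?nnegrE ?cabs_ge0.
apply/negP; rewrite -ltNge.
have M2 : 0 < M ^+ 2 + 1 by have := sqr_ge0 M; lra.
apply: (@le_lt_trans _ _ (q ^+ n * (M ^+ 2 + 1))).
  by rewrite ler_wpM2l ?exprn_ge0//; [case/andP: q01|lra].
by rewrite -ltr_pdivlMr.
Qed.

End Blaschke.

(** * Poisson-Jensen: zeros and negative part of log |f| from the positive part *)

Section PoissonJensen.
Variable R : realType.
Implicit Types (z w a b c : R[i]).

(** The contribution of a zero c to the Poisson-Jensen formula is at least a third of this weight,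
    and the same weight is the numerator, up to r^2, of the logarithmic derivative of the Blaschke
    factor. The weighted sum that can be bounded is therefore the one that has to be bounded, and
    zeros close to |c| = r need not be counted separately. *)
Definition blweight (r : R) c : R := if cabs c < r then 1 - cabs c ^+ 2 / r ^+ 2 else 0.

Lemma blweight_itv (r : R) c : 0 < r -> 0 <= blweight r c <= 1.
Proof.
move=> r0; rewrite /blweight; case: ifP => [cr|_]; last by rewrite lexx ler01.
rewrite subr_ge0 ler_pdivrMr ?exprn_gt0// mul1r lerXn2r ?nnegrE ?cabs_ge0 ?(ltW r0) ?(ltW cr)//=.
by rewrite gerBl divr_ge0 ?sqr_ge0.
Qed.

Lemma cReZ (x : R) z : Re (x%:C * z) = x * Re z.
Proof. by case: z => a b /=; rewrite mul0r subr0. Qed.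

Lemma ln_prod_seq (T : eqType) (s : seq T) (F : T -> R) : {in s, forall i, 0 < F i} ->
  ln (\prod_(i <- s) F i) = \sum_(i <- s) ln (F i).
Proof.
elim: s => [|i s IH] H; first by rewrite !big_nil ln1.
have Fi : 0 < F i by apply: H; rewrite mem_head.
have Hs : {in s, forall i, 0 < F i} by move=> j js; apply: H; rewrite inE js orbT.
rewrite !big_cons lnM ?posrE ?IH//; rewrite big_seq; exact: prodr_gt0.
Qed.

Lemma blden_log_lower (r : R) c w : 0 < r -> cabs w <= r / 8 -> 0 < cabs (w - c) ->
  0 < cabs (blden r c w) ->
  blweight r c / 3 <= ln (cabs (blden r c w)) - ln (cabs (w - c)).
Proof.
move=> r0 wr p0 k0; rewrite /blweight; have [cr|rc] := ltP (cabs c) r; last first.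
  by rewrite mul0r /blden ltNge rc /= subrr.
have r20 : 0 < r ^+ 2 by rewrite exprn_gt0.
have I := blaschke_identity r c w.
have kE : cabs (blden r c w) = cabs ((r ^+ 2)%:C - c^* * w) / r.
  by rewrite /blden cr cabs_div cabs_real_ge0 ?(ltW r0).
set D := cabs (_ - _ * _) in I kE; set p := cabs (w - c) in p0 I *.
set k := cabs (blden r c w) in k0 kE *.
have DE : D = k * r by rewrite kE divfK// gt_eqF.
have D0 : 0 < D by rewrite DE mulr_gt0.
have cw : cabs c * cabs w <= r * (r / 8) by rewrite ler_pM ?cabs_ge0// ltW.
have D1 : D <= 9 / 8 * r ^+ 2.
  apply: le_trans (cabsB _ _) _; rewrite cabs_real_ge0 ?sqr_ge0// cabsM cabsJ expr2.
  by have := mulr_gt0 r0 r0; lra.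
have W2 : cabs w ^+ 2 <= r ^+ 2 / 64.
  rewrite (_ : r ^+ 2 / 64 = (r / 8) ^+ 2); last by field.
  by rewrite lerXn2r ?nnegrE ?cabs_ge0//; lra.
have C2 : cabs c ^+ 2 <= r ^+ 2 by rewrite lerXn2r ?nnegrE ?cabs_ge0 ?(ltW r0)// ltW.
set W := 1 - _; have WE : W * r ^+ 2 = r ^+ 2 - cabs c ^+ 2.
  by rewrite /W mulrBl mul1r divfK// gt_eqF.
have W0 : 0 <= W by rewrite /W subr_ge0 ler_pdivrMr// mul1r.
pose t := W * r ^+ 2 * (r ^+ 2 - cabs w ^+ 2) / D ^+ 2.
have pE : p ^+ 2 = k ^+ 2 * (1 - t).
  apply: (mulfI (lt0r_neq0 r20)); rewrite /t WE -I DE; field.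
  by rewrite (gt_eqF r0) (gt_eqF k0).
have t1 : 0 < 1 - t by rewrite -(pmulr_rgt0 _ (exprn_gt0 2 k0)) -pE exprn_gt0.
(* With |w| <= r/8 one has D <= 9/8 r^2 and r^2 - |w|^2 >= 63/64 r^2, so t >= 7/9 W. As t = 1 -
   (p/k)^2 and ln (1 - t) <= -t, the logarithm of k/p is at least t/2, hence at least W/3. *)
have tl : 2 / 3 * W <= t.
  rewrite /t ler_pdivlMr ?exprn_gt0//.
  suff h : 2 / 3 * D ^+ 2 <= r ^+ 2 * (r ^+ 2 - cabs w ^+ 2) by have := ler_wpM2l W0 h; lra.
  have : D ^+ 2 <= (9 / 8 * r ^+ 2) ^+ 2 by rewrite lerXn2r ?nnegrE ?(ltW D0)//; lra.
  have : r ^+ 2 * (63 / 64 * r ^+ 2) <= r ^+ 2 * (r ^+ 2 - cabs w ^+ 2).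
    by rewrite ler_wpM2l ?(ltW r20)//; lra.
  have -> : (9 / 8 * r ^+ 2) ^+ 2 = 81 / 64 * (r ^+ 2 * r ^+ 2) by field.
  have -> : r ^+ 2 * (63 / 64 * r ^+ 2) = 63 / 64 * (r ^+ 2 * r ^+ 2) by field.
  have := mulr_gt0 r20 r20; move: (r ^+ 2 * r ^+ 2) (D ^+ 2) => X Y; lra.
have : ln (1 - t) <= - t by apply: le_ln1Dx; rewrite ltrNl opprK; lra.
have : ln (p ^+ 2) = ln (k ^+ 2) + ln (1 - t) by rewrite pE lnM ?posrE ?exprn_gt0.
by rewrite !lnXn// !mulr2n; lra.
Qed.

Lemma blden_log_upper (r d : R) c w : 0 < r -> cabs w <= r / 8 -> 0 < d -> d <= r ->
  d <= cabs (w - c) -> 0 < cabs (blden r c w) ->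
  ln (cabs (blden r c w)) - ln (cabs (w - c)) <= ln (2 * r / d).
Proof.
move=> r0 wr d0 dr dp k0; have p0 := lt_le_trans d0 dp.
rewrite -ln_div ?posrE// ler_ln ?posrE ?divr_gt0 ?mulr_gt0//.
rewrite ler_pdivrMr// mulrAC ler_pdivlMr//.
have [cr|rc] := ltP (cabs c) r; last first.
  by rewrite /blden ltNge rc /= mulrC ler_wpM2r ?cabs_ge0//; lra.
rewrite /blden cr cabs_div cabs_real_ge0 ?(ltW r0)// mulrAC ler_pdivrMr//.
have cw : cabs c * cabs w <= r * (r / 8) by rewrite ler_pM ?cabs_ge0// ltW.
have D1 : cabs ((r ^+ 2)%:C - c^* * w) <= 2 * r * r.
  apply: le_trans (cabsB _ _) _; rewrite cabs_real_ge0 ?sqr_ge0// cabsM cabsJ expr2.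
  by have := mulr_gt0 r0 r0; lra.
have := ler_pM (cabs_ge0 _) (ltW d0) D1 dp; lra.
Qed.

(** On |z| = r the factor is the Poisson kernel (r^2 - |w|^2) / |z - w|^2, in the form that results
    from taking real parts in the Schwarz formula and subtracting the mean value. *)
Lemma poisson_formula (beta r : R) F w : 0 < r -> r < beta -> cabs w < r -> hol beta F ->
  Re (F w) = ravg r (fun z => Re (F z) * (1 + 2 * Re (w / (z - w)))).
Proof.
move=> r0 rb wr H; rewrite (schwarz_formula r0 rb wr H) cReB -(@mean_value_hol _ beta r F) ?rb ?(ltW r0)//.
have -> : Re (cavg r F)^* = ravg r (fun z => Re (F z)) by rewrite -Re_cavg; case: (cavg r F).
rewrite /ctrans Re_cavg.
have cF := hol_conc rb H.
have cU := conc_Re (ltW r0) cF.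
have cK : rconc r (fun z => Re (w / (z - w))).
  apply: (conc_Re (ltW r0)) => z zr; apply: ccontM; first exact: ccont_cst.
  by apply: ccontV; [exact: circle_sub_neq0 zr wr|exact: ccont_sub].
have cUK : rconc r (fun z => 2 * (Re (F z) * (1 + Re (w / (z - w))))).
  by apply: rconZ; apply: rconM => //; apply: rconD; [exact: rcon_cst|exact: cK].
rewrite (@ravg_eq _ _ _ (fun z => 2 * (Re (F z) * (1 + Re (w / (z - w))))) (ltW r0)); last first.
  move=> z zr; have n := circle_sub_neq0 zr wr.
  rewrite expr1 (_ : z / (z - w) = 1 + w / (z - w)); last by field.
  by rewrite cReZ cReD /= mulrA.
rewrite -ravgB//; apply: ravg_eq => [|z _]; first exact: ltW.
by ring.
Qed.

Lemma poisson_kernel_itv (r : R) z w : 0 < r -> cabs z = r -> cabs w <= r / 8 ->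
  1 / 3 <= 1 + 2 * Re (w / (z - w)) <= 3.
Proof.
move=> r0 zr wr; have wr' : cabs w < r by lra.
have h : 7 / 8 * r <= cabs (z - w) by have := cabs_triB z w; rewrite zr; lra.
have : `|Re (w / (z - w))| <= 1 / 7.
  apply: le_trans (Re_cabs _) _; rewrite cabs_div ler_pdivrMr; lra.
by rewrite ler_norml; lra.
Qed.

(* h is a logarithm of f divided by the Blaschke factors of its zeros A and poles
   B, so that Re h = ln |f| on the circle. The hypothesis on A ++ B keeps the
   zeros of the denominators [blden r c] out of the disc of radius beta > r. *)
Lemma poisson_jensen (f G : R[i] -> R[i]) (A B : seq R[i]) (beta r d : R) z1 :
  0 < r -> r < beta -> hol beta G -> (forall z, cabs z < beta -> G z != 0) ->
  {in A ++ B, forall c, (cabs c < r -> cabs c * beta <= r ^+ 2) /\ (r <= cabs c -> beta <= cabs c)} ->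
  (forall z, cabs z < beta -> z \notin B ->
     f z * \prod_(b <- B) (z - b) = \prod_(a <- A) (z - a) * G z) ->
  cabs z1 <= r / 8 -> f z1 != 0 -> 0 < d -> d <= r ->
  {in B, forall b, d <= cabs (z1 - b)} ->
  exists h kappa, [/\ hol beta h, cabs kappa = 1,
    (forall z, cabs z < beta -> G z * \prod_(a <- A) blden r a z =
       kappa * cexp (h z) * \prod_(b <- B) blden r b z),
    (forall z, cabs z = r -> logplus (cabs (f z)) = Num.max 0 (Re (h z))) &
    let Lam := ravg r (fun z => Num.max 0 (Re (h z))) + `|ln (cabs (f z1))|
                 + (size B)%:R * ln (2 * r / d) in
    \sum_(a <- A) blweight r a <= 9 * Lam /\ ravg r (fun z => `|Re (h z)|) <= 10 * Lam].
Proof.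
move=> r0 rb HG G0 Hc fE z1r fz1 d0 dr Bd.
have z1b : cabs z1 < beta by lra.
have beta0 : 0 < beta := lt_trans r0 rb.
have K0 c z : c \in A ++ B -> cabs z < beta -> blden r c z != 0.
  by move=> /Hc[h1 h2] zb; exact: (@blden_neq0 _ r beta).
have KA0 z : cabs z < beta -> \prod_(a <- A) blden r a z != 0.
  move=> zb; rewrite prodf_seq_neq0; apply/allP => a aA; rewrite K0//.
  by rewrite mem_cat aA.
have KB0 z : cabs z < beta -> \prod_(b <- B) blden r b z != 0.
  move=> zb; rewrite prodf_seq_neq0; apply/allP => b bB; rewrite K0//.
  by rewrite mem_cat bB orbT.
pose g z := G z * \prod_(a <- A) blden r a z * (\prod_(b <- B) blden r b z)^-1.
have g0 z : cabs z < beta -> g z != 0.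
  by move=> zb; rewrite /g !mulf_neq0 ?invr_neq0 ?KA0 ?KB0 ?G0.
have Hg : hol beta g.
  move=> z zb; apply: cdiffM; first apply: cdiffM; first exact: HG.
    by apply: cdiff_prod => a; exact: cdiff_blden.
  by apply: cdiffV; [exact: KB0|apply: cdiff_prod => a; exact: cdiff_blden].
have [H HH gE] := hol_log Hg g0.
have g00 : g 0 != 0 by apply: g0; rewrite cabs0.
have ag0 : 0 < cabs (g 0) by rewrite cabs_gt0.
(* The modulus of g 0 is moved into the exponent and only its phase is kept as [kappa], so that Re h
   = ln |g| exactly. *)
pose h z := H z + (ln (cabs (g 0)))%:C.
pose kappa := g 0 / (cabs (g 0))%:C.
have cR : cexp (ln (cabs (g 0)))%:C = (cabs (g 0))%:C.
  by rewrite /cexp /circle_pt /= cos0 sin0 mulr0 mulr1 lnK ?posrE.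
have gh z : cabs z < beta -> g z = kappa * cexp (h z).
  move=> zb; rewrite gE// /h cexpD cR /kappa; field.
  by rewrite -cabs_gt0 cabs_real_ge0 ?(ltW ag0).
have k1 : cabs kappa = 1 by rewrite cabs_div cabs_real_ge0 ?(ltW ag0)// divff// gt_eqF.
have Hh : hol beta h by move=> z zb; apply: cdiffD; [exact: HH|exact: cdiff_cst].
have lng z : cabs z < beta -> ln (cabs (g z)) = Re (h z).
  by move=> zb; rewrite gh// cabsM k1 mul1r cabs_cexp expRK.
have circ_g z : cabs z = r -> cabs (f z) = cabs (g z).
  move=> zr; have zb : cabs z < beta by rewrite zr.
  have nc c : c \in A ++ B -> cabs c != r.
    by move=> /Hc[_ h2]; apply/eqP => cr; have := h2; rewrite cr lexx => /(_ isT); lra.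
  have zB : z \notin B.
    by apply/negP => zB; have := nc z; rewrite mem_cat zB orbT zr eqxx => /(_ isT).
  have := congr1 (@cabs R) (fE _ zb zB); rewrite !cabsM !cabs_prod_seq => E.
  have PB : \prod_(b <- B) cabs (z - b) = \prod_(b <- B) cabs (blden r b z).
    by apply: eq_bigr => b _; rewrite blden_circle.
  have PA : \prod_(a <- A) cabs (z - a) = \prod_(a <- A) cabs (blden r a z).
    by apply: eq_bigr => a _; rewrite blden_circle.
  rewrite PA PB in E; rewrite /g cabsV cabs_prod_seq.
  apply: (@mulIf _ (\prod_(b <- B) cabs (blden r b z))).
    by rewrite -cabs_prod_seq cabs_eq0 KB0.
  rewrite E divfK; first by rewrite mulrC.
  by rewrite -cabs_prod_seq cabs_eq0 KB0.
exists h, kappa; split=> //.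
- by move=> z zb; rewrite -gh// /g divfK// KB0.
- by move=> z zr; rewrite /logplus circ_g// lng// zr.
set m := ravg r _; set L := ln (2 * r / d); set n := (size B)%:R.
have L0 : 0 <= L.
  by apply: ln_ge0; rewrite ler_pdivlMr// mul1r; lra.
have cU := conc_Re (ltW r0) (hol_conc rb Hh).
have z1B : z1 \notin B.
  by apply/negP => /Bd; rewrite subrr cabs0; lra.
have E1 := fE _ z1b z1B.
have PB0 : \prod_(b <- B) (z1 - b) != 0.
  rewrite prodf_seq_neq0; apply/allP => b bB /=; rewrite -cabs_gt0.
  exact: lt_le_trans d0 (Bd _ bB).
have PA0 : \prod_(a <- A) (z1 - a) != 0.
  apply/eqP => E; move: E1; rewrite E mul0r => /eqP.
  by rewrite mulf_eq0 (negbTE fz1) (negbTE PB0).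
have pA a : a \in A -> 0 < cabs (z1 - a).
  by move=> aA; move: PA0; rewrite prodf_seq_neq0 => /allP /(_ _ aA) /=; rewrite cabs_gt0.
have kA a : a \in A -> 0 < cabs (blden r a z1).
  by move=> aA; rewrite cabs_gt0 K0// mem_cat aA.
have kB b : b \in B -> 0 < cabs (blden r b z1).
  by move=> bB; rewrite cabs_gt0 K0// mem_cat bB orbT.
have pB b : b \in B -> 0 < cabs (z1 - b) by move=> /Bd; exact: lt_le_trans.
pose lA := \sum_(a <- A) (ln (cabs (blden r a z1)) - ln (cabs (z1 - a))).
pose lB := \sum_(b <- B) (ln (cabs (blden r b z1)) - ln (cabs (z1 - b))).
(* This identity is used in both directions. Since lA >= 0 and lB is bounded by the number of poles,
   it bounds Re h(z1) from below, hence the mean of |Re h| by [lo]. The upper bound [up] for Re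
   h(z1) bounds lA, hence the weights of the zeros. *)
have U1 : Re (h z1) = ln (cabs (f z1)) + lA - lB.
  have : cabs (g z1) * (\prod_(b <- B) cabs (blden r b z1) * \prod_(a <- A) cabs (z1 - a))
       = cabs (f z1) * (\prod_(b <- B) cabs (z1 - b) * \prod_(a <- A) cabs (blden r a z1)).
    rewrite -!cabs_prod_seq -!cabsM; congr cabs; rewrite [RHS]mulrA E1 /g.
    have := KB0 _ z1b; set X := \prod_(b <- B) _ => X0; field; exact: X0.
  have pr (T : eqType) (s : seq T) (F : T -> R) : {in s, forall i, 0 < F i} -> 0 < \prod_(i <- s) F i.
    by move=> H0; rewrite big_seq; exact: prodr_gt0.
  have fz1' : 0 < cabs (f z1) by rewrite cabs_gt0.
  have gz1' : 0 < cabs (g z1) by rewrite cabs_gt0 g0.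
  move=> /(congr1 (@ln R)); rewrite !lnM ?posrE ?mulr_gt0 ?pr// !ln_prod_seq//.
  by rewrite lng// /lA /lB !big_split /= !sumrN; lra.
have lAw : \sum_(a <- A) blweight r a <= 3 * lA.
  rewrite mulrC -ler_pdivrMr// mulr_suml /lA big_seq [leRHS]big_seq; apply: ler_sum => a aA.
  by apply: blden_log_lower => //; [exact: pA|exact: kA].
have lA0 : 0 <= lA.
  have : 0 <= \sum_(a <- A) blweight r a.
    by apply: sumr_ge0 => a _; case/andP: (blweight_itv a r0).
  lra.
have lBn : lB <= n * L.
  rewrite /lB /n -sum1_size natr_sum mulr_suml big_seq [leRHS]big_seq; apply: ler_sum => b bB.
  by rewrite mul1r; apply: (@blden_log_upper r d) => //; [exact: Bd|exact: kB].
have z1r' : cabs z1 < r by lra.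
have P1 := poisson_formula r0 rb z1r' Hh.
pose P z := 1 + 2 * Re (z1 / (z - z1)).
have cP : rconc r P.
  apply: rconD; first exact: rcon_cst.
  apply: rconZ; apply: (@conc_Re _ _ (fun z => z1 / (z - z1)) (ltW r0)) => z zr.
  apply: ccontM; first exact: ccont_cst.
  by apply: ccontV; [exact: circle_sub_neq0 zr z1r'|exact: ccont_sub].
have cUP : rconc r (fun z => Re (h z) * P z) by apply: rconM.
have cabsU : rconc r (fun z => `|Re (h z)|) by apply: rcon_norm.
have cp : rconc r (fun z => Num.max 0 (Re (h z))).
  have -> : (fun z => Num.max 0 (Re (h z))) = (fun z => 2^-1 * (`|Re (h z)| + Re (h z))).
    apply/funext => z; case: (leP 0 (Re (h z))) => hz.
      by rewrite ger0_norm//; field.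
    by rewrite ltr0_norm// addNr mulr0.
  by apply: rconZ; apply: rconD.
have up : Re (h z1) <= 3 * m.
  rewrite P1 -ravgZ//; apply: ravg_le => //; [exact: ltW|exact: rconZ|].
  move=> z zr; have /andP[h1 h2] := poisson_kernel_itv r0 zr z1r.
  by case: (leP 0 (Re (h z))) => hz; nra.
(* Pointwise |u| <= 10 max(0, u) - 3 u P for u = Re h: if u >= 0 use P <= 3, if u < 0 use P >= 1/3.
   The average of u P is Re h(z1). *)
have lo : ravg r (fun z => `|Re (h z)|) <= 10 * m - 3 * Re (h z1).
  rewrite P1 -!ravgZ// -ravgB; [|exact: rconZ|exact: rconZ].
  apply: ravg_le => //; [exact: ltW| |].
    have c1 : rconc r (fun z => 10 * Num.max 0 (Re (h z))) by exact: rconZ.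
    have c2 : rconc r (fun z => - 1 * (3 * (Re (h z) * P z))) by apply: rconZ; exact: rconZ.
    have := rconD c1 c2; congr rcon; apply/funext => t; rewrite mulN1r//.
  move=> z zr; have /andP[h1 h2] := poisson_kernel_itv r0 zr z1r.
  case: (leP 0 (Re (h z))) => hz.
    by rewrite ger0_norm// /P; nra.
  by rewrite ltr0_norm// mulr0 /P; nra.
have la := ler_norm (ln (cabs (f z1))); have la' := ler_norm (- ln (cabs (f z1))).
rewrite normrN in la'.
have m0 : 0 <= m by apply: ravg_ge0 => [|z _]; [exact: ltW|rewrite le_max lexx].
have nL0 : 0 <= n * L by rewrite mulr_ge0.
by cbv zeta; lra.
Qed.

End PoissonJensen.

(** * Difference quotients *)

Section DifferenceQuotient.
Variable R : realType.
Implicit Types (F G h : R[i] -> R[i]) (z eta c a b : R[i]) (y tau r : R).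

(* First order expansion of F (z + eta) / F z, with an error that is quadratic
   in the bound y for the logarithmic derivative; the linear slack tau absorbs
   the contributions of relative size eta / r. *)
Definition dq tau z eta F y := exists l, [/\ cder F z l, F z != 0,
  cabs (eta * (l / F z)) <= y &
  cabs (F (z + eta) / F z - 1 - eta * (l / F z)) <= y ^+ 2 + tau * y].

Lemma dq_eq tau z eta F G y (d : R) : 0 < d -> (forall w, cabs (w - z) < d -> F w = G w) ->
  F (z + eta) = G (z + eta) -> dq tau z eta F y -> dq tau z eta G y.
Proof.
move=> d0 E Ee [l [H Fz h1 h2]]; have Ez : F z = G z by apply: E; rewrite subrr cabs0.
by exists l; rewrite -Ez -Ee; split=> //; exact: cder_eq E H.
Qed.

Lemma dq_le tau z eta F y y' : 0 <= tau -> 0 <= y -> y <= y' -> dq tau z eta F y -> dq tau z eta F y'.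
Proof.
move=> t0 y0 yy [l [H Fz h1 h2]]; exists l; split=> //; first exact: le_trans yy.
by apply: le_trans h2 _; rewrite lerD ?ler_wpM2l// lerXn2r ?nnegrE//; exact: le_trans yy.
Qed.

Lemma dq_cst tau z eta c : c != 0 -> dq tau z eta (fun=> c) 0.
Proof.
move=> c0; exists 0; split=> //; first exact: cder_cst.
  by rewrite mul0r mulr0 cabs0.
by rewrite mul0r mulr0 divff// subrr subr0 cabs0 mulr0 addr0 expr0n.
Qed.

(** The form y^2 + tau y is stable because (y1 + y2)^2 exceeds y1^2 + y2^2 by 2 y1 y2: one y1 y2
    pays for the product of the linear terms, the other for all products involving an error, whose
    total coefficient is at most 1 thanks to the bounds 1/8. *)
Lemma dq_mul tau z eta F G y1 y2 : 0 <= tau <= 1 / 8 -> 0 <= y1 <= 1 / 8 -> 0 <= y2 <= 1 / 8 ->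
  dq tau z eta F y1 -> dq tau z eta G y2 -> dq tau z eta (fun w => F w * G w) (y1 + y2).
Proof.
move=> /andP[t0 t1] /andP[a0 a1] /andP[b0 b1] [l [HF Fz f1 f2]] [m [HG Gz g1 g2]].
exists (l * G z + F z * m); split; [exact: cderM|by rewrite mulf_neq0| |].
  rewrite (_ : eta * _ = eta * (l / F z) + eta * (m / G z)); last by field; rewrite Fz Gz.
  by apply: le_trans (cabsD _ _) _; exact: lerD.
set x1 := eta * (l / F z) in f1 f2; set x2 := eta * (m / G z) in g1 g2.
set e1 := _ - 1 - x1 in f2; set e2 := _ - 1 - x2 in g2.
rewrite (_ : _ - _ = x1 * x2 + e1 * (1 + x2 + e2) + e2 * (1 + x1)); last first.
  by rewrite /e1 /e2 /x1 /x2; field; rewrite Fz Gz.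
have h1 : cabs (1 + x2 + e2) <= 1 + y2 + (y2 ^+ 2 + tau * y2).
  apply: le_trans (cabsD _ _) _; apply: lerD => //.
  by apply: le_trans (cabsD _ _) _; rewrite cabs1 lerD.
have h2 : cabs (1 + x1) <= 1 + y1.
  by apply: le_trans (cabsD _ _) _; rewrite cabs1 lerD.
apply: le_trans (cabsD _ _) _; apply: le_trans (lerD (cabsD _ _) (lexx _)) _.
rewrite (cabsM x1 x2) (cabsM e1) (cabsM e2).
have k1 : cabs x1 * cabs x2 <= y1 * y2 by rewrite ler_pM ?cabs_ge0.
have k2 := ler_pM (cabs_ge0 _) (cabs_ge0 _) f2 h1.
have k3 := ler_pM (cabs_ge0 _) (cabs_ge0 _) g2 h2.
have p0 : 0 <= y1 * y2 by rewrite mulr_ge0.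
have k4 : y1 * y2 * ((y1 + tau) * (1 + y2 + tau) + (y2 + tau)) <= y1 * y2 * 1.
  by apply: ler_wpM2l => //; nra.
apply: le_trans (lerD (lerD k1 k2) k3) _; lra.
Qed.

Lemma dq_prod (T : eqType) (s : seq T) tau z eta (F : T -> R[i] -> R[i]) (y : T -> R) :
  0 <= tau <= 1 / 8 -> {in s, forall i, 0 <= y i} -> \sum_(i <- s) y i <= 1 / 8 ->
  {in s, forall i, dq tau z eta (F i) (y i)} ->
  dq tau z eta (fun w => \prod_(i <- s) F i w) (\sum_(i <- s) y i).
Proof.
move=> t01; elim: s => [|i s IH] y0 ys H.
  rewrite big_nil; apply: (dq_eq ltr01 _ _ (dq_cst tau z eta (oner_neq0 _))) => [w _|];
  by rewrite big_nil.
have yi : 0 <= y i by apply: y0; rewrite mem_head.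
have y0' : {in s, forall i, 0 <= y i} by move=> j js; apply: y0; rewrite inE js orbT.
have S0 : 0 <= \sum_(j <- s) y j by rewrite big_seq; apply: sumr_ge0.
rewrite big_cons in ys *.
have Hs : {in s, forall i, dq tau z eta (F i) (y i)} by move=> j js; apply: H; rewrite inE js orbT.
have ysr : \sum_(j <- s) y j <= 1 / 8 by lra.
have yi8 : 0 <= y i <= 1 / 8 by rewrite yi /=; lra.
have ys8 : 0 <= \sum_(j <- s) y j <= 1 / 8 by rewrite S0.
apply: (dq_eq ltr01 _ _ (dq_mul t01 yi8 ys8 (H i (mem_head _ _)) (IH y0' ysr Hs))) => [w _|];
by rewrite big_cons.
Qed.

(** * Expansions of the exponential and of the Blaschke factors *)

Section Factors.
Variables (r : R) (z eta : R[i]).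
Hypotheses (r0 : 0 < r) (zr : cabs z <= r / 4) (zer : cabs (z + eta) <= r / 4)
  (er : cabs eta <= r / 16).
Let tau := 2 * cabs eta / r.

Let tau0 : 0 <= tau. Proof. by rewrite divr_ge0 ?mulr_ge0 ?cabs_ge0 ?(ltW r0). Qed.
Let tau1 : tau <= 1 / 8.
Proof. by rewrite /tau ler_pdivrMr//; move: er r0; lra. Qed.
Let r20 : 0 < r ^+ 2. Proof. by rewrite exprn_gt0. Qed.

(** Put t = M |eta| / r. The Schwarz formula bounds eta h' by 8 t and the second order remainder of
    h by 5 t tau, so the increment s of h is at most 9 t. The remainder of the exponential is then
    at most 8 (9 t)^2, which (60 t)^2 dominates, and 5 t tau is absorbed in the linear slack. *)
Lemma dq_cexp_hol (beta M : R) h kappa : r < beta -> hol beta h -> kappa != 0 ->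
  ravg r (fun w => `|Re (h w)|) <= M -> 60 * M * cabs eta / r <= 1 / 8 ->
  dq tau z eta (fun w => kappa * cexp (h w)) (60 * M * cabs eta / r).
Proof.
move=> rb Hh k0 hM y1; pose psi w : R[i] := (2 * Re (h w))%:C.
have ch := hol_conc rb Hh.
have M0 : 0 <= M by apply: le_trans hM; apply: ravg_ge0 => //; exact: ltW.
have cpsi : conc r psi.
  move=> w wr; rewrite /psi; apply: clim_ReIm; last exact: cvg_cst.
  by apply: cvgM; [exact: cvg_cst|apply: clim_Re; exact: ch].
pose g w := 2 * `|Re (h w)|.
have cabsU : rconc r (fun w => `|Re (h w)|) by apply: rcon_norm; exact: (conc_Re (ltW r0) ch).
have cg : rconc r g by exact: rconcZ.
have bg w : cabs w = r -> cabs (psi w) <= g w by move=> _; rewrite /psi cabsR normrM ger0_norm.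
have gM : ravg r g <= 2 * M by rewrite ravgZ// ler_wpM2l.
have sr : r / 4 < r by move: r0; lra.
have S w : cabs w < r -> h w = ctrans 0 psi r w - (h 0)^* by move=> wr; exact: (@schwarz_formula _ beta).
have zr' := le_lt_trans zr sr; have zer' := le_lt_trans zer sr.
pose l := ctrans 1 psi r z.
have dh : cder h z l.
  apply: (@cder_eq _ (fun w => ctrans 0 psi r w - (h 0)^* ) _ _ _ (r - cabs z)); first by rewrite subr_gt0.
    move=> w wz; rewrite -S//; have := cabsD (w - z) z; rewrite subrK; lra.
  by have := cderB (ctrans_cder r0 cpsi zr') (cder_cst (h 0)^* z); rewrite subr0.
pose t := M * cabs eta / r.
have t0 : 0 <= t by rewrite divr_ge0 ?mulr_ge0 ?cabs_ge0 ?(ltW r0).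
have yE : 60 * M * cabs eta / r = 60 * t by rewrite /t; ring.
rewrite yE in y1 *.
have l1 : cabs (eta * l) <= 8 * t.
  rewrite cabsM; have := ctrans_bound r0 sr cpsi cg bg 1 zr; rewrite -/l => hl.
  have : cabs l <= 8 * (M / r).
    apply: le_trans hl _; rewrite (_ : r / (r - r / 4) ^+ 2 = 16 / 9 / r); last by field; move: r0; lra.
    have : ravg r g / r <= 2 * M / r by rewrite ler_wpM2r ?invr_ge0 ?(ltW r0).
    have : 0 <= M / r by rewrite divr_ge0 ?(ltW r0).
    lra.
  move=> h1; have := ler_wpM2l (cabs_ge0 eta) h1; rewrite /t; lra.
have q1 : cabs (h (z + eta) - h z - eta * l) <= 10 * t * (cabs eta / r).
  have := ctrans_quad0 r0 sr cpsi cg bg zr zer.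
  rewrite (S (z + eta))// (S z)// [eta * l]mulrC.
  rewrite (_ : _ - _ - _ = ctrans 0 psi r (z + eta) - (h 0)^* - (ctrans 0 psi r z - (h 0)^* ) - l * eta); last by rewrite /l; ring.
  move=> /le_trans; apply.
  rewrite (_ : r / (r - r / 4) ^+ 3 = 64 / 27 / r ^+ 2); last by field; move: r0; lra.
  rewrite (_ : 10 * t * _ = 10 * M * (cabs eta ^+ 2 / r ^+ 2)); last by rewrite /t; field; rewrite gt_eqF.
  have : ravg r g * (cabs eta ^+ 2 / r ^+ 2) <= 2 * M * (cabs eta ^+ 2 / r ^+ 2).
    by rewrite ler_wpM2r// divr_ge0 ?sqr_ge0.
  have : 0 <= M * (cabs eta ^+ 2 / r ^+ 2) by rewrite mulr_ge0// divr_ge0 ?sqr_ge0.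
  lra.
have tE : cabs eta / r = tau / 2 by rewrite /tau; field; rewrite gt_eqF.
rewrite tE in q1.
set s := h (z + eta) - h z in q1.
have s1 : cabs s <= 9 * t.
  have := cabsD (s - eta * l) (eta * l); rewrite subrK.
  have := ler_wpM2l t0 tau1; lra.
have F0 : kappa * cexp (h z) != 0 by rewrite mulf_neq0 ?cexp_neq0.
exists (kappa * (cexp (h z) * l)); split=> //.
- by apply: cderZ; exact: (cder_comp dh (cder_cexp _)).
- rewrite (_ : _ * (_ / _) = eta * l); last by field; rewrite k0 cexp_neq0.
  by move: l1 t0; lra.
- rewrite (_ : _ - _ - _ = (cexp s - 1 - s) + (s - eta * l)); last first.
    rewrite /s cexpD cexpN; field; rewrite k0 cexp_neq0//.
  apply: le_trans (cabsD _ _) _; apply: lerD; last first.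
    by apply: le_trans q1 _; have := mulr_ge0 t0 tau0; lra.
  apply: le_trans (cexp_quad _) _; first by move: s1 y1; lra.
  have : cabs s ^+ 2 <= (9 * t) ^+ 2 by rewrite lerXn2r ?nnegrE ?cabs_ge0//; lra.
  by have := sqr_ge0 t; nra.
Qed.

Let blfac c w := (w - c) / blden r c w.

Let D_lower c w : cabs c < r -> cabs w <= r / 4 -> 3 / 4 * r ^+ 2 <= cabs ((r ^+ 2)%:C - c^* * w).
Proof.
move=> cr wr; have cw : cabs c * cabs w <= r * (r / 4) by rewrite ler_pM ?cabs_ge0// ltW.
have cw' : cabs c * cabs w <= r ^+ 2 by apply: le_trans cw _; rewrite expr2; have := mulr_gt0 r0 r0; lra.
by apply: le_trans (blden_lower cw'); move: cw; rewrite expr2; lra.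
Qed.

(** This is exact algebra: with N = r^2 - |c|^2 and D = r^2 - conj(c) z, the logarithmic derivative
    is N / ((z - c) D), and the relative increment x' is eta N / ((z - c) D') with D' taken at z +
    eta. They differ only through D and D', by a relative error at most tau, so there is no
    quadratic term, however close z is to c. *)
Lemma blfac_expansion c : cabs c < r -> z != c -> exists l x',
  [/\ cder (blfac c) z l, blfac c z != 0,
      cabs (eta * (l / blfac c z)) <= 2 * cabs eta * blweight r c / cabs (z - c),
      cabs (x' - eta * (l / blfac c z)) <= tau * cabs (eta * (l / blfac c z)) &
      blfac c (z + eta) / blfac c z = 1 + x'].
Proof.
move=> cr zc; have zc0 : z - c != 0 by rewrite subr_eq0.
have d0 : 0 < cabs (z - c) by rewrite cabs_gt0.
pose D := (r ^+ 2)%:C - c^* * z; pose D' := (r ^+ 2)%:C - c^* * (z + eta).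
have Dl : 3 / 4 * r ^+ 2 <= cabs D by exact: D_lower.
have Dl' : 3 / 4 * r ^+ 2 <= cabs D' by exact: D_lower.
have q0 : 0 < 3 / 4 * r ^+ 2 by rewrite mulr_gt0//; lra.
have Dp := lt_le_trans q0 Dl; have Dp' := lt_le_trans q0 Dl'.
have Dn : D != 0 by rewrite -cabs_gt0. have Dn' : D' != 0 by rewrite -cabs_gt0.
have rc : r%:C != 0 :> R[i] by rewrite -cabs_gt0 cabs_real_ge0 ?(ltW r0).
pose N := (r ^+ 2)%:C - c^* * c.
have NE : cabs N = r ^+ 2 * blweight r c.
  rewrite /N mulrC mul_conjc -rmorphB cabs_real_ge0.
    by rewrite /blweight cr mulrBr mulr1 mulrCA divff ?mulr1// gt_eqF.
  by rewrite subr_ge0 lerXn2r ?nnegrE ?cabs_ge0 ?(ltW r0)// ltW.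
have bE w : blfac c w = r%:C * ((w - c) * ((r ^+ 2)%:C - c^* * w)^-1).
  by rewrite /blfac /blden cr invfM invrK; ring.
have dD : cder (fun w => (r ^+ 2)%:C - c^* * w) z (0 - c^* * 1).
  by apply: cderB; [exact: cder_cst|apply: cderZ; exact: cder_id].
have d1 := cderB (cder_id z) (cder_cst c z).
have := cderZ r%:C (cderM d1 (@cderV _ (fun w => (r ^+ 2)%:C - c^* * w) _ _ Dn dD)).
set l := r%:C * _ => dl.
have bz : blfac c z = r%:C * ((z - c) / D) by rewrite bE.
have lE : l / blfac c z = N / ((z - c) * D).
  rewrite bz /l /N /D; move: rc zc0 Dn; rewrite /D.
  move: (r%:C) ((r ^+ 2)%:C) (c^* ) => k rho cb rc zc0 Dn.
  by field; rewrite Dn zc0 rc.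
have x0 : cabs (eta * (l / blfac c z)) <= 2 * cabs eta * blweight r c / cabs (z - c).
  rewrite lE cabsM cabs_div cabsM NE.
  have /andP[w0 w1] := blweight_itv c r0.
  rewrite [leLHS](_ : _ = cabs eta * (blweight r c / cabs (z - c)) * (r ^+ 2 / cabs D)); last first.
    by rewrite invfM; ring.
  rewrite [leRHS](_ : _ = cabs eta * (blweight r c / cabs (z - c)) * 2); last by ring.
  apply: ler_wpM2l; first by rewrite mulr_ge0 ?divr_ge0 ?cabs_ge0.
  by rewrite ler_pdivrMr//; lra.
exists l, (eta * (N / ((z - c) * D'))); split=> //.
- by apply: cder_eq (ltr01) _ dl => w _; rewrite bE.
- by rewrite bz !mulf_neq0 ?invr_neq0.
- rewrite lE (_ : _ - _ = (eta * (N / ((z - c) * D))) * (c^* * eta / D')); last first.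
    rewrite /N; move: zc0 Dn Dn'; rewrite /D /D'.
    move: ((r ^+ 2)%:C) (c^* ) => rho cb zc0 Dn Dn'.
    by field; rewrite Dn' Dn zc0.
  rewrite cabsM [leRHS]mulrC ler_wpM2l ?cabs_ge0// cabs_div cabsM cabsJ ler_pdivrMr//.
  have h1 : cabs c * cabs eta <= r * cabs eta by rewrite ler_wpM2r ?cabs_ge0// ltW.
  apply: le_trans h1 _; have := ler_wpM2l tau0 Dl'; move/(le_trans _); apply.
  rewrite (_ : tau * _ = 3 / 2 * (r * cabs eta)); last by rewrite /tau; field; rewrite gt_eqF.
  by have := mulr_ge0 (ltW r0) (cabs_ge0 eta); lra.
- rewrite !bE /N; move: rc zc0 Dn Dn'; rewrite /D /D'.
  move: (r%:C) ((r ^+ 2)%:C) (c^* ) => k rho cb rc zc0 Dn Dn'.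
  by field; rewrite Dn' Dn zc0 rc.
Qed.

Let dq_out (beta : R) c F : r < beta -> beta <= cabs c ->
  (forall w, cabs w < beta -> F w = 1) -> dq tau z eta F 0.
Proof.
move=> rb bc E; have zb : cabs z < beta by move: zr rb r0; lra.
apply: (@dq_eq _ _ _ (fun=> 1) _ _ (beta - cabs z)) (dq_cst _ _ _ (oner_neq0 _)).
- by rewrite subr_gt0.
- by move=> w wz; rewrite E//; have := cabsD (w - z) z; rewrite subrK; lra.
- by rewrite E//; move: zer rb r0; lra.
Qed.

Let blfac_out (beta : R) c w : r < beta -> (r <= cabs c -> beta <= cabs c) -> r <= cabs c ->
  cabs w < beta -> blfac c w = 1.
Proof.
move=> rb h rc wb; rewrite /blfac /blden ltNge rc /= divff// subr_eq0.
by apply/eqP => E; have := h rc; rewrite -E leNgt wb.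
Qed.

Lemma dq_blfac (beta : R) c : r < beta -> (r <= cabs c -> beta <= cabs c) -> z != c ->
  dq tau z eta (blfac c) (2 * cabs eta * blweight r c / cabs (z - c)).
Proof.
move=> rb h zc; have [cr|rc] := ltP (cabs c) r; last first.
  apply: (@dq_le _ _ _ _ 0) => //; last exact: (dq_out rb (h rc) (fun w => @blfac_out beta c w rb h rc)).
  by case/andP: (blweight_itv c r0) => w0 _; rewrite divr_ge0 ?mulr_ge0 ?cabs_ge0.
have [l [x' [dl b0 x1 x2 E]]] := blfac_expansion cr zc.
exists l; split=> //; rewrite E [1 + x']addrC addrK; apply: le_trans x2 _.
apply: le_trans (ler_wpM2l tau0 x1) _; rewrite lerDr sqr_ge0//.
Qed.

(** For the inverse, 1/(1 + x') - 1 + x = (x - x') + x'^2 / (1 + x'), and the last term is a genuine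
    quadratic error that requires x' to be small. The constant 6 makes |x| <= y/3, hence |x'| <=
    2y/3 and the quadratic term at most 8/9 y^2. *)
Lemma dq_blfacV (beta : R) c : r < beta -> (r <= cabs c -> beta <= cabs c) -> z != c ->
  6 * cabs eta / cabs (z - c) <= 1 / 8 ->
  blfac c (z + eta) != 0 /\ dq tau z eta (fun w => (blfac c w)^-1) (6 * cabs eta / cabs (z - c)).
Proof.
move=> rb h zc y1; have y0 : 0 <= 6 * cabs eta / cabs (z - c) by rewrite divr_ge0 ?mulr_ge0 ?cabs_ge0.
have zeb : cabs (z + eta) < beta by move: zer rb r0; lra.
have [cr|rc] := ltP (cabs c) r; last first.
  split; first by rewrite (blfac_out rb h rc)// oner_neq0.
  apply: (@dq_le _ _ _ _ 0) => //; apply: (dq_out rb (h rc)) => w wb.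
  by rewrite (blfac_out rb h rc)// invr1.
have [l [x' [dl b0 x1 x2 E]]] := blfac_expansion cr zc.
set x := eta * _ in x1 x2; set y := 6 * _ / _ in y0 y1 *.
have x1' : cabs x <= y / 3.
  apply: le_trans x1 _; have /andP[w0 w1] := blweight_itv c r0.
  rewrite (_ : y / 3 = 2 * cabs eta / cabs (z - c)); last by rewrite /y; field; rewrite cabs_eq0 subr_eq0.
  by rewrite ler_wpM2r ?invr_ge0 ?cabs_ge0// ler_piMr// mulr_ge0 ?cabs_ge0.
have x2' : cabs x' <= 2 * cabs x.
  have := cabsD (x' - x) x; rewrite subrK.
  by have := cabs_ge0 x; have := ler_wpM2r (cabs_ge0 x) tau1; lra.
have p : 1 / 2 <= cabs (1 + x').
  by have := cabs_triD 1 x'; rewrite cabs1; lra.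
have pn : 1 + x' != 0 by rewrite -cabs_gt0; lra.
have bn : blfac c (z + eta) != 0.
  by move: E; apply: contra_eq_neq => ->; rewrite mul0r eq_sym.
split=> //; exists (- l / blfac c z ^+ 2); split.
- exact: cderV.
- by rewrite invr_neq0.
- rewrite (_ : eta * _ = - x); last by rewrite /x; field.
  
  by rewrite cabsN; lra.
- have -> : (blfac c (z + eta))^-1 / (blfac c z)^-1 = (1 + x')^-1 by rewrite -E [RHS]invfM.
  rewrite (_ : _ - _ = (x - x') + x' ^+ 2 / (1 + x')); last first.
    by rewrite /x; field; rewrite pn.
  apply: le_trans (cabsD _ _) _; rewrite addrC lerD//; last first.
    by rewrite cabsBC; apply: le_trans x2 _; rewrite ler_wpM2l//; lra.
  rewrite cabs_div cabsX ler_pdivrMr; last by lra.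
  have xy : cabs x' <= 2 * (y / 3) by lra.
  have : cabs x' ^+ 2 <= (2 * (y / 3)) ^+ 2 by rewrite lerXn2r ?nnegrE ?cabs_ge0//; lra.
  by have := ler_wpM2l (sqr_ge0 y) p; have := sqr_ge0 y; lra.
Qed.

End Factors.

(** Off its poles f is a constant times exp h, Blaschke factors of A and inverse Blaschke factors of
    B, to which the expansions apply. The weights are kept for the zeros, because only their
    weighted sum is bounded, and dropped for the poles, whose number is bounded. *)
Lemma difference_quotient_estimate (f G : R[i] -> R[i]) (A B : seq R[i]) (beta r Lam : R)
   h kappa z eta :
  0 < r -> r < beta -> hol beta h -> cabs kappa = 1 ->
  {in A ++ B, forall c, (cabs c < r -> cabs c * beta <= r ^+ 2) /\ (r <= cabs c -> beta <= cabs c)} ->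
  (forall w, cabs w < beta -> w \notin B ->
     f w * \prod_(b <- B) (w - b) = \prod_(a <- A) (w - a) * G w) ->
  (forall w, cabs w < beta -> G w * \prod_(a <- A) blden r a w =
       kappa * cexp (h w) * \prod_(b <- B) blden r b w) ->
  ravg r (fun w => `|Re (h w)|) <= 10 * Lam ->
  cabs z <= r / 4 -> cabs (z + eta) <= r / 4 -> cabs eta <= r / 16 ->
  z \notin A -> z \notin B -> z + eta \notin B ->
  let Y := 600 * Lam * cabs eta / r + \sum_(a <- A) 2 * cabs eta * blweight r a / cabs (z - a)
      + \sum_(b <- B) 6 * cabs eta / cabs (z - b) in
  Y <= 1 / 8 ->
  f z != 0 /\
  cabs ((f (z + eta) - f z) / f z - eta * (cderiv f z / f z)) <= Y ^+ 2 + 2 * cabs eta / r * Y.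
Proof.
move=> r0 rb Hh k1 Hc fE GE hL zr zer er zA zB zeB Y Y1.
set tau := 2 * cabs eta / r.
have t01 : 0 <= tau <= 1 / 8.
  by rewrite /tau divr_ge0 ?mulr_ge0 ?cabs_ge0 ?(ltW r0)//= ler_pdivrMr//; lra.
have kn : kappa != 0 by rewrite -cabs_gt0 k1.
have L0 : 0 <= 10 * Lam by apply: le_trans hL; apply: ravg_ge0 => //; exact: ltW.
have zb : cabs z < beta by lra. have zeb : cabs (z + eta) < beta by lra.
have neq s c : z \notin s -> c \in s -> z != c by move=> zs cs; apply: contraNneq zs => ->.
pose S1 := \sum_(a <- A) 2 * cabs eta * blweight r a / cabs (z - a).
pose S2 := \sum_(b <- B) 6 * cabs eta / cabs (z - b).
pose y0 := 60 * (10 * Lam) * cabs eta / r.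
have yE : 600 * Lam * cabs eta / r = y0 by rewrite /y0; ring.
have yA a : 0 <= 2 * cabs eta * blweight r a / cabs (z - a).
  by case/andP: (blweight_itv a r0) => w0 _; rewrite divr_ge0 ?mulr_ge0 ?cabs_ge0.
have yB b : 0 <= 6 * cabs eta / cabs (z - b) by rewrite divr_ge0 ?mulr_ge0 ?cabs_ge0.
have S10 : 0 <= S1 by apply: sumr_ge0.
have S20 : 0 <= S2 by apply: sumr_ge0.
have y00 : 0 <= y0 by rewrite divr_ge0 ?mulr_ge0 ?cabs_ge0 ?(ltW r0)//; lra.
have YE : Y = y0 + S1 + S2 by rewrite /Y yE.
rewrite YE in Y1 *.
have HcA a : a \in A -> r <= cabs a -> beta <= cabs a by move=> aA; apply: (Hc _ _).2; rewrite mem_cat aA.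
have HcB b : b \in B -> r <= cabs b -> beta <= cabs b by move=> bB; apply: (Hc _ _).2; rewrite mem_cat bB orbT.
have q1 := dq_cexp_hol r0 zr zer er rb Hh kn hL.
have q2 : dq tau z eta (fun w => \prod_(a <- A) ((w - a) / blden r a w)) S1.
  apply: dq_prod => //; first by rewrite -/S1; lra.
  by move=> a aA; exact: (dq_blfac r0 zr zer rb (HcA _ aA) (neq _ _ _ zA aA)).
have q3 : dq tau z eta (fun w => \prod_(b <- B) ((w - b) / blden r b w)^-1) S2.
  apply: dq_prod => //; first by rewrite -/S2; lra.
  move=> b bB.
  have yb : 6 * cabs eta / cabs (z - b) <= 1 / 8.
    have : 6 * cabs eta / cabs (z - b) <= S2.
      by rewrite /S2 (perm_big _ (perm_to_rem bB)) /= big_cons lerDl sumr_ge0.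
    lra.
  by have [] := dq_blfacV r0 zr zer er rb (HcB _ bB) (neq _ _ _ zB bB) yb.
have q : dq tau z eta (fun w => kappa * cexp (h w) * \prod_(a <- A) ((w - a) / blden r a w)
    * \prod_(b <- B) ((w - b) / blden r b w)^-1) (y0 + S1 + S2).
  have [i1 i2 i3 i4] : [/\ 0 <= y0 + S1 <= 1 / 8, 0 <= S2 <= 1 / 8, 0 <= y0 <= 1 / 8 & 0 <= S1 <= 1 / 8].
    by split; clear -Y1 y00 S10 S20; lra.
  apply: dq_mul => //; apply: dq_mul => //.
  by apply: q1; rewrite -/y0; lra.
have nz c w : c \in A ++ B -> cabs w < beta -> blden r c w != 0.
  by move=> /Hc[c1 c2] wb; exact: (@blden_neq0 _ r beta).
have fF w : cabs w < beta -> w \notin B -> kappa * cexp (h w) * \prod_(a <- A) ((w - a) / blden r a w)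
    * \prod_(b <- B) ((w - b) / blden r b w)^-1 = f w.
  move=> wb wB; have KA : \prod_(a <- A) blden r a w != 0.
    by rewrite prodf_seq_neq0; apply/allP => a aA /=; apply: nz => //; rewrite mem_cat aA.
  have KB : \prod_(b <- B) blden r b w != 0.
    by rewrite prodf_seq_neq0; apply/allP => b bB /=; apply: nz => //; rewrite mem_cat bB orbT.
  have PB : \prod_(b <- B) (w - b) != 0.
    rewrite prodf_seq_neq0; apply/allP => b bB /=; rewrite subr_eq0.
    by apply: contraNneq wB => ->.
  rewrite prodf_div prodfV prodf_div invf_div.
  have E1 := fE _ wb wB; have E2 := GE _ wb.
  apply: (mulIf PB); rewrite E1; apply: (mulIf KA); rewrite -[RHS]mulrA E2.
  by field; rewrite PB KA.
have [d1 d10 B1] : exists2 d1 : R, 0 < d1 & forall w, cabs (w - z) < d1 -> w \notin B.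
  elim: (B) zB => [|b s IH]; first by exists 1.
  rewrite inE negb_or => /andP[zb' /IH[d1 d10 H1]].
  exists (Num.min d1 (cabs (z - b))); first by rewrite lt_min d10 cabs_gt0 subr_eq0.
  move=> w; rewrite lt_min => /andP[/H1 ws wb]; rewrite inE negb_or ws andbT.
  by apply/eqP => E; rewrite E cabsBC ltxx in wb.
have [l [dl fz l1 l2]] : dq tau z eta f (y0 + S1 + S2).
  apply: (@dq_eq _ _ _ _ _ _ (Num.min d1 (beta - cabs z))) q; last exact: fF.
    by rewrite lt_min d10 subr_gt0.
  move=> w; rewrite lt_min => /andP[/B1 wB wz]; apply: fF => //.
  by have := cabsD (w - z) z; rewrite subrK; lra.
split=> //; rewrite (cder_cderiv dl) (_ : (f (z + eta) - f z) / f z = f (z + eta) / f z - 1)//.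
by rewrite mulrBl divff.
Qed.

End DifferenceQuotient.

(** * Growth of zeros and poles *)

Section Poles.
Variable R : realType.
Implicit Types (f F : R[i] -> R[i]) (z w a b : R[i]).

Lemma has_poleP f a n : has_pole f a n -> exists (g : R[i] -> R[i]) (d : R),
  [/\ (0 < n)%N, 0 < d, g a != 0, (forall w, cabs (w - a) < d -> cdiff g w) &
      forall w, cabs (w - a) < d -> w != a -> f w = g w / (w - a) ^+ n].
Proof.
move=> [n0 [g [/holomorphic_atP[d1 d10 H1] ga /dnbhs_cabsP[d2 d20 H2]]]].
exists g, (Num.min d1 d2); split=> //; first by rewrite lt_min d10.
  by move=> w; rewrite lt_min => /andP[/H1].
by move=> w; rewrite lt_min => /andP[_]; exact: H2.
Qed.

Lemma has_pole_intro f g a n (d : R) : (0 < n)%N -> 0 < d -> g a != 0 ->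
  (forall w, cabs (w - a) < d -> cdiff g w) ->
  (forall w, cabs (w - a) < d -> w != a -> f w = g w / (w - a) ^+ n) -> has_pole f a n.
Proof.
move=> n0 d0 ga H1 H2; split=> //; exists g; split=> //.
  by apply/holomorphic_atP; exists d.
by apply/dnbhs_cabsP; exists d.
Qed.

(** If f were continuous at a, then f(w) (w - a)^n would tend to 0, while off a it equals g(w),
    which tends to g(a) != 0. This keeps the poles outside any disc on which f is differentiable. *)
Lemma pole_not_cdiff f a n : has_pole f a n -> ~ cdiff f a.
Proof.
move=> /has_poleP[g [d [n0 d0 ga Hg Hf]]] Hd.
have cg : ccont g a by apply/cdiff_ccont/Hg; rewrite subrr cabs0.
have C : ccont (fun w => f w * (w - a) ^+ n) a.
  by apply/cdiff_ccont/cdiffM => //; apply/cdiffX/cdiff_sub.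
move/eqP : ga; apply; apply/cabs_eq_small => e e0; have e2 : 0 < e / 2 by lra.
have /ccontP /(_ _ e2)[d1 d10 H1] := cg; have /ccontP /(_ _ e2)[d2 d20 H2] := C.
pose m := Num.min d (Num.min d1 d2); have m0 : 0 < m by rewrite !lt_min d0 d10.
pose w := a + (m / 2)%:C.
have wa : cabs (w - a) = m / 2 by rewrite /w addrC addKr cabs_real_ge0//; lra.
have [k1 [k2 k3]] : m / 2 < d /\ m / 2 < d1 /\ m / 2 < d2.
  have h1 : m <= d by rewrite ge_min lexx.
  have h2 : m <= d1 by rewrite !ge_min lexx orbT.
  have h3 : m <= d2 by rewrite !ge_min lexx !orbT.
  by split; [|split]; lra.
have wna : w != a by rewrite -subr_eq0 -cabs_gt0 wa; lra.
have := H2 w; rewrite wa => /(_ k3); rewrite subrr expr0n eqn0Ngt n0 mulr0 subr0.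
rewrite (Hf w) ?wa// divfK ?expf_neq0 ?subr_eq0// => h2.
have := H1 w; rewrite wa cabsBC => /(_ k2) h1.
by have := cabsD (g a - g w) (g w); rewrite subrK; lra.
Qed.

Lemma holomorphic_at_cdiff f a : holomorphic_at f a -> cdiff f a.
Proof. by move=> /holomorphic_atP[d d0 H]; apply: H; rewrite subrr cabs0. Qed.

Lemma pole_multP f a : pole_mult f a != 0%N -> has_pole f a (pole_mult f a).
Proof. by rewrite /pole_mult; case: xgetP => //= n -> H _. Qed.

Lemma pole_mult0 f a : meromorphic f -> pole_mult f a = 0%N -> holomorphic_at f a.
Proof.
move=> /(_ a)[//|[n H]] E; exfalso.
have := @xgetPex _ 0%N [set n | has_pole f a n] (ex_intro _ n H).
by rewrite -/(pole_mult f a) E => -[].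
Qed.

(** Poles are removed one at a time: f is multiplied by the appropriate power and its value at b is
    replaced by that of the numerator g. The other points of S remain poles of the same order, since
    the power of z - b is holomorphic and nonzero near them. *)
Lemma clear_poles (m : R[i] -> nat) (S : seq R[i]) f (beta : R) : uniq S ->
  (forall z, cabs z < beta -> z \notin S -> cdiff f z) -> {in S, forall b, has_pole f b (m b)} ->
  exists2 F, hol beta F & forall z, z \notin S -> F z = f z * \prod_(b <- S) (z - b) ^+ m b.
Proof.
elim: S f => [|b S IH] f.
  move=> _ H _; exists f; first by move=> z zb; exact: H.
  by move=> z _; rewrite big_nil mulr1.
move=> /= /andP[bS uS] H P.
have [g [d [n0 d0 gb Hg Hf]]] := has_poleP (P b (mem_head _ _)).
pose f1 z := if z == b then g b else f z * (z - b) ^+ m b.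
have f1E z : z != b -> f1 z = f z * (z - b) ^+ m b by rewrite /f1 => /negbTE->.
have f1g w : cabs (w - b) < d -> f1 w = g w.
  move=> wd; rewrite /f1; case: eqP => [->//|/eqP wb].
  by rewrite Hf// divfK// expf_neq0// subr_eq0.
have [z zb zS|b' b'S|F HF E] := IH f1 uS _ _.
- have [->|znb] := eqVneq z b.
    apply: (@cdiff_eq _ g _ _ d) => // [w wd|]; first by rewrite f1g.
    by apply: Hg; rewrite subrr cabs0.
  apply: (@cdiff_eq _ (fun w => f w * (w - b) ^+ m b) _ _ (cabs (z - b))).
  + by rewrite cabs_gt0 subr_eq0.
  + by move=> w wz; rewrite f1E//; apply/eqP => E; rewrite E cabsBC ltxx in wz.
  + apply: cdiffM; last by apply/cdiffX/cdiff_sub.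
    by apply: H => //; rewrite inE negb_or znb.
- have [g' [d' [n0' d0' gb' Hg' Hf']]] := has_poleP (P b' (mem_behead (b'S : b' \in behead (b :: S)))).
  have bb : b' != b by apply: contraNneq bS => <-.
  have bb0 : 0 < cabs (b' - b) by rewrite cabs_gt0 subr_eq0.
  apply: (@has_pole_intro _ (fun w => g' w * (w - b) ^+ m b) _ _ (Num.min d' (cabs (b' - b)))) => //.
  + by rewrite lt_min d0'.
  + by rewrite mulf_neq0// expf_neq0// subr_eq0.
  + move=> w; rewrite lt_min => /andP[wd _].
    by apply: cdiffM; [exact: Hg'|apply/cdiffX/cdiff_sub].
  + move=> w; rewrite lt_min => /andP[wd wb] wnb; rewrite f1E; last first.
      by apply/eqP => E; rewrite E cabsBC ltxx in wb.
    by rewrite Hf'// mulrAC.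
- exists F => // z; rewrite inE negb_or => /andP[zb zS].
  by rewrite E// f1E// big_cons mulrA.
Qed.

Lemma npoles_ge0 f t : (0 <= npoles f t)%E.
Proof. by apply: esum_ge0 => a _; rewrite lee_fin. Qed.

Lemma npoles_le f s t : s <= t -> (npoles f s <= npoles f t)%E.
Proof.
move=> st; apply: ub_ereal_sup => _ [A [fA AS] <-]; apply: ereal_sup_ubound.
by exists A => //; split=> // a /AS /= h; exact: le_trans st.
Qed.

Lemma npoles0 f : npoles f 0 = ((pole_mult f 0)%:R)%:E.
Proof.
rewrite /npoles (_ : [set a : R[i] | cabs a <= 0] = [set 0]) ?esum_set1 ?lee_fin//.
apply/seteqP; split=> a /=; last by move=> ->; rewrite cabs0.
by move=> h; apply/eqP; rewrite -cabs_eq0 eq_le h cabs_ge0.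
Qed.

Lemma pole_list f (t M : R) : (npoles f t <= M%:E)%E -> exists S : seq R[i],
  [/\ uniq S, (forall b, b \in S <-> cabs b <= t /\ pole_mult f b != 0%N) &
      (\sum_(b <- S) pole_mult f b)%:R <= M].
Proof.
move=> HM; pose P := [set b : R[i] | cabs b <= t /\ pole_mult f b != 0%N].
have key (S : seq R[i]) : uniq S -> (forall b, b \in S -> P b) ->
    (\sum_(b <- S) pole_mult f b)%:R <= M.
  move=> uS SP; rewrite -lee_fin; apply: le_trans HM; apply: esum_ge.
  exists [set` S]; first by split; [exact: finite_seq|move=> b /SP[]].
  by rewrite natr_sum -sumEFin fsbig_seq.
have fP : finite_set P.
  apply: contrapT => /(infinite_set_fset (Num.bound `|M|).+1)[B BP sB].
  have := key (finmap.enum_fset B) (finmap.fset_uniq B) (fun b h => BP b h).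
  apply/negP; rewrite -ltNge; apply: le_lt_trans (ler_norm M) _.
  apply: lt_le_trans (archi_boundP (normr_ge0 M)) _; rewrite ler_nat.
  apply: leq_trans (ltnW sB) _; rewrite -sum1_size big_seq [leqRHS]big_seq.
  by apply: leq_sum => b /(BP b)[_]; rewrite lt0n.
have [B EB] := finite_fsetP.1 fP.
have memB b : b \in finmap.enum_fset B <-> P b by rewrite EB.
exists (finmap.enum_fset B); split; [exact: finmap.fset_uniq|exact: memB|].
by apply: key; [exact: finmap.fset_uniq|move=> b /memB].
Qed.

Lemma expand_mult (m : R[i] -> nat) (S : seq R[i]) : exists B : seq R[i],
  [/\ size B = (\sum_(b <- S) m b)%N, (forall b, b \in B -> b \in S),
     (forall b, b \in S -> m b != 0%N -> b \in B) &
     forall z, \prod_(b <- B) (z - b) = \prod_(b <- S) (z - b) ^+ m b].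
Proof.
elim: S => [|b S [B [sB B1 B2 B3]]].
  by exists [::]; split=> //; rewrite ?big_nil// => z; rewrite !big_nil.
exists (nseq (m b) b ++ B); split.
- by rewrite size_cat size_nseq big_cons sB.
- by move=> c; rewrite mem_cat mem_nseq inE => /orP[/andP[_ ->]//|/B1->]; rewrite orbT.
- move=> c; rewrite mem_cat mem_nseq inE => /predU1P[->|cS] mc; first by rewrite lt0n mc eqxx.
  by rewrite B2 ?orbT.
- by move=> z; rewrite big_cat big_cons B3 big_nseq iter_mulr_1.
Qed.

Lemma meromorphic_quotient f (t M : R) : meromorphic f -> (npoles f t <= M%:E)%E ->
  exists B F, [/\ hol t F, (size B)%:R <= M,
    (forall b, b \in B -> exists n, has_pole f b n),
    (forall z, cabs z <= t -> z \notin B -> holomorphic_at f z) &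
    forall z, z \notin B -> F z = f z * \prod_(b <- B) (z - b)].
Proof.
move=> mf /pole_list[S [uS memS SM]].
have nonpole z : cabs z <= t -> z \notin S -> holomorphic_at f z.
  move=> zt zS; apply: pole_mult0 => //; apply/eqP; apply: contraNT zS => h.
  by apply/memS.
have [F HF E] := @clear_poles (pole_mult f) S f t uS
  (fun z zt zS => holomorphic_at_cdiff (nonpole z (ltW zt) zS))
  (fun b bS => pole_multP ((memS b).1 bS).2).
have [B [sB B1 B2 B3]] := expand_mult (pole_mult f) S.
have BS b : b \in B = (b \in S).
  by apply/idP/idP => [|bS]; [exact: B1|apply: B2 => //; case/memS: bS].
exists B, F; split=> //.
- by rewrite sB.
- by move=> b; rewrite BS => /memS[_ /pole_multP]; exists (pole_mult f b).
- by move=> z zt; rewrite BS; exact: nonpole.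
- by move=> z; rewrite BS => /E ->; rewrite B3.
Qed.

End Poles.

(** * The pole counting function against the characteristic *)

Section Growth.
Variable R : realType.
Implicit Types (f : R[i] -> R[i]) (r s t : R).
Local Notation mu := (@lebesgue_measure R).

Lemma proximity_ge0 f r : (0 <= proximity f r)%E.
Proof.
rewrite mule_ge0// ?lee_fin ?invr_ge0 ?mulr_ge0 ?pi_ge0//.
by apply: integral_ge0 => t _; rewrite lee_fin le_max lexx.
Qed.

Lemma nondecreasing_emeasurable (D : set R) (g : R -> \bar R) : measurable D ->
  {homo g : x y / (x <= y)%R >-> (x <= y)%E} -> measurable_fun D g.
Proof.
move=> mD g_nd; apply: (measurability _ (ErealGenOInfty.measurableE R)) => //.
move=> _ [_ [x ->] <-]; apply: measurableI => //; apply: is_interval_measurable.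
move=> a b /= ga _ c /andP[ac _]; move: ga; rewrite !in_itv /= !andbT => /lt_le_trans; apply.
exact: g_nd.
Qed.

(** On (t, 2t] the integrand is at least c / (2t), and n(0) log (2t) >= 0 because t >= 1. A real
    minorant c is used so that an infinite number of poles is covered as well. *)
Lemma pole_counting_ge f t (c : R) : 1 <= t -> 0 <= c ->
  (c%:E <= npoles f t - npoles f 0)%E ->
  ((c / 2)%:E <= pole_counting f (2 * t))%E.
Proof.
move=> t1 c0 hc; have t0 : 0 < t by lra.
have L0 : 0 <= ln (2 * t) by apply: ln_ge0; lra.
apply: (@le_trans _ _ (\int[mu]_(s in `]0%R, (2 * t)%R]) ((npoles f s - npoles f 0) * (s^-1)%:E))%E); last first.
  by rewrite leeDl// mule_ge0 ?npoles_ge0 ?lee_fin.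
have fin0 : npoles f 0 \is a fin_num by rewrite npoles0.
have g0 s : 0 < s -> (0 <= (npoles f s - npoles f 0) * (s^-1)%:E)%E.
  move=> s0; rewrite mule_ge0 ?lee_fin ?invr_ge0 ?(ltW s0)//.
  by rewrite sube_ge0 ?fin0// npoles_le// ltW.
have mg : measurable_fun `]0%R, (2 * t)%R] (fun s => (npoles f s - npoles f 0) * (s^-1)%:E)%E.
  apply: emeasurable_funM.
    apply: nondecreasing_emeasurable => // x y xy.
    by rewrite leeB// npoles_le.
  apply/measurable_EFinP; apply: subspace_continuous_measurable_fun => //.
  apply/continuous_in_subspaceT => s; rewrite inE /= in_itv /= => /andP[s0 _].
  by apply: cvgV; [rewrite gt_eqF|exact: cvg_id].
apply: (@le_trans _ _ (\int[mu]_(s in `]t, (2 * t)%R]) ((npoles f s - npoles f 0) * (s^-1)%:E))%E); last first.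
  apply: ge0_subset_integral => //.
  - by move=> s /=; rewrite in_itv /= => /andP[s0 _]; exact: g0.
  - by move=> s /=; rewrite !in_itv /= => /andP[ts ->]; rewrite (lt_trans t0 ts).
have -> : (c / 2)%:E = (\int[mu]_(s in `]t, (2 * t)%R]) (cst ((c / (2 * t))%:E) s))%E.
  rewrite integral_cst//= lebesgue_measure_itv /= lte_fin ltr_pMl// ltr1n -EFinB -EFinM.
  by congr EFin; field; rewrite gt_eqF.
apply: ge0_le_integral => //.
- by move=> s _; rewrite lee_fin divr_ge0//; lra.
- apply: measurable_funS mg => //.
  by move=> s /=; rewrite !in_itv /= => /andP[ts ->]; rewrite (lt_trans t0 ts).
- move=> s /=; rewrite in_itv /= => /andP[ts s2t]; rewrite EFinM.
  apply: lee_pmul; rewrite ?lee_fin// ?invr_ge0; [lra| |].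
    by apply: le_trans hc _; rewrite leeB// npoles_le// ltW.
  by rewrite lef_pV2 ?posrE//; lra.
Qed.

End Growth.

Section GrowthBounds.
Variable R : realType.
Implicit Types (f : R[i] -> R[i]) (r s t M : R).
Local Notation mu := (@lebesgue_measure R).

Lemma pole_counting_ge0 f r : 2 <= r -> (0 <= pole_counting f r)%E.
Proof.
move=> r2; have := @pole_counting_ge R f (r / 2) 0 _ (lexx _) _.
rewrite mulrCA divff// mulr1 mul0r; apply; first by lra.
rewrite sube_ge0 ?npoles0//.
by rewrite -npoles0 npoles_le//; lra.
Qed.

Lemma proximity_le_char f r : 2 <= r -> (proximity f r <= nevanlinna_char f r)%E.
Proof. by move=> r2; rewrite leeDl// pole_counting_ge0. Qed.

Lemma npoles_le_char f t M : 1 <= t -> (nevanlinna_char f (2 * t) <= M%:E)%E ->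
  (npoles f t <= ((pole_mult f 0)%:R + 2 * M)%:E)%E.
Proof.
move=> t1 HT; set k : R := (pole_mult f 0)%:R.
have HP : (pole_counting f (2 * t) <= M%:E)%E.
  by apply: le_trans HT; rewrite leeDr// proximity_ge0.
have key (c : R) : 0 <= c -> (c%:E <= npoles f t - npoles f 0)%E -> c <= 2 * M.
  move=> c0 /(pole_counting_ge t1 c0) /le_trans /(_ HP).
  by rewrite lee_fin ler_pdivrMr// mulrC.
have k_le : (k%:E <= npoles f t)%E by rewrite -npoles0 npoles_le//; lra.
rewrite npoles0 -/k in key; move: key k_le; case: (npoles f t) => [v| |] key k_le //.
  rewrite lee_fin in k_le; rewrite lee_fin.
  have : v - k <= 2 * M by apply: key; rewrite ?subr_ge0// lee_fin.
  by lra.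
(* If the number of poles were infinite, c = 2 |M| + 1 would be admissible, contradicting c <= 2
   M. *)
have M0 : 0 <= 2 * `|M| + 1 by have := normr_ge0 M; lra.
have h : ((2 * `|M| + 1)%:E <= +oo - k%:E)%E by rewrite addye// leey.
have {key} := key _ M0 h; move=> {h k_le HT HP}; have := ler_norm M.
by move=> h1 h2; exfalso; lra.
Qed.

Lemma order_growth f (sigma e : R) : order_of_growth f = sigma%:E -> 0 < e ->
  exists2 r0 : R, 1 < r0 & forall r, r0 < r -> (nevanlinna_char f r <= (r `^ (sigma + e))%:E)%E.
Proof.
move=> Ho e0; have : (order_of_growth f < (sigma + e)%:E)%E.
  by rewrite Ho lte_fin ltrDl.
(* The limsup is the infimum, over neighbourhoods V of infinity, of the suprema over V; one of these
   suprema is already below sigma + e. *)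
move=> /ereal_inf_lt[_ [V [M [_ HV]] <-] Hs].
exists (Num.max 1 M + 1); first by rewrite ltr_pwDr// le_max lexx.
move=> r hr; have r1 : 1 < r by apply: lt_trans hr; rewrite ltr_pwDr// le_max lexx.
have rM : M < r by apply: lt_trans hr; rewrite ltr_pwDr// le_max lexx orbT.
have l0 : 0 < ln r by exact: ln_gt0.
have r0 : 0 < r by lra.
have H : (elogplus (nevanlinna_char f r) * ((ln r)^-1)%:E <= (sigma + e)%:E)%E.
  apply: le_trans (ltW Hs); apply: ereal_sup_ubound; exists r => //; exact: HV.
have {}H : (elogplus (nevanlinna_char f r) <= ((sigma + e) * ln r)%:E)%E.
  by rewrite EFinM -lee_pdivrMr.
have {}H : (lne (nevanlinna_char f r) <= ((sigma + e) * ln r)%:E)%E.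
  by apply: le_trans H; rewrite le_max lexx orbT.
have p0 : 0 < r `^ (sigma + e) by exact: powR_gt0.
move: H; case: (nevanlinna_char f r) => [x| |].
- have [x0|x0] := ltP 0 x; last by move=> _; rewrite lee_fin (le_trans x0)// ltW.
  by rewrite lne_EFin// !lee_fin -ln_powR ler_ln ?posrE.
- by rewrite /=.
- by move=> _; rewrite leNye.
Qed.

Lemma order_ge0 f (sigma : R) : order_of_growth f = sigma%:E -> 0 <= sigma.
Proof.
move=> Ho; rewrite -lee_fin -Ho; apply: le_ereal_inf_tmp => _ [V [M [_ HV]] <-].
pose r := Num.max 2 (M + 1).
have r2 : 2 <= r by rewrite le_max lexx.
have Vr : V r.
  by apply: HV; apply: (@lt_le_trans _ _ (M + 1)); [rewrite ltrDl|rewrite le_max lexx orbT].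
apply: (@le_trans _ _ (elogplus (nevanlinna_char f r) * ((ln r)^-1)%:E)%E); last first.
  by apply: ereal_sup_ubound; exists r.
apply: mule_ge0; first by rewrite le_max lexx.
by rewrite lee_fin invr_ge0 ln_ge0//; lra.
Qed.

Lemma proximity_ravg f r (h : R[i] -> R[i]) : 0 < r ->
  rconc r (fun z => Num.max 0 (Re (h z))) ->
  (forall z, cabs z = r -> logplus (cabs (f z)) = Num.max 0 (Re (h z))) ->
  proximity f r = (ravg r (fun z => Num.max 0 (Re (h z))))%:E.
Proof.
move=> r0 C E; rewrite /proximity /ravg EFinM; congr (_ * _)%E.
have I := rcon_integrable C.
rewrite /rint /Rintegral fineK; last exact: integrable_fin_num.
by apply: eq_integral => t _; rewrite E// circle_on// ltW.
Qed.

(** Each point of s rules out at most one half of the current interval, and shrinking the final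
    interval by thirds makes the inequalities strict. Applied to the moduli of zeros and poles, this
    gives an annulus free of both, hence room for r < beta. *)
Lemma radius_gap (s : seq R) (lo hi : R) : lo < hi ->
  exists al be, [/\ lo < al, al < be, be < hi & {in s, forall x, x < al \/ be < x}].
Proof.
move=> lh; suff H : exists al be, [/\ lo <= al, al < be, be <= hi & {in s, forall x, x <= al \/ be <= x}].
  have [al [be [h1 h2 h3 h4]]] := H.
  exists (al + (be - al) / 3), (be - (be - al) / 3); split; [lra|lra|lra|].
  by move=> x /h4[]; [left|right]; lra.
elim: s => [|x s [al [be [h1 h2 h3 h4]]]]; first by exists lo, hi; split.
have [xm|mx] := leP x ((al + be) / 2).
  exists ((al + be) / 2), be; split; [lra|lra|lra|].
  move=> y; rewrite inE => /predU1P[->|/h4[]]; [by left|left; lra|by right].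
exists al, ((al + be) / 2); split; [lra|lra|lra|].
move=> y; rewrite inE => /predU1P[->|/h4[]]; [by right; lra|by left|right; lra].
Qed.

Lemma cabs_dist (z a : R[i]) : `|cabs z - cabs a| <= cabs (z - a).
Proof.
rewrite ler_norml; have := cabs_triB z a; have := cabs_triB a z.
by rewrite [cabs (a - z)]cabsBC; lra.
Qed.

(** Replacing |z - b| by the difference of moduli makes the bound depend on |z| only, so that the
    exceptional set can be a set of radii. *)
Lemma sum_inv_dist_le (B : seq R[i]) (z : R[i]) (k : R) : 0 <= k ->
  {in B, forall b, 0 < `|cabs z - cabs b|} ->
  \sum_(b <- B) k / cabs (z - b) <= k * \sum_(b <- B) `|cabs z - cabs b|^-1.
Proof.
move=> k0 nz; rewrite mulr_sumr big_seq [leRHS]big_seq; apply: ler_sum => b bB.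
have db : `|cabs z - cabs b| <= cabs (z - b) by exact: cabs_dist.
rewrite ler_wpM2l// lef_pV2 ?posrE ?db ?nz//.
exact: lt_le_trans (nz _ bB) db.
Qed.

Lemma sum_blweight_div_le (A : seq R[i]) (z : R[i]) (r X k : R) : 0 < r -> 0 < X -> 0 <= k ->
  cabs z <= 2 * X ->
  {in [seq a <- A | cabs a <= 4 * X], forall a, 0 < `|cabs z - cabs a|} ->
  \sum_(a <- A) k * blweight r a / cabs (z - a) <=
   k * \sum_(a <- A | cabs a <= 4 * X) `|cabs z - cabs a|^-1 + k / (2 * X) * \sum_(a <- A) blweight r a.
Proof.
move=> r0 X0 k0 zX nz.
rewrite !mulr_sumr [X in _ <= X + _]big_mkcond /= -big_split /= big_seq [leRHS]big_seq.
apply: ler_sum => a aA; have /andP[w0 w1] := blweight_itv a r0.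
have da : `|cabs z - cabs a| <= cabs (z - a) by exact: cabs_dist.
have [a4|a4] := leP (cabs a) (4 * X).
  have na : 0 < `|cabs z - cabs a| by apply: nz; rewrite mem_filter a4 aA.
  apply: (@le_trans _ _ (k * `|cabs z - cabs a|^-1)); last first.
    by rewrite lerDl mulr_ge0// divr_ge0// mulr_ge0// ltW.
  rewrite -[leLHS]mulrA ler_wpM2l// -[leRHS]mul1r ler_pM ?invr_ge0 ?cabs_ge0//.
  by rewrite lef_pV2 ?posrE ?da//; exact: lt_le_trans da.
have h1 : 2 * X <= cabs (z - a) by have := cabs_triB a z; rewrite cabsBC; lra.
rewrite add0r [leRHS]mulrAC ler_wpM2l ?mulr_ge0// lef_pV2 ?posrE//; first by lra.
by rewrite mulr_gt0.
Qed.

(** Poles are removed up to modulus 16 X, zeros up to 12 X, and r is found between 10 X and 11 X.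
    Then |z| <= 2 X and |eta| <= X/2 give |z + eta| <= r/4, and |z1| <= X gives |z1| <= r/8. The
    logarithm in W bounds ln (2 r / d). *)
Lemma scale_factorization f (z1 : R[i]) (X d M : R) : meromorphic f ->
  (forall w, cabs (w - z1) < d -> cdiff f w) -> f z1 != 0 ->
  0 < d -> d <= X -> 2 <= X -> cabs z1 <= X ->
  1 <= M -> (forall r, 10 * X < r -> r < 11 * X -> (proximity f r <= M%:E)%E) ->
  (npoles f (16 * X) <= M%:E)%E ->
  let W := M * (1 + `|ln (cabs (f z1))| + ln (22 * X / d)) in
  exists A B G h kappa r be,
  [/\ 10 * X < r, r < be, hol be h, cabs kappa = 1 &
    {in A ++ B, forall c, (cabs c < r -> cabs c * be <= r ^+ 2) /\ (r <= cabs c -> be <= cabs c)}] /\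
  [/\ forall z, cabs z < be -> z \notin B ->
       f z * \prod_(b <- B) (z - b) = \prod_(a <- A) (z - a) * G z,
    forall z, cabs z < be -> G z * \prod_(a <- A) blden r a z =
       kappa * cexp (h z) * \prod_(b <- B) blden r b z,
    forall z, cabs z <= 16 * X -> z \notin B -> holomorphic_at f z &
    [/\ ravg r (fun z => `|Re (h z)|) <= 10 * W, \sum_(a <- A) blweight r a <= 9 * W,
      (size B)%:R <= W & 1 <= W]].
Proof.
move=> mf df fz1 d0 dX X2 z1X M1 Hprox Hpoles W.
have X0 : 0 < X by lra.
have [B [F [HF sB BP Bhol FE]]] := meromorphic_quotient mf Hpoles.
have Bd : {in B, forall b, d <= cabs (z1 - b)}.
  move=> b /BP[n Pb]; rewrite leNgt; apply/negP => h; apply: (pole_not_cdiff Pb).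
  by apply: df; rewrite cabsBC.
have z1B : z1 \notin B by apply/negP => /Bd; rewrite subrr cabs0; lra.
have Fz1 : F z1 != 0.
  rewrite FE// mulf_neq0// prodf_seq_neq0; apply/allP => b bB /=.
  by rewrite subr_eq0; apply: contraNneq z1B => ->.
have s12 : 12 * X < 16 * X by lra.
have z112 : cabs z1 <= 12 * X by lra.
have [A [G [HG FG As G0]]] := hol_zero_factorization s12 HF z112 Fz1.
have X89 : 10 * X < 11 * X by lra.
have [al [be [a8 ab b9 gap]]] := radius_gap (map (@cabs R) (A ++ B)) X89.
(* For the midpoint, al be <= r^2 by the arithmetic-geometric mean inequality; so the zeros and
   poles inside |z| < r, which lie in |z| < al, have their reflections outside |z| < be. *)
pose r := (al + be) / 2.
have ar : al < r by rewrite /r; lra.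
have rb : r < be by rewrite /r; lra.
have r0 : 0 < r by lra.
have Hc : {in A ++ B, forall c, (cabs c < r -> cabs c * be <= r ^+ 2) /\ (r <= cabs c -> be <= cabs c)}.
  move=> c cAB; have [ca|cb] := gap _ (map_f (@cabs R) cAB); split=> h; try lra.
  have : cabs c * be <= al * be by rewrite ler_wpM2r//; lra.
  by have := sqr_ge0 (al - be); rewrite /r; lra.
have rX : 10 * X < r by lra.
have Xr : r < 11 * X by rewrite /r; lra.
clearbody r; clear gap X89 s12 z112 ar.
have fE z : cabs z < be -> z \notin B -> f z * \prod_(b <- B) (z - b) = \prod_(a <- A) (z - a) * G z.
  by move=> _ zB; rewrite -FE// FG.
have be12 : be < 12 * X by lra.
have HG' : hol be G by move=> z zb; apply: HG; lra.
have G0' z : cabs z < be -> G z != 0 by move=> zb; apply: G0; lra.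
have z1r : cabs z1 <= r / 8 by lra.
have dr : d <= r by lra.
have [h [kappa [Hh k1 GE circ]]] := poisson_jensen r0 rb HG' G0' Hc fE z1r fz1 d0 dr Bd.
cbv zeta; set m := ravg r (fun z => Num.max 0 _); set L := ln (2 * r / d).
set Lam := m + _ + _ => -[HA HU].
have cU := conc_Re (ltW r0) (hol_conc rb Hh).
have cp : rconc r (fun z => Num.max 0 (Re (h z))).
  have -> : (fun z => Num.max 0 (Re (h z))) = (fun z => 2^-1 * (`|Re (h z)| + Re (h z))).
    apply/funext => z; case: (leP 0 (Re (h z))) => hz.
      by rewrite ger0_norm//; field.
    by rewrite ltr0_norm// addNr mulr0.
  by apply: rconZ; apply: rconD => //; exact: rcon_norm.
have lam0 : 0 <= Lam.
  have m0 : 0 <= m by apply: ravg_ge0 => [|w _]; [exact: ltW|rewrite le_max lexx].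
  have p1 : 0 <= (size B)%:R * L by apply: mulr_ge0; [exact: ler0n|apply: ln_ge0; rewrite ler_pdivlMr// mul1r; lra].
  have := normr_ge0 (ln (cabs (f z1)));
  by rewrite /Lam; lra.
have mM : m <= M.
  by rewrite -lee_fin -(proximity_ravg r0 cp circ); exact: Hprox.
have L_le : L <= ln (22 * X / d).
  have p1 : 0 < 2 * r / d by rewrite divr_gt0//; lra.
  have p2 : 0 < 22 * X / d by rewrite divr_gt0//; lra.
  by rewrite /L ler_ln ?posrE// ler_wpM2r ?invr_ge0 ?(ltW d0)//; lra.
have L0 : 0 <= L by apply: ln_ge0; rewrite ler_pdivlMr// mul1r; lra.
pose K := `|ln (cabs (f z1))|.
have K0 : 0 <= K by exact: normr_ge0.
have LamW : Lam <= W.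
  have h1 : (size B)%:R * L <= M * ln (22 * X / d) by exact: ler_pM (ler0n _ _) L0 sB L_le.
  have h2 : 1 * K <= M * K by rewrite ler_wpM2r.
  by rewrite /Lam /W -/K; lra.
have W1 : 1 <= W.
  have : 1 * 1 <= M * (1 + K + ln (22 * X / d)) by rewrite ler_pM//; lra.
  by rewrite /W -/K; lra.
have sBW : (size B)%:R <= W.
  by apply: le_trans sB _; rewrite /W -/K ler_peMr//; clear -M1 K0 L0 L_le; lra.
exists A, B, G, h, kappa, r, be; split; split=> //.
by split=> //; clear -HA HU LamW; lra.
Qed.

(* xs lists the moduli of the zeros of modulus at most 4 X and of the poles of
   modulus at most 16 X; the other zeros only contribute to W / X. *)
Lemma scale_estimate f (z1 eta : R[i]) (X d M : R) : meromorphic f ->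
  (forall w, cabs (w - z1) < d -> cdiff f w) -> f z1 != 0 ->
  0 < d -> d <= X -> 2 <= X -> cabs z1 <= X -> 0 < cabs eta -> 2 * cabs eta <= X ->
  1 <= M -> (forall r, 10 * X < r -> r < 11 * X -> (proximity f r <= M%:E)%E) ->
  (npoles f (16 * X) <= M%:E)%E ->
  let W := M * (1 + `|ln (cabs (f z1))| + ln (22 * X / d)) in
  exists xs : seq R, (size xs)%:R <= 13 * W /\
  forall z, X <= cabs z -> cabs z <= 2 * X -> cabs z \notin xs ->
    let Y := 100 * cabs eta * (W / X + \sum_(x <- xs) `|cabs z - x|^-1) in
    Y <= 1 / 8 ->
    [/\ holomorphic_at f z, holomorphic_at f (z + eta), f z != 0 &
      cabs ((f (z + eta) - f z) / f z - eta * (cderiv f z / f z)) <= Y ^+ 2 + cabs eta / X * Y].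
Proof.
move=> mf df fz1 d0 dX X2 z1X e0 eX M1 Hprox Hpoles W.
have X0 : 0 < X by lra.
have := scale_factorization mf df fz1 d0 dX X2 z1X M1 Hprox Hpoles; cbv zeta; rewrite -/W.
move: W X0 e0 eX; clear => W X0 e0 eX.
move=> [A [B [G [h [kappa [r [be [[rX rb Hh k1 Hc] [fE GE Bhol [HU HA sBW W1]]]]]]]]]].
have r0 : 0 < r by lra.
pose A1 := [seq a <- A | cabs a <= 4 * X].
have sA1 : (size A1)%:R <= 12 * W.
  (* Here |a| <= 4 X < r/2, so each weight is at least 3/4 and the number of such zeros is at most
     4/3 times 9 W. *)
  have w34 a : cabs a <= 4 * X -> 3 / 4 <= blweight r a.
    move=> a4; have ar' : cabs a < r by lra.
    rewrite /blweight ar' lerBrDr -lerBrDl ler_pdivrMr ?exprn_gt0//.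
    have : cabs a ^+ 2 <= (r / 2) ^+ 2 by rewrite lerXn2r ?nnegrE ?cabs_ge0//; lra.
    by have := sqr_ge0 r; lra.
  have : 3 / 4 * (size A1)%:R <= \sum_(a <- A1) blweight r a.
    rewrite mulrC -sum1_size natr_sum mulr_suml big_seq [leRHS]big_seq; apply: ler_sum => a.
    by rewrite mem_filter mul1r => /andP[/w34].
  have : \sum_(a <- A1) blweight r a <= \sum_(a <- A) blweight r a.
    rewrite /A1 big_filter big_mkcond /=; apply: ler_sum => a _.
    by case: ifP => // _; case/andP: (blweight_itv a r0).
  by lra.
exists (map (@cabs R) (A1 ++ B)); split.
  by rewrite size_map size_cat natrD; lra.
move=> z Xz z2X zxs; set S := \sum_(x <- _) _; set Y := 100 * _ * _ => Y1.
have SE : S = \sum_(a <- A1) `|cabs z - cabs a|^-1 + \sum_(b <- B) `|cabs z - cabs b|^-1.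
  by rewrite /S big_map big_cat.
have nz c : c \in A1 ++ B -> 0 < `|cabs z - cabs c|.
  move=> cAB; rewrite normr_gt0 subr_eq0; apply/eqP => E.
  by move: zxs; rewrite E map_f.
have S10 : 0 <= \sum_(a <- A1) `|cabs z - cabs a|^-1 by apply: sumr_ge0 => a _; rewrite invr_ge0.
have S20 : 0 <= \sum_(b <- B) `|cabs z - cabs b|^-1 by apply: sumr_ge0 => a _; rewrite invr_ge0.
have WX : 0 < W / X by rewrite divr_gt0//; lra.
have S8 : 100 * cabs eta * S <= 1 / 8.
  apply: le_trans Y1; rewrite /Y ler_wpM2l ?mulr_ge0 ?cabs_ge0//; lra.
(* A single term of the sum satisfies 100 |eta| / ||z| - |b|| <= 1/8, so |b| is farther than |eta|
   from |z|; this excludes both z and z + eta from B. *)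
have far b : b \in B -> cabs eta < `|cabs z - cabs b|.
  move=> bB; have nb := nz b; rewrite mem_cat bB orbT in nb.
  have h1 : `|cabs z - cabs b|^-1 <= S.
    rewrite SE (perm_big _ (perm_to_rem bB)) /= big_cons.
    have : 0 <= \sum_(b0 <- rem b B) `|cabs z - cabs b0|^-1 by apply: sumr_ge0 => a _; rewrite invr_ge0.
    lra.
  have h2 : 100 * cabs eta * `|cabs z - cabs b|^-1 <= 1 / 8.
    by apply: le_trans S8; rewrite ler_wpM2l// mulr_ge0 ?cabs_ge0.
  rewrite ler_pdivrMr in h2; last exact: nb.
  by lra.
have zB : z \notin B.
  by apply/negP => zB; have := far _ zB; rewrite subrr normr0; lra.
have zeB : z + eta \notin B.
  apply/negP => /far; have := cabs_dist z (z + eta); rewrite opprD addNKr cabsN; lra.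
have zA : z \notin A.
  apply/negP => zA; have := nz z; rewrite subrr normr0 ltxx mem_cat mem_filter zA andbT.
  by rewrite (_ : cabs z <= 4 * X) /=; [move=> /(_ isT)|lra].
have zr : cabs z <= r / 4 by lra.
have zer : cabs (z + eta) <= r / 4 by have := cabsD z eta; lra.
have er : cabs eta <= r / 16 by lra.
have := difference_quotient_estimate r0 rb Hh k1 Hc fE GE HU zr zer er zA zB zeB.
cbv zeta; set Y' := _ + _ + \sum_(b <- B) _.
have YY : Y' <= Y.
  have t1 : 600 * W * cabs eta / r <= 80 * cabs eta * (W / X).
    have h1 : W / r <= W / (10 * X) by rewrite ler_wpM2l ?lef_pV2 ?posrE; clear -W1 rX X0 r0; lra.
    have := ler_wpM2l (cabs_ge0 eta) h1; have := mulr_gt0 e0 WX; rewrite invfM; lra.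
  have t2 : \sum_(a <- A) 2 * cabs eta * blweight r a / cabs (z - a) <=
      2 * cabs eta * \sum_(a <- A1) `|cabs z - cabs a|^-1 + cabs eta / X * \sum_(a <- A) blweight r a.
    have k0 : 0 <= 2 * cabs eta by rewrite mulr_ge0 ?cabs_ge0.
    have nzA : {in A1, forall a, 0 < `|cabs z - cabs a|} by move=> a aA; apply: nz; rewrite mem_cat aA.
    have := sum_blweight_div_le r0 X0 k0 z2X nzA.
    by rewrite /A1 big_filter -mulf_div divff// mul1r.
  have t3 : \sum_(b <- B) 6 * cabs eta / cabs (z - b) <= 6 * cabs eta * \sum_(b <- B) `|cabs z - cabs b|^-1.
    apply: sum_inv_dist_le; first by rewrite mulr_ge0 ?cabs_ge0.
    by move=> b bB; apply: nz; rewrite mem_cat bB orbT.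
  have t4 : cabs eta / X * \sum_(a <- A) blweight r a <= 9 * cabs eta * (W / X).
    rewrite (_ : 9 * cabs eta * (W / X) = cabs eta / X * (9 * W)); last by ring.
    by rewrite ler_wpM2l ?divr_ge0 ?cabs_ge0 ?(ltW X0)//; lra.
  rewrite /Y' /Y SE.
  have := mulr_ge0 (ltW e0) S10; have := mulr_ge0 (ltW e0) S20; have := mulr_gt0 e0 WX.
  by lra.
have Y'0 : 0 <= Y'.
  apply: addr_ge0; [apply: addr_ge0|].
  - apply: divr_ge0; last exact: ltW.
    by apply: mulr_ge0; [clear -W1; lra|exact: cabs_ge0].
  - apply: sumr_ge0 => a _; have /andP[w0 w1] := blweight_itv a r0.
    by apply: divr_ge0; rewrite ?cabs_ge0// mulr_ge0// mulr_ge0 ?cabs_ge0.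
  - by apply: sumr_ge0 => b _; apply: divr_ge0; rewrite ?cabs_ge0// mulr_ge0 ?cabs_ge0.
move=> /(_ (le_trans YY Y1))[fz est]; split=> //.
- by apply: Bhol => //; clear -z2X X0; lra.
- by apply: Bhol => //; have := cabsD z eta; clear -z2X eX X0; lra.
apply: le_trans est _; apply: lerD.
  by rewrite lerXn2r ?nnegrE//; exact: le_trans YY.
have : 2 * cabs eta / r <= cabs eta / X.
  rewrite ler_pdivrMr// mulrAC ler_pdivlMr//.
  have : cabs eta * (2 * X) <= cabs eta * r.
    by rewrite ler_wpM2l ?cabs_ge0//; clear -rX X0; lra.
  by move=> q; clear -q; lra.
move=> t1; apply: ler_pM => //.
by rewrite divr_ge0 ?mulr_ge0 ?cabs_ge0 ?(ltW r0).
Qed.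

End GrowthBounds.

(** * Exceptional radii *)

Section ExceptionalSets.
Variable R : realType.
Implicit Types (r x t lam : R) (xs : seq R) (k : nat).
Local Notation mu := (@lebesgue_measure R).

(** The term with 2^m <= t < 2^(m+1) alone dominates 1/t, and the last summand takes over when t >=
    2^k. *)
Lemma inv_le_dyadic k t : 1 <= t ->
  t^-1 <= \sum_(m < k) (2 ^+ m)^-1 * (t < 2 ^+ m.+1)%R%:R + (2 ^+ k)^-1.
Proof.
move=> t1; elim: k => [|k IH]; first by rewrite big_ord0 add0r expr0 invr1 invf_le1//; lra.
rewrite big_ord_recr /=; have p0 : 0 < (2 : R) ^+ k.+1 by rewrite exprn_gt0.
have [tk|kt] := ltP t (2 ^+ k.+1).
  rewrite mulr1; apply: le_trans IH _; rewrite lerDl invr_ge0 ltW//.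
rewrite mulr0 addr0; apply: (@le_trans _ _ (2 ^+ k.+1)^-1).
  by rewrite lef_pV2 ?posrE//; lra.
by rewrite lerDr sumr_ge0// => m _; rewrite mulr_ge0// invr_ge0 exprn_ge0.
Qed.

Let near_itv x t : set (measurableTypeR R) := `]x - t, x + t[%classic.

Let measurable_near_itv x t : measurable (near_itv x t).
Proof. exact: measurable_itv. Qed.

Let measure_near_itv x t : 0 < t -> mu (near_itv x t) = (2 * t)%:E.
Proof.
move=> t0; rewrite /near_itv lebesgue_measure_itv /= lte_fin ifT; last by lra.
by rewrite -EFinB; congr (_%:E); ring.
Qed.

Let measurable_near_seq xs t : measurable (\bigcup_(x in [set` xs]) near_itv x t).
Proof. by apply: fin_bigcup_measurable => // x _; exact: measurable_near_itv. Qed.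

Let measure_near_seq xs t : 0 < t ->
  (mu (\bigcup_(x in [set` xs]) near_itv x t) <= ((size xs)%:R * (2 * t))%:E)%E.
Proof.
move=> t0; elim: xs => [|x xs IH].
  by rewrite bigcup_seq big_nil measure0 mul0r.
rewrite bigcup_seq big_cons -bigcup_seq /= -natr1 mulrDl mul1r [X in X%:E]addrC EFinD.
apply: le_trans (measureU2 _ _ _) _; [exact: measurable_near_itv|exact: measurable_near_seq|].
by apply: leeD => //; rewrite -(measure_near_itv x t0).
Qed.

Let weight k x r : R := \sum_(m < k) (2 ^+ m)^-1 * \1_(near_itv x (2 ^+ m.+1)) r + (2 ^+ k)^-1.

Let weight_ge0 k x r : 0 <= weight k x r.
Proof.
by rewrite addr_ge0 ?invr_ge0 ?exprn_ge0// sumr_ge0.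
Qed.

Let measurable_weight k x (D : set (measurableTypeR R)) : measurable_fun D (weight k x).
Proof.
apply: measurable_funD => //; apply: measurable_sum => m.
by apply: measurable_funM => //; apply: measurable_indic; exact: measurable_near_itv.
Qed.

Let weightP k x r : 1 <= `|r - x| -> `|r - x|^-1 <= weight k x r.
Proof.
move=> h; apply: le_trans (inv_le_dyadic k h) _; rewrite lerD2r.
apply: ler_sum => m _; rewrite ler_wpM2l ?invr_ge0 ?exprn_ge0// indicE.
suff -> : (r \in near_itv x (2 ^+ m.+1)) = (`|r - x| < 2 ^+ m.+1) by [].
by rewrite /near_itv mem_setE in_itv /= distrC ltr_distl; lra.
Qed.

(** Each of the k steps has height 2^-m over an interval of length 4 * 2^m and contributes at most
    4; the constant 2^-k over an interval of length 2^k contributes 1. *)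
Let integral_weight k x :
  (\int[mu]_(r in `](2 ^+ k)%R, (2 ^+ k.+1)%R]) (weight k x r)%:E <= (4 * k%:R + 1)%:E)%E.
Proof.
set D : set (measurableTypeR R) := `]_, _]%classic.
have mD : measurable D by exact: measurable_itv.
have mI m : measurable_fun D (fun r => (((2 ^+ m)^-1 : R) * \1_(near_itv x (2 ^+ m.+1)) r)%:E).
  by apply/measurable_EFinP; apply: measurable_funM => //; apply: measurable_indic; exact: measurable_near_itv.
pose S (r : measurableTypeR R) : R := \sum_(m < k) (2 ^+ m)^-1 * \1_(near_itv x (2 ^+ m.+1)) r.
have I0 (r : measurableTypeR R) : D r -> (0 <= (S r)%:E)%E.
  by move=> _; rewrite lee_fin sumr_ge0.
have c0 (r : measurableTypeR R) : D r -> (0 <= ((2 ^+ k)^-1 : R)%:E)%E.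
  by move=> _; rewrite lee_fin invr_ge0 exprn_ge0.
have mS : measurable_fun D (EFin \o S).
  apply/measurable_EFinP; apply: measurable_sum => m.
  by apply: measurable_funM => //; apply: measurable_indic; exact: measurable_near_itv.
rewrite (eq_integral (fun r : measurableTypeR R => (S r)%:E + ((2 ^+ k)^-1)%:E)%E); last first.
  by move=> r _; rewrite -EFinD.
rewrite ge0_integralD//.
rewrite EFinD; apply: leeD; last first.
  have muD : mu D = (2 ^+ k)%:E.
    rewrite /D lebesgue_measure_itv /= lte_fin ltr_eXn2l ?ltr1n// ltnSn.
    by rewrite -EFinB exprS mulrDl mul1r addrK.
  rewrite integral_cst//; apply: (@le_trans _ _ (((2 ^+ k)^-1)%:E * mu D)%E) => //.
  by rewrite muD -EFinM lee_fin mulVf// expf_neq0.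
under eq_integral do rewrite -sumEFin.
rewrite ge0_integral_sum//.
have -> : (4 * k%:R)%:E = (\sum_(m < k) 4%:E)%E :> \bar R.
  by rewrite sumEFin sumr_const card_ord mulr_natr.
apply: lee_sum => m _; under eq_integral do rewrite EFinM.
rewrite ge0_integralZl_EFin//; last first.
  by apply/measurable_EFinP; apply: measurable_indic; exact: measurable_near_itv.
rewrite integral_indic//.
have mn := measurable_near_itv x (2 ^+ m.+1).
apply: (@le_trans _ _ (((2 ^+ m)^-1)%:E * mu (near_itv x (2 ^+ m.+1)))%E).
  rewrite lee_wpmul2l ?lee_fin ?invr_ge0 ?exprn_ge0//.
  by rewrite le_measure ?inE//; exact: measurableI.
rewrite measure_near_itv ?exprn_gt0// -EFinM lee_fin exprS mulrCA (mulrCA _ 2) mulVf ?expf_neq0//.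
by lra.
Qed.

(* Outside the unit intervals around the points, 1 / |r - x| is dominated by a
   dyadic step function, whose integral is O(k) instead of diverging; Markov's
   inequality then bounds the set where the sum is large. *)
Lemma exceptional_scale xs k lam : 0 < lam -> exists E : set (measurableTypeR R),
  [/\ measurable E, E `<=` `]2 ^+ k, 2 ^+ k.+1]%classic,
    (mu E <= ((size xs)%:R * (2 + (4 * k%:R + 1) / lam))%:E)%E &
    forall r, 2 ^+ k < r -> r <= 2 ^+ k.+1 -> ~ E r ->
      r \notin xs /\ \sum_(x <- xs) `|r - x|^-1 <= lam].
Proof.
move=> lam0; set D : set (measurableTypeR R) := `]_, _]%classic.
have mD : measurable D by exact: measurable_itv.
pose g r := \sum_(x <- xs) weight k x r.
have g0 r : 0 <= g r by apply: sumr_ge0 => x _; exact: weight_ge0.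
have mg (A : set (measurableTypeR R)) : measurable_fun A g by apply: measurable_sum => x; exact: measurable_weight.
pose N := \bigcup_(x in [set` xs]) near_itv x 1.
pose H := D `&` [set r | (lam%:E <= `|(g r)%:E|)%E].
have mN : measurable N by exact: measurable_near_seq.
have mH : measurable H.
  apply: emeasurable_fun_c_infty => //; apply: (measurableT_comp (f := @abse R)) => //.
  by apply/measurable_EFinP.
exists ((D `&` N) `|` H); split.
- by apply: measurableU => //; exact: measurableI.
- by move=> r [[]|[]].
- apply: le_trans (measureU2 _ _ _) _ => //; first exact: measurableI.
  rewrite mulrDr EFinD; apply: leeD.
    apply: (@le_trans _ _ (mu N)); first by rewrite le_measure ?inE//; exact: measurableI.
    by have := @measure_near_seq xs 1 ltr01; rewrite mulr1.
  have := @le_integral_comp_abse _ _ _ mu D mD (EFin \o g) lam id.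
  move=> /(_ _ _ _ _ lam0) => K.
  have {K} : (lam%:E * mu H <= \int[mu]_(r in D) `|(g r)%:E|)%E.
    by apply: K => //; exact/measurable_EFinP.
  under eq_integral do rewrite gee0_abs ?lee_fin//.
  have -> : (\int[mu]_(r in D) (g r)%:E = \sum_(x <- xs) \int[mu]_(r in D) (weight k x r)%:E)%E.
    under eq_integral do rewrite -sumEFin.
    rewrite ge0_integral_sum//; first by move=> x; exact/measurable_EFinP.
    by move=> x r _; rewrite lee_fin weight_ge0.
  move=> K; rewrite mulrA EFinM lee_pdivlMr//.
  rewrite muleC; apply: le_trans K _.
  have -> : ((size xs)%:R * (4 * k%:R + 1))%:E = (\sum_(x <- xs) (4 * k%:R + 1)%:E)%E :> \bar R.
    by rewrite sumEFin big_const_seq count_predT iter_addr_0 mulr_natl.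
  by apply: lee_sum => x _; exact: integral_weight.
- move=> r r1 r2 nE; have Dr : D r by rewrite /D /= in_itv /= r1.
  have far x : x \in xs -> 1 <= `|r - x|.
    move=> xxs; rewrite leNgt; apply/negP => h; apply: nE; left; split=> //; exists x => //.
    by move: h; rewrite /near_itv /= in_itv /= distrC ltr_distl; lra.
  split; first by apply/negP => /far; rewrite subrr normr0; lra.
  apply: (@le_trans _ _ (g r)).
    by rewrite /g big_seq [leRHS]big_seq; apply: ler_sum => x /far; exact: weightP.
  rewrite leNgt; apply/negP => h; apply: nE; right; split=> //=.
  by rewrite lee_fin ger0_norm// ltW.
Qed.

End ExceptionalSets.

(** * Summation of the exceptional sets over dyadic scales *)

Section ExceptionalUnion.
Variable R : realType.
Implicit Types (r x : R) (k : nat).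
Local Notation mu := (@lebesgue_measure R).

Lemma ln_le_powR x (d : R) : 0 < x -> 0 < d -> ln x <= x `^ d / d.
Proof.
move=> x0 d0; rewrite ler_pdivlMr// mulrC -ln_powR.
by apply/ltW/ln_sublinear; exact: powR_gt0.
Qed.

Lemma le1_powR x (d : R) : 1 <= x -> 0 <= d -> 1 <= x `^ d.
Proof. by move=> x1 d0; rewrite -[leLHS](powRr0 x) ler_powR. Qed.

Lemma dyadic_index r : 1 < r -> exists2 k, 2 ^+ k < r & r <= 2 ^+ k.+1.
Proof.
move=> r1; have ex : exists n, r <= 2 ^+ n.
  by exists (Num.bound r); apply/ltW; exact: upper_nthrootP.
case: (ex_minnP ex) => -[|n] rn mn; first by move: rn; rewrite expr0; lra.
by exists n => //; rewrite ltNge; apply/negP => /mn; rewrite ltnn.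
Qed.

Lemma measurable_inv_gt0 (D : set (measurableTypeR R)) : D `<=` [set r | 0 < r] ->
  measurable_fun D (fun r : measurableTypeR R => (r^-1)%:E).
Proof.
move=> D0; apply: (measurable_funS (E := [set r : measurableTypeR R | 0 < r])) => //.
  have -> : [set r : measurableTypeR R | 0 < r] = `]0, +oo[%classic by rewrite set_itvoy.
  exact: measurable_itv.
apply/measurable_EFinP; apply: open_continuous_measurable_fun; first exact: open_gt.
by move=> r; rewrite inE /= => r0; apply: inv_continuous; rewrite gt_eqF.
Qed.

Lemma integral_inv_le (E : set (measurableTypeR R)) (a c : R) : 0 < a -> measurable E ->
  E `<=` [set r | a < r] -> (mu E <= (c * a)%:E)%E ->
  (\int[mu]_(r in E) (r^-1)%:E <= c%:E)%E.
Proof.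
move=> a0 mE Ea Ec; apply: (@le_trans _ _ (\int[mu]_(r in E) cst (a^-1)%:E r)%E).
  apply: ge0_le_integral => //.
  - by move=> r /Ea /= ar; rewrite lee_fin invr_ge0; lra.
  - by apply: measurable_inv_gt0 => r /Ea /=; lra.
  - by move=> r /Ea /= ar; rewrite lee_fin lef_pV2 ?posrE//; lra.
rewrite integral_cst// muleC; apply: (@le_trans _ _ ((c * a)%:E * (a^-1)%:E)%E).
  by rewrite lee_wpmul2r// lee_fin invr_ge0 ltW.
by rewrite -EFinM mulfK// gt_eqF.
Qed.

Lemma nneseries_geometric_lty (c q : R) : 0 <= c -> 0 < q -> q < 1 ->
  (\sum_(0 <= k <oo) (c * q ^+ k)%:E < +oo)%E.
Proof.
move=> c0 q0 q1; apply: (@le_lt_trans _ _ (c / (1 - q))%:E); last exact: ltry.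
apply: lime_le; first by apply: is_cvg_nneseries => n _ _; rewrite lee_fin mulr_ge0// exprn_ge0// ltW.
apply: nearW => n; rewrite sumEFin lee_fin.
by have := @geometric_le_lim R n c q c0 q0; rewrite ger0_norm ?(ltW q0)//; exact.
Qed.

Lemma exceptional_union (xs : nat -> seq R) (C a b : R) k0 : 0 <= C -> b <= 0 -> a < b + 1 ->
  (forall k, (k0 <= k)%N -> (size (xs k))%:R <= C * (2 ^+ k) `^ a) ->
  exists E : set R, [/\ E `<=` [set r | 1 < r], finite_log_measure E &
    forall r, 1 < r -> ~ E r -> exists k,
      [/\ (k0 <= k)%N, 2 ^+ k < r, r <= 2 ^+ k.+1, r \notin xs k &
       \sum_(x <- xs k) `|r - x|^-1 <= (2 ^+ k) `^ b]].
Proof.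
(* d is half the slack: a - b = 1 - 2 d, so the exceptional set at scale X = 2^k has measure O(k
   X^(1 - 2d)). One X^d absorbs the factor k, and dividing by X leaves X^(-d) = q^k, a geometric
   series. *)
move=> C0 b0 ab Hxs; pose d := (b + 1 - a) / 2; have d0 : 0 < d by rewrite /d; lra.
pose X k : R := 2 ^+ k.
have X0 k : 0 < X k by rewrite exprn_gt0.
have X1 k : 1 <= X k by rewrite exprn_ege1// ler1n.
have XS k : X k.+1 = 2 * X k by rewrite /X exprS.
pose q : R := 2 `^ (- d); have q0 : 0 < q by exact: powR_gt0.
have qE k : (X k) `^ (- d) = q ^+ k.
  by rewrite /q /X -powR_mulrn// -!powRrM mulrC powRrM powR_mulrn ?powR_ge0.
have ln2 : 0 < ln (2 : R) by apply: ln_gt0; rewrite ltr1n.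
have q1 : q < 1.
  by rewrite /q /powR pnatr_eq0 /= -[ltRHS]expR0 ltr_expR mulNr oppr_lt0 mulr_gt0.
have kX k : k%:R <= (X k) `^ d / (d * ln 2).
  have := ln_le_powR (X0 k) d0; rewrite /X lnXn// -[ln 2 *+ k]mulr_natl => h.
  by rewrite invfM mulrA ler_pdivlMr.
(* Scales k < k0 are excluded entirely: their logarithmic measure is at most 1, hence at most q^k /
   q^k0, which is what the second summand of c provides. *)
pose c1 := C * (3 + 4 / (d * ln 2)); pose c := c1 + (q ^+ k0)^-1.
have c10 : 0 <= c1 by rewrite mulr_ge0// addr_ge0// divr_ge0// mulr_ge0// ltW.
have qk0 : 0 < (q ^+ k0)^-1 by rewrite invr_gt0 exprn_gt0.
have c0 : 0 <= c by rewrite /c addr_ge0// ltW.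
have /choice[E HE] : forall k, exists E : set (measurableTypeR R),
    [/\ measurable E, E `<=` `](X k), (X k.+1)]%classic,
      (\int[mu]_(r in E) (r^-1)%:E <= (c * q ^+ k)%:E)%E &
      forall r, X k < r -> r <= X k.+1 -> ~ E r ->
       [/\ (k0 <= k)%N, r \notin xs k & \sum_(x <- xs k) `|r - x|^-1 <= (X k) `^ b]].
  move=> k; have qk : 0 < q ^+ k by rewrite exprn_gt0.
  have [kk|kk] := leqP k0 k; last first.
    exists `](X k), (X k.+1)]%classic; split=> //.
      apply: (integral_inv_le (X0 k)); first exact: measurable_itv.
        by move=> r /=; rewrite in_itv /= => /andP[].
      rewrite lebesgue_measure_itv /= lte_fin XS ifT; last by have := X0 k; lra.
      rewrite -EFinB lee_fin (_ : 2 * X k - X k = 1 * X k); last by ring.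
      rewrite ler_wpM2r// ?(ltW (X0 k))//.
      have : 1 <= (q ^+ k0)^-1 * q ^+ k.
        by rewrite mulrC ler_pdivlMr ?exprn_gt0// mul1r; apply: (ler_wiXn2l (ltW q0) (ltW q1)); exact: ltnW.
      by have := mulr_ge0 c10 (ltW qk); rewrite /c; lra.
    by move=> r r1 r2 []; rewrite /= in_itv /= r1.
  have [E [mE sE muE HE]] := exceptional_scale (xs k) k (powR_gt0 b (X0 k)).
  exists E; split=> //; last by move=> r r1 r2 /(HE _ r1 r2)[].
  apply: (integral_inv_le (X0 k)) => //.
    by move=> r /sE /=; rewrite in_itv /= => /andP[].
  apply: le_trans muE _; rewrite lee_fin.
  apply: (@le_trans _ _ (C * X k `^ a * (X k `^ (- b) * (4 * k%:R + 3)))).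
    apply: ler_pM => //; [by rewrite addr_ge0// divr_ge0 ?powR_ge0// addr_ge0// mulr_ge0|exact: Hxs|].
    have h : 1 <= X k `^ (- b) by apply: le1_powR => //; lra.
    by rewrite -powRN; lra.
  rewrite (_ : _ * _ = C * (X k `^ a * X k `^ (- b)) * (4 * k%:R + 3)); last by ring.
  have xn : X k != 0 by rewrite gt_eqF.
  rewrite -powRD; last by rewrite xn implybT.
  rewrite (_ : a - b = 1 + (- d + - d)); last by rewrite /d; field.
  rewrite !powRD ?xn ?implybT// powRr1 ?(ltW (X0 k))// qE.
  have dd : X k `^ d * q ^+ k = 1 by rewrite -qE powRN mulfV// gt_eqF// powR_gt0.
  have k3 : q ^+ k * (4 * k%:R + 3) <= 3 + 4 / (d * ln 2).
    have := ler_wpM2l (ltW qk) (kX k).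
    have : q ^+ k <= 1 by rewrite exprn_ile1// ltW.
    rewrite (_ : q ^+ k * (_ / _) = X k `^ d * q ^+ k / (d * ln 2)); last by ring.
    by rewrite dd; lra.
  rewrite (_ : C * _ * _ = C * (q ^+ k * (4 * k%:R + 3)) * q ^+ k * X k); last by ring.
  rewrite ler_wpM2r ?(ltW (X0 k))// ler_wpM2r ?(ltW qk)//.
  apply: (@le_trans _ _ c1); last by rewrite /c; lra.
  by rewrite ler_wpM2l.
have E1 k r : E k r -> X k < r /\ r <= X k.+1.
  by case: (HE k) => _ sE _ _ /sE /=; rewrite in_itv /= => /andP[].
have mE k : measurable (E k) by case: (HE k).
have Epos k r : E k r -> 1 < r by move=> /E1[h _]; apply: le_lt_trans h.
exists (\bigcup_k E k); split.
- by move=> r [k _ /Epos].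
- split; first exact: bigcup_measurable.
  rewrite ge0_integral_bigcup//.
  + apply: le_lt_trans (nneseries_geometric_lty c0 q0 q1).
    apply: lee_nneseries => [k _ _|k _]; last by case: (HE k).
    by apply: integral_ge0 => r /Epos r1; rewrite lee_fin invr_ge0; lra.
  + by apply: measurable_inv_gt0 => r [k _ /Epos] /=; lra.
  + by move=> r [k _ /Epos r1]; rewrite lee_fin invr_ge0; lra.
  + apply/trivIsetP => i j _ _; apply: contra_neqP => /eqP/set0P[r [/E1[i1 i2] /E1[j1 j2]]].
    have lt m n : X m < X n.+1 -> (m <= n)%N by rewrite /X ltr_eXn2l ?ltr1n.
    by apply/eqP; rewrite eqn_leq !lt// (lt_le_trans _ i2, lt_le_trans _ j2).
- move=> r r1 nE; have [k k1 k2] := dyadic_index r1.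
  have nEk : ~ E k r by move=> h; apply: nE; exists k.
  by exists k; case: (HE k) => _ _ _ /(_ r k1 k2 nEk)[].
Qed.

End ExceptionalUnion.

(** * Estimates with constants independent of the scale *)

Section ScaleBound.
Variable R : realType.
Implicit Types (f : R[i] -> R[i]) (z eta : R[i]).

(** The given point may be a pole, where the value of f is arbitrary. In that case a point at
    distance m/2 serves, so close that g is still nonzero there, with a disc that avoids the
    pole. *)
Lemma regular_point f : meromorphic f -> (exists z, f z != 0) ->
  exists z1 (d : R), [/\ 0 < d, forall w, cabs (w - z1) < d -> cdiff f w & f z1 != 0].
Proof.
move=> mf [z0 fz0]; have [/holomorphic_atP[d d0 H]|[n /has_poleP[g [d [n0 d0 gz Hg Hf]]]]] := mf z0.
  by exists z0, d.
have /ccontP cg : ccont g z0 by apply/cdiff_ccont/Hg; rewrite subrr cabs0.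
have g2 : 0 < cabs (g z0) / 2 by rewrite divr_gt0 ?cabs_gt0.
have [d1 d10 H1] := cg _ g2.
pose m := Num.min d d1; have m0 : 0 < m by rewrite lt_min d0.
have md : m <= d by rewrite ge_min lexx.
have md1 : m <= d1 by rewrite ge_min lexx orbT.
pose w := z0 + (m / 2)%:C.
have wz : cabs (w - z0) = m / 2 by rewrite /w addrC addKr cabs_real_ge0//; lra.
have off v : cabs (v - w) < m / 2 -> v != z0 /\ cabs (v - z0) < d.
  move=> vw; split.
    by apply/eqP => E; move: vw; rewrite E cabsBC wz ltxx.
  by have := cabsD (v - w) (w - z0); rewrite addrA subrK wz; lra.
have wP : w != z0 by rewrite -subr_eq0 -cabs_gt0 wz; lra.
exists w, (m / 2); split; first by lra.
- move=> v vw; have [vz vd] := off v vw.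
  have t0 : 0 < m / 2 - cabs (v - w) by rewrite subr_gt0.
  apply: (@cdiff_eq _ (fun u => g u * ((u - z0) ^+ n)^-1) _ _ _ t0).
    move=> u uv; have [|uz ud] := off u; last by rewrite Hf.
    by have := cabsD (u - v) (v - w); rewrite addrA subrK; lra.
  apply: cdiffM; first exact: Hg.
  apply: cdiffV; first by rewrite expf_neq0// subr_eq0.
  by apply/cdiffX/cdiffB; [exact: cdiff_id|exact: cdiff_cst].
- rewrite Hf ?wz//; last by lra.
  rewrite mulf_neq0 ?invr_eq0 ?expf_neq0 ?subr_eq0// -cabs_gt0.
  have := H1 w; rewrite wz => /(_ _); have -> : m / 2 < d1 by lra.
  move=> /(_ isT); have := cabsD (g z0 - g w) (g w); rewrite subrK [cabs (g z0 - g w)]cabsBC.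
  by move: g2; lra.
Qed.

Lemma scale_bound f (sigma e : R) eta : meromorphic f -> (exists z, f z != 0) ->
  order_of_growth f = sigma%:E -> 0 < e -> eta != 0 ->
  exists C X0 : R, [/\ 0 < C, 1 <= X0 & forall X : R, X0 <= X ->
    exists xs : seq R, (size xs)%:R <= C * X `^ (sigma + e) /\
    forall z, X <= cabs z -> cabs z <= 2 * X -> cabs z \notin xs ->
      let Y := C * (X `^ (sigma + e - 1) + \sum_(x <- xs) `|cabs z - x|^-1) in
      Y <= 1 / 8 ->
      [/\ holomorphic_at f z, holomorphic_at f (z + eta), f z != 0 &
        cabs ((f (z + eta) - f z) / f z - eta * (cderiv f z / f z)) <= Y ^+ 2 + C / X * Y]].
Proof.
move=> mf f0 Ho e0 eta0; have [z1 [d [d0 df fz1]]] := regular_point mf f0.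
have h0 : 0 < cabs eta by rewrite cabs_gt0.
have s0 := order_ge0 Ho; have e2 : 0 < e / 2 by lra.
have [r0 r01 HT] := order_growth Ho e2.
(* Half of e is spent on the growth of the characteristic, the other half on the logarithm ln (22 X
   / d). *)
pose s := sigma + e / 2; have sp : 0 <= s by rewrite /s; lra.
pose p0 : R := (pole_mult f 0)%:R; have p00 : 0 <= p0 by exact: ler0n.
pose K := `|ln (cabs (f z1))|; have K0 : 0 <= K by exact: normr_ge0.
pose L := `|ln (22 / d)|; have L0 : 0 <= L by exact: normr_ge0.
pose C1 := (p0 + 2) * 32 `^ s * (1 + K + L + (e / 2)^-1).
have ei : 0 < (e / 2)^-1 by rewrite invr_gt0.
have C10 : 0 < C1.
  by apply: mulr_gt0; [apply: mulr_gt0; [lra|exact: powR_gt0]|lra].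
have hC : 0 < cabs eta * C1 by exact: mulr_gt0.
(* The summand 13 C1 bounds the number of points, the second one the term W / X, and the third one
   the sum over xs; together they also dominate |eta| in the linear term. *)
exists (13 * C1 + 100 * (cabs eta * C1) + 100 * cabs eta), (2 + d + cabs z1 + 2 * cabs eta + r0).
set C := 13 * C1 + _ + _; have z10 := cabs_ge0 z1.
split; [by rewrite /C; lra|lra|move=> X hX].
have X1 : 1 <= X by lra.
have X0 : 0 < X by lra.
have Xn : X != 0 by rewrite gt_eqF.
(* Counting the poles up to 16 X requires the characteristic at twice that radius. *)
pose P := (32 * X) `^ s.
have T_le r : r0 < r -> r <= 32 * X -> (nevanlinna_char f r <= P%:E)%E.
  move=> rr rX; apply: le_trans (HT _ rr) _; rewrite lee_fin.
  by apply: ge0_ler_powR => //; rewrite nnegrE; lra.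
have P1 : 1 <= P by apply: le1_powR => //; lra.
have M1 : 1 <= p0 + 2 * P by lra.
have prox r : 10 * X < r -> r < 11 * X -> (proximity f r <= (p0 + 2 * P)%:E)%E.
  move=> r1 r2; apply: le_trans (proximity_le_char f _) _; first by lra.
  by apply: le_trans (T_le _ _ _) _; [lra|lra|rewrite lee_fin; lra].
have poles : (npoles f (16 * X) <= (p0 + 2 * P)%:E)%E.
  by apply: npoles_le_char; [lra|apply: T_le; lra].
have [dX X2 zX eX] : [/\ d <= X, 2 <= X, cabs z1 <= X & 2 * cabs eta <= X].
  by split; clear -hX z10 h0 d0 r01; lra.
have [xs []] := scale_estimate mf df fz1 d0 dX X2 zX h0 eX M1 prox poles.
set W := (p0 + 2 * P) * _ => sxs est.
have W_le : W <= C1 * X `^ (sigma + e).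
  have XE : X `^ (sigma + e) = X `^ s * X `^ (e / 2).
    by rewrite -powRD ?Xn ?implybT//; congr (_ `^ _); rewrite /s; field.
  have PE : P = 32 `^ s * X `^ s by rewrite /P powRM//; lra.
  have x1 : 1 <= X `^ (e / 2) by apply: le1_powR; clear -X1 e2; lra.
  have lnE : ln (22 * X / d) <= L + (e / 2)^-1 * X `^ (e / 2).
    rewrite mulrAC lnM ?posrE ?divr_gt0//; apply: lerD; first exact: ler_norm.
    by rewrite mulrC; exact: ln_le_powR.
  rewrite XE (_ : C1 * _ = ((p0 + 2) * P) * ((1 + K + L + (e / 2)^-1) * X `^ (e / 2))); last first.
    by rewrite PE /C1; ring.
  have ln0 : 0 <= ln (22 * X / d) by apply: ln_ge0; rewrite ler_pdivlMr//; lra.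
  rewrite /W -/K; apply: ler_pM; [clear -p00 P1; lra|clear -K0 ln0; lra| |].
    by have := ler_wpM2l p00 P1; lra.
  have : 0 <= (1 + K + L) * (X `^ (e / 2) - 1) by apply: mulr_ge0; clear -K0 L0 x1; lra.
  by lra.
have eW : cabs eta * W <= cabs eta * C1 * X `^ (sigma + e) by rewrite -mulrA ler_wpM2l// ltW.
have XX : 0 < X `^ (sigma + e) by exact: powR_gt0.
exists xs; split.
  apply: le_trans sxs _; have := mulr_gt0 hC XX; have := mulr_gt0 h0 XX.
  by rewrite /C; lra.
move=> z z1' z2 zxs; set S := \sum_(x <- xs) _; cbv zeta; set Y := C * _ => Y1.
have S0 : 0 <= S by apply: sumr_ge0 => x _; rewrite invr_ge0.
set Y' := 100 * cabs eta * (W / X + S).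
have YY : Y' <= Y.
  have XE : X `^ (sigma + e - 1) = X `^ (sigma + e) / X.
    by rewrite powRD ?Xn ?implybT// powRN powRr1// ltW.
  have Xi : 0 < X^-1 by rewrite invr_gt0.
  have t1 := ler_wpM2r (ltW Xi) eW.
  have t2 := mulr_gt0 C10 (mulr_gt0 XX Xi).
  have t3 := mulr_gt0 h0 (mulr_gt0 XX Xi).
  have t4 := mulr_ge0 (ltW C10) S0; have t5 := mulr_ge0 (ltW hC) S0.
  by rewrite /Y' /Y XE /C; lra.
have Y'0 : 0 <= Y'.
  apply: mulr_ge0; first by clear -h0; lra.
  apply: addr_ge0 => //; apply: divr_ge0; last exact: ltW.
  by have := ler0n R (size xs); lra.
have [h1 h2 h3 h4] := est z z1' z2 zxs (le_trans YY Y1).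
split=> //; apply: le_trans h4 _; apply: lerD.
  by rewrite lerXn2r ?nnegrE//; exact: le_trans YY.
apply: ler_pM => //; first by rewrite divr_ge0// ltW.
by rewrite ler_wpM2r ?invr_ge0 ?(ltW X0)// /C; clear -C10 hC h0; lra.
Qed.

End ScaleBound.

(* The third clause of the conclusion says that both sides of the identity are
   defined at every z with |z| outside E and [0, 1]. *)
Theorem theorem4p1 (R : realType) (f : R[i] -> R[i]) (sigma : R) (eta : R[i])
    (f_mero : meromorphic f) (f_neq0 : exists z, f z != 0)
    (f_order : order_of_growth f = sigma%:E) (sigma_lt1 : sigma < 1)
    (eta_neq0 : eta != 0) (eps : R) (eps_gt0 : 0 < eps) :
  exists E : set R,
    [/\ E `<=` [set r | 1 < r], finite_log_measure E,
        (forall z, ~ (E `|` `[0, 1]) (cabs z) ->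
           [/\ holomorphic_at f z, holomorphic_at f (z + eta) & f z != 0]) &
        bigO_off (E `|` `[0, 1])
          (fun z => (f (z + eta) - f z) / f z - eta * (cderiv f z / f z))
          (fun r => r `^ (2 * sigma - 2 + eps))].
Proof.
have s0 := order_ge0 f_order.
(* The bound eps / 2 brings the final exponent 2 b below 2 sigma - 2 + eps; the bound (1 - sigma) /
   2 keeps b negative. *)
pose e := Num.min (eps / 2) ((1 - sigma) / 2).
have e0 : 0 < e by rewrite lt_min; apply/andP; split; lra.
have e_eps : e <= eps / 2 by rewrite ge_min lexx.
have e_sig : e <= (1 - sigma) / 2 by rewrite ge_min lexx orbT.
have e2 : 0 < e / 2 by lra.
(* Growth uses e/2 and the threshold uses e; the difference is the slack a < b + 1 that makes the
   logarithmic measures summable. *)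
pose a := sigma + e / 2; pose b := sigma - 1 + e.
have b0 : b < 0 by rewrite /b; lra.
have ab : a < b + 1 by rewrite /a /b; lra.
have [C [X0 [C0 X01 HX]]] := scale_bound f_mero f_neq0 f_order e2 eta_neq0.
(* Beyond this index 2^k exceeds (16 C)^(-1/b), which is equivalent to 2 C X^b < 1/8 for X = 2^k;
   this is where b < 0 makes Y small. *)
pose k0 := Num.bound (X0 + (16 * C) `^ (- b)^-1).
have big k : (k0 <= k)%N -> X0 <= 2 ^+ k /\ 2 * C * (2 ^+ k) `^ b <= 1 / 8.
  move=> /upper_nthrootP h; have p0 := powR_ge0 (16 * C) (- b)^-1.
  have X0' : 0 < (2 : R) ^+ k by rewrite exprn_gt0.
  split; first by lra.
  have h1 : 16 * C <= (2 ^+ k) `^ (- b).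
    have -> : 16 * C = ((16 * C) `^ (- b)^-1) `^ (- b).
      by rewrite -powRrM mulVf ?powRr1 ?oppr_eq0 ?lt_eqF//; lra.
    by apply: ge0_ler_powR; rewrite ?nnegrE//; lra.
  have p1 := powR_gt0 b X0'; have := ler_wpM2r (ltW p1) h1.
  by rewrite powRN mulVf ?gt_eqF//; lra.
have /choice[xs Hxs] : forall k, exists xs : seq R, (k0 <= k)%N ->
    (size xs)%:R <= C * (2 ^+ k) `^ a /\
    forall z, 2 ^+ k <= cabs z -> cabs z <= 2 * 2 ^+ k -> cabs z \notin xs ->
      let Y := C * ((2 ^+ k) `^ (a - 1) + \sum_(x <- xs) `|cabs z - x|^-1) in
      Y <= 1 / 8 ->
      [/\ holomorphic_at f z, holomorphic_at f (z + eta), f z != 0 &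
        cabs ((f (z + eta) - f z) / f z - eta * (cderiv f z / f z)) <= Y ^+ 2 + C / 2 ^+ k * Y].
  move=> k; have [kk|_] := leqP k0 k; last by exists [::].
  by have [xs H] := HX _ (big k kk).1; exists xs.
have [E [E1 Efin HE]] := exceptional_union (ltW C0) (ltW b0) ab (fun k kk => (Hxs k kk).1).
(* Y <= 2 C X^b gives 4 C^2 X^(2b) for Y^2 and 2 C^2 X^(2b) for the linear term; the powers of 2
   come from passing from X to |z|. *)
pose K := 6 * C ^+ 2 * (2 `^ (- b)) ^+ 2.
have K0 : 0 < K by rewrite /K !mulr_gt0 ?exprn_gt0 ?powR_gt0.
have main z : ~ (E `|` `[0, 1]) (cabs z) ->
    [/\ holomorphic_at f z, holomorphic_at f (z + eta), f z != 0 &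
      cabs ((f (z + eta) - f z) / f z - eta * (cderiv f z / f z)) <=
        K * cabs z `^ (2 * sigma - 2 + eps)].
  move=> nz; have z1 : 1 < cabs z.
    by rewrite ltNge; apply/negP => h; apply: nz; right; rewrite /= in_itv /= cabs_ge0.
  have nE : ~ E (cabs z) by move=> h; apply: nz; left.
  have [k [kk k1 k2 zxs hS]] := HE _ z1 nE.
  have [_ HC] := big k kk; have [_ H] := Hxs k kk.
  set X : R := 2 ^+ k in k1 k2 hS HC H; rewrite exprS -/X in k2.
  have X1 : 1 <= X by rewrite exprn_ege1// ler1n.
  have Xp : 0 < X by lra.
  move: (H z (ltW k1) k2 zxs); cbv zeta; set Y := C * _ => {}H.
  have Xb := powR_gt0 b Xp.
  have Y_le : Y <= 2 * C * X `^ b.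
    rewrite /Y (_ : 2 * C * X `^ b = C * (X `^ b + X `^ b)); last by ring.
    rewrite ler_wpM2l ?(ltW C0)// lerD// ler_powR//; rewrite /a /b; lra.
  have Y0 : 0 <= Y.
    apply: mulr_ge0; [exact: ltW|apply: addr_ge0; [exact: powR_ge0|]].
    by apply: sumr_ge0 => x _; rewrite invr_ge0.
  have [h1 h2 h3 h4] := H (le_trans Y_le HC); split=> //.
  apply: le_trans h4 _.
  (* As sigma >= 0, one has b >= -1, so the linear error (C / X) Y is no worse than the quadratic
     one. *)
  have Xi : X^-1 <= X `^ b.
    have -> : X^-1 = X `^ (- 1) by rewrite powRN powRr1// ltW.
    by rewrite ler_powR//; rewrite /b; lra.
  have t1 : Y ^+ 2 + C / X * Y <= 6 * C ^+ 2 * (X `^ b) ^+ 2.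
    have q1 : Y ^+ 2 <= (2 * C * X `^ b) ^+ 2 by rewrite lerXn2r ?nnegrE//; exact: le_trans Y_le.
    have q2 : C / X * Y <= C * X `^ b * (2 * C * X `^ b).
      apply: ler_pM => //; first by rewrite divr_ge0 ?ltW.
      by rewrite ler_wpM2l// ltW.
    by lra.
  apply: le_trans t1 _.
  (* Since b < 0, the upper bound |z| <= 2 X is the one that matters. *)
  have Xz : X `^ b <= 2 `^ (- b) * cabs z `^ b.
    have z0 : 0 < cabs z by lra.
    have h : cabs z `^ (- b) <= 2 `^ (- b) * X `^ (- b).
      by rewrite -powRM ?(ltW Xp)//; apply: ge0_ler_powR; rewrite ?nnegrE; clear -b0 z0 k2 Xp; lra.
    have := ler_wpM2r (ltW (mulr_gt0 Xb (powR_gt0 b z0))) h.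
    rewrite (powRN X) (powRN (cabs z)) mulrCA mulVf ?gt_eqF ?powR_gt0// mulr1.
    by rewrite -mulrA mulKf ?gt_eqF.
  have t2 : (X `^ b) ^+ 2 <= (2 `^ (- b)) ^+ 2 * cabs z `^ (2 * sigma - 2 + eps).
    apply: (@le_trans _ _ ((2 `^ (- b) * cabs z `^ b) ^+ 2)).
      by rewrite lerXn2r ?nnegrE ?powR_ge0 ?mulr_ge0 ?powR_ge0.
    rewrite exprMn ler_wpM2l ?sqr_ge0// expr2 -powRD; last first.
      by rewrite (gt_eqF (lt_trans ltr01 z1)) implybT.
    by rewrite ler_powR ?(ltW z1)//; rewrite /b; lra.
  by rewrite /K -[leRHS]mulrA; apply: ler_wpM2l t2; rewrite mulr_ge0 ?sqr_ge0.
exists E; split=> //; first by move=> z /main[].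
by exists 1, K; split=> // z _ /main[].
Qed.
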